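(* Let $(X,G)$ be a topological dynamical system, where $X$ is a compact metric space and $G$ is a countably infinite group with $|Z(F)|=\infty$ for every finite subset $F\subset G$. Let $\{F_n\}$ be a symmetric Følner sequence in $G$ such that $(G,\{F_n\})$ satisfies (WAFC) with respect to $L_G$. Let $m\in\mathbb N$, $d\in\mathbb N\cup\{0\}$, and let $(Y,G)$ be a factor of $(X,G)$. If $(Y,G)$ is free, $\dim(Y)\le d$ and ${\rm mdim}(X,G)<m/2$, then $${\rm edim}(X,G)\le Q:=(L_G(d+1)+1)m+1,$$ in other words, there is an embedding of $(X,G)$ into $(([0,1]^Q)^G,\sigma)$. In particular, this applies to the cases $G=\mathbb H_{2n+1}(\mathbb Z)\times G_1$, where $\mathbb H_{2n+1}(\mathbb Z)$ is the discrete Heisenberg group and $G_1$ is any of: a finite group, a finitely generated abelian group, a locally finite group, or a countable group satisfying (WAFC) with a symmetric Følner sequence.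
   Context: All groups are countable and discrete; $e$ is the identity. A topological dynamical system $(X,G)$ is an action of $G$ on a compact metric space $X$ by homeomorphisms $x\mapsto gx$; it is free if $gx\neq x$ for all $x\in X$ and all $g\ne e$. $(Y,G)$ is a factor of $(X,G)$ if there is a continuous surjection $\pi:X\to Y$ with $\pi(gx)=g\pi(x)$ for all $g,x$. $\dim$ is Lebesgue covering dimension. For $F\subset G$, $Z(F)=\{g\in G: gz=zg \text{ for all } z\in F\}$. A Følner sequence in $G$ is an increasing sequence $\{F_n\}_{n\ge1}$ of finite subsets of $G$ with $e\in F_n$ for all $n$, $\bigcup_n F_n=G$, and $\lim_n |gF_n\triangle F_n|/|F_n|=0$ for all $g\in G$. It is symmetric if $F_n=F_n^{-1}$ for all $n$. A finite subset $A\subset G$ is a (weakly) approximate group with respect to a natural number $L>0$ if $e\in A$ and there are $g_1,\dots,g_L\in G$ with $A^{-1}A\subset\bigcup_{i=1}^L g_iA$; the smallest such $L$ is denoted $L_A$. $(G,\{F_n\})$ satisfies (WAFC) with respect to the natural number $L_G$ if $\{F_n\}$ is a Følner sequence, every $F_n$ is an approximate group, and $L_{F_n}\le L_G$ for all $n\ge1$. Mean dimension: for a finite open cover $\mathcal U$ of $X$, ${\rm ord}(\mathcal U)=-1+\max_{x\in X}\sum_{O\in\mathcal U}1_O(x)$ and $D(\mathcal U)=\min{\rm ord}(\mathcal U')$ over finite open covers $\mathcal U'$ refining $\mathcal U$. For finite $A\subset G$, $\mathcal U_A=\bigvee_{g\in A}g^{-1}(\mathcal U)$. With a Følner sequence $\{F_n\}$,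 ${\rm mdim}(X,G)=\sup_{\mathcal U}\lim_{n\to\infty}D(\mathcal U_{F_n})/|F_n|$ over all finite open covers $\mathcal U$ (the limit exists and does not depend on $\{F_n\}$). Cubical shift: $\sigma$ is the action of $G$ on $([0,1]^Q)^G$ given by $(\sigma_g(x))_h=x_{hg}$. An embedding of systems is an equivariant topological embedding. ${\rm edim}(X,G)$ is the minimum of $Q\in\mathbb N$ such that $(X,G)$ embeds into $(([0,1]^Q)^G,\sigma)$, and $\infty$ if there is none. $\mathbb H_{2n+1}(\mathbb Z)$ is $\mathbb Z^n\times\mathbb Z^n\times\mathbb Z$ with $(a,b,c)(a',b',c')=(a+a',b+b',c+c'+a\cdot b')$. *)

(* Defs.v *)
From HB Require Import structures.
From mathcomp Require Import all_boot all_order all_algebra finmap ring.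
From mathcomp Require Import all_classical all_reals all_analysis.

Set Implicit Arguments.
Unset Strict Implicit.
Unset Printing Implicit Defensive.

Import Order.TTheory GRing.Theory Num.Theory.
Import numFieldNormedType.Exports.

Local Open Scope classical_set_scope.
Local Open Scope ring_scope.

Section Groups.
Variable G : groupType.
Local Open Scope group_scope.

Definition centralizer (S : {fset G}) : set G :=
  [set g | forall z, z \in S -> commute g z].

Definition is_subgroup (H : set G) : Prop :=
  H 1 /\ forall x y, H x -> H y -> H (x * y^-1).

Definition generated (S : {fset G}) : set G := smallest is_subgroup [set` S].

Definition finitely_generated : Prop :=
  exists S : {fset G}, generated S = [set: G].

Definition abelian_group : Prop := forall x y : G, commute x y.

Definition locally_finite : Prop :=
  forall S : {fset G}, finite_set (generated S).

Definition left_translate (g : G) (A : {fset G}) : {fset G} :=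
  [fset g * x | x in A]%fset.

Definition symdiff (A B : {fset G}) : {fset G} :=
  ((A `\` B) `|` (B `\` A))%fset.

(* A sequence F_1, F_2, ... is indexed here from 0. "Increasing" is
   non-strict, so that the constant sequence is allowed in a finite group. *)
Definition folner (R : realType) (F : nat -> {fset G}) : Prop :=
  [/\ forall n, (F n `<=` F n.+1)%fset,
      forall n, 1 \in F n,
      \bigcup_n [set` F n] = [set: G] &
      forall g : G,
        (fun n => (#|` symdiff (left_translate g (F n)) (F n)|%:R
                   / #|` F n|%:R)%R : R) @ \oo --> (0%R : R)].

Definition symmetric_seq (F : nat -> {fset G}) : Prop :=
  forall n, F n = [fset x^-1 | x in F n]%fset.

Definition approximate_group (A : {fset G}) (L : nat) : Prop :=
  [/\ (0 < L)%N, 1 \in A &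
      exists g : 'I_L -> G,
        [set x^-1 * y | x in [set` A] & y in [set` A]] `<=`
        \bigcup_(i in [set: 'I_L]) [set g i * z | z in [set` A]]].

(* The graph of A |-> L_A. *)
Definition approximate_const (A : {fset G}) (L : nat) : Prop :=
  approximate_group A L /\
  forall L' : nat, approximate_group A L' -> (L <= L')%N.

Definition WAFC (R : realType) (F : nat -> {fset G}) (LG : nat) : Prop :=
  folner R F /\
  forall n, exists L : nat, approximate_const (F n) L /\ (L <= LG)%N.

Definition group_hypotheses (R : realType) (F : nat -> {fset G}) (LG : nat) :
    Prop :=
  [/\ countable [set: G], infinite_set [set: G],
      forall S : {fset G}, infinite_set (centralizer S),
      symmetric_seq F & WAFC R F LG].

End Groups.

Section Covers.
Variables (R : realType) (X : topologicalType).
Implicit Types U V : set (set X).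

Definition finite_open_cover U : Prop :=
  [/\ finite_set U, forall O, U O -> open O & \bigcup_(O in U) O = [set: X]].

Definition refines V U : Prop :=
  forall O, V O -> exists2 O', U O' & O `<=` O'.

(* The order and [cover_dim] are integers >= -1 on finite open covers, so the
   [sup] and the [inf] below are a maximum and a minimum.  As [sup set0 = 0],
   the order is -1 when X is empty. *)
Definition cover_order U : R :=
  -1 + sup [set \sum_(O \in U) (\1_O x : R) | x in [set: X]].

Definition cover_dim U : R :=
  inf [set cover_order V | V in [set V | finite_open_cover V /\ refines V U]].

Definition covering_dimension : \bar R :=
  ereal_sup [set (cover_dim U)%:E | U in finite_open_cover].

End Covers.

Section Systems.
Variables (R : realType) (G : groupType).
Local Open Scope group_scope.

Definition is_system (X : metricType R) (act : G -> X -> X) : Prop :=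
  [/\ compact [set: X],
      forall x, act 1 x = x,
      forall g h x, act (g * h) x = act g (act h x) &
      forall g, continuous (act g)].

Definition is_free (X : Type) (act : G -> X -> X) : Prop :=
  forall (x : X) (g : G), g <> 1 -> act g x <> x.

Definition is_factor (X Y : topologicalType)
    (actX : G -> X -> X) (actY : G -> Y -> Y) : Prop :=
  exists pi : X -> Y,
    [/\ continuous pi, set_surj [set: X] [set: Y] pi &
        forall g x, pi (actX g x) = actY g (pi x)].

Definition dynamical_cover (X : topologicalType) (act : G -> X -> X)
    (U : set (set X)) (A : {fset G}) : set (set X) :=
  [set \bigcap_(g in [set` A]) (act g @^-1` f g) |
     f in [set f : G -> set X | forall g, g \in A -> U (f g)]].

Definition mdim (X : topologicalType) (act : G -> X -> X)
    (F : nat -> {fset G}) : \bar R :=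
  ereal_sup
    [set (limn (fun n => cover_dim R (dynamical_cover act U (F n))
                         / #|` F n|%:R)%R)%:E
      | U in @finite_open_cover X].

Definition unit_interval : topologicalType := set_type `[0%R, 1%R : R].

Definition cube (Q : nat) : topologicalType := {ptws 'I_Q -> unit_interval}.

Definition cubical_space (Q : nat) : topologicalType := {ptws G -> cube Q}.

Definition cubical_shift (Q : nat) (g : G) (x : cubical_space Q) :
    cubical_space Q :=
  fun h : G => x (h * g).

Definition topological_embedding (X Y : topologicalType) (f : X -> Y) : Prop :=
  [/\ injective f, continuous f &
      forall O : set X, open O ->
        exists2 O' : set Y, open O' & f @` O = O' `&` range f].

Definition embeds_in_cubical_shift (X : topologicalType) (act : G -> X -> X)
    (Q : nat) : Prop :=
  exists f : X -> cubical_space Q,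
    topological_embedding f /\
    forall g x, f (act g x) = cubical_shift g (f x).

(* The infimum is a minimum when the set is nonempty, and is +oo otherwise. *)
Definition edim (X : topologicalType) (act : G -> X -> X) : \bar R :=
  ereal_inf [set (Q%:R%R)%:E |
    Q in [set Q : nat | (0 < Q)%N /\ embeds_in_cubical_shift act Q]].

Definition edim_bound (F : nat -> {fset G}) (LG : nat) : Prop :=
  forall (X : metricType R) (actX : G -> X -> X)
         (Y : metricType R) (actY : G -> Y -> Y) (m d : nat),
    is_system actX -> is_system actY -> is_factor actX actY ->
    (0 < m)%N ->
    is_free actY ->
    (covering_dimension R Y <= (d%:R%R)%:E)%E ->
    (mdim actX F < (m%:R / 2)%R%:E)%E ->
    let Q := ((LG * (d + 1) + 1) * m + 1)%N in
    (edim actX <= (Q%:R%R)%:E)%E /\ embeds_in_cubical_shift actX Q.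

End Systems.

Record heisenberg (n : nat) : Type := Heisenberg {
  heis_a : 'rV[int]_n;
  heis_b : 'rV[int]_n;
  heis_c : int
}.

Section Heisenberg.
Variable n : nat.
Implicit Types x y z : heisenberg n.

Definition heis_to_triple x := (heis_a x, heis_b x, heis_c x).

Definition heis_of_triple (t : 'rV[int]_n * 'rV[int]_n * int) : heisenberg n :=
  Heisenberg t.1.1 t.1.2 t.2.

Lemma heis_to_tripleK : cancel heis_to_triple heis_of_triple.
Proof. by case. Qed.

HB.instance Definition _ :=
  Choice.copy (heisenberg n) (can_type heis_to_tripleK).

Definition dotz (a b : 'rV[int]_n) : int := \sum_(i < n) a 0 i * b 0 i.

Definition heis_mul x y : heisenberg n :=
  Heisenberg (heis_a x + heis_a y) (heis_b x + heis_b y)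
    (heis_c x + heis_c y + dotz (heis_a x) (heis_b y)).

Definition heis_one : heisenberg n := Heisenberg 0 0 0.

Definition heis_inv x : heisenberg n :=
  Heisenberg (- heis_a x) (- heis_b x) (- heis_c x + dotz (heis_a x) (heis_b x)).

Lemma dotzDl a b c : dotz (a + b) c = dotz a c + dotz b c.
Proof. by rewrite -big_split; apply: eq_bigr => i _; rewrite mxE mulrDl. Qed.

Lemma dotzDr a b c : dotz a (b + c) = dotz a b + dotz a c.
Proof. by rewrite -big_split; apply: eq_bigr => i _; rewrite mxE mulrDr. Qed.

Lemma dotz0l a : dotz 0 a = 0.
Proof. by apply: big1 => i _; rewrite mxE mul0r. Qed.

Lemma dotz0r a : dotz a 0 = 0.
Proof. by apply: big1 => i _; rewrite mxE mulr0. Qed.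

Lemma dotzNl a b : dotz (- a) b = - dotz a b.
Proof. by apply/eqP; rewrite -addr_eq0 -dotzDl addNr dotz0l. Qed.

Lemma dotzNr a b : dotz a (- b) = - dotz a b.
Proof. by apply/eqP; rewrite -addr_eq0 -dotzDr addNr dotz0r. Qed.

Lemma heis_mulA : associative heis_mul.
Proof.
move=> x y z; rewrite /heis_mul /= dotzDl dotzDr !addrA; congr Heisenberg.
by ring.
Qed.

Lemma heis_mul1x : left_id heis_one heis_mul.
Proof. by case=> a b c; rewrite /heis_mul /= dotz0l addr0 !add0r. Qed.

Lemma heis_mulx1 : right_id heis_one heis_mul.
Proof. by case=> a b c; rewrite /heis_mul /= dotz0r !addr0. Qed.

Lemma heis_mulVx : left_inverse heis_one heis_inv heis_mul.
Proof.
case=> a b c; rewrite /heis_mul /= dotzNl !addNr.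
by congr Heisenberg; ring.
Qed.

Lemma heis_mulxV : right_inverse heis_one heis_inv heis_mul.
Proof.
case=> a b c; rewrite /heis_mul /= dotzNr !addrN.
by congr Heisenberg; ring.
Qed.

HB.instance Definition _ := isGroup.Build (heisenberg n)
  heis_mulA heis_mul1x heis_mulx1 heis_mulVx heis_mulxV.

End Heisenberg.

(* Main.v *)
Require Import Defs.
From HB Require Import structures.
From mathcomp Require Import all_boot all_order all_algebra finmap.
From mathcomp Require Import all_classical all_reals all_analysis.
From mathcomp Require Import ring lra zify.

Set Implicit Arguments.
Unset Strict Implicit.
Unset Printing Implicit Defensive.

Import Order.TTheory GRing.Theory Num.Theory.
Import numFieldNormedType.Exports.

Local Open Scope classical_set_scope.
Local Open Scope ring_scope.

(** It suffices to find finitely many continuous functions on [X], at most as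
    many as the cube has coordinates, whose values along the orbits separate
    the points ([embeds_of_separating]). One function on [Y] separates the
    points of [Y] along their orbits, because the action on [Y] is free and
    [dim Y] is finite ([exists_orbit_separating]). There remain the pairs of
    points in a fibre of [X -> Y], and [L m] functions for each of [d + 1]
    colours, [L] being the constant of (WAFC), take care of them
    ([exists_fibre_separating]). Both steps are by Baire category
    ([baire_families]): separating the pairs at distance at least
    [1 / (n + 1)] is an open condition, and the point is its density.

    Density for the fibres rests on two facts.
    - Freeness and [dim Y <= d] give [d + 1] open marker sets in [Y]. For a
      given finite [F], the [F]-translates of each are disjoint, and together
      the [F^-1 F]-translates of all cover [Y] ([marker_sets]). Each is built by
      a greedy choice that can only miss orbits meeting certain zero sets, and
      general position keeps a point of [Y] from being missed for all colours.
    - For a fine cover [U] of [X] and a suitable [F] of the Folner sequence, the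
      cover along [F^-1 F] has a partition of unity of multiplicity at most
      [L m #|F| / 2] ([narrow_of_mdim]). Mean dimension below [m / 2] gives
      [m #|F| / 2] along [F]. By symmetry [F^-1 F] lies in [L] right translates
      of [F], and multiplicities add up in joins of covers ([has_pou_join]).

    Over a marker point [z], the [L m] functions of one colour are then replaced
    along [F z] by [L m #|F|] functions of [z] close to the original values. Twice
    the multiplicity being at most [L m #|F|], these can be put into general
    position, and they then determine [z] up to a member of the cover
    ([approx_injective_mod]). Two points in a fibre visit the marker sets at the
    same times, so if all their values agree they are [U]-close.

    To extract the bound along [F] from a supremum of limits, these limits must
    exist; this is the convergence theorem of Ornstein and Weiss for subadditive
    functions. Under (WAFC) a single scale of disjoint translates covers a fixed
    fraction of every invariant set, which suffices to improve any bound that is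
    not optimal ([subadditive_rate_cvg]).

    For the Heisenberg groups, boxes adapted to the dilations are symmetric and
    of bounded doubling, and so are boxes in finitely generated abelian groups.
    An increasing sequence of bounded doubling cannot grow fast at every step,
    hence contains a Folner subsequence ([sym_wafc_of_doubling]). Finite and
    locally finite groups are exhausted by finite subgroups, and products of
    sequences serve for products of groups ([sym_wafc_prod]). The centre of the
    Heisenberg group makes all centralizers infinite. *)

(** * General position *)

Section GeneralPosition.
Variable R : realType.

Lemma poly_nonroot_above (p : {poly R}) (M : R) :
  p != 0 -> exists2 s, M < s & p.[s] != 0.
Proof.
move=> p0; pose t i : R := `|M| + 1 + i%:R.
have : ~~ all (root p) [seq t i | i <- iota 0 (size p)].
  apply/negP => h.
  have u : uniq [seq t i | i <- iota 0 (size p)].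
    rewrite map_inj_uniq ?iota_uniq// => i j /addrI/eqP.
    by rewrite eqr_nat => /eqP.
  by have := max_poly_roots p0 h u; rewrite size_map size_iota ltnn.
case/allPn => x /mapP[i _ ->] nr; exists (t i) => //.
by rewrite /t (le_lt_trans (ler_norm M))// -addrA ltrDl ltr_pwDl.
Qed.

Lemma det_pencil_poly k (V B : 'M[R]_k) :
  exists p : {poly R}, forall s, p.[s] = \det (V + s *: B).
Proof.
exists (\det (map_mx polyC V + 'X *: map_mx polyC B)) => s.
rewrite -[LHS]/(horner_eval s _) -det_map_mx; congr determinant.
by apply/matrixP => i j; rewrite !mxE rmorphD rmorphM /= /horner_eval !hornerE.
Qed.

Lemma general_position_ord (s k : nat) (b : 'I_s -> 'I_k -> R) (e : R) :
  0 < e ->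
  exists a : 'I_s -> 'I_k -> R,
    (forall j i, `|a j i - b j i| < e) /\
    forall sg : {ffun 'I_k -> 'I_s}, injective sg ->
      \det (\matrix_(i, j) a (sg i) j) != 0.
Proof.
move=> e0.
pose v (j : 'I_s) (i : 'I_k) : R := (j%:R) ^+ i.
pose V (sg : {ffun 'I_k -> 'I_s}) := \matrix_(i, j) v (sg i) j.
pose B (sg : {ffun 'I_k -> 'I_s}) := \matrix_(i, j) b (sg i) j.
have [P HP] := choice (fun sg => det_pencil_poly (V sg) (B sg)).
have PN0 (sg : {ffun 'I_k -> 'I_s}) : injective sg -> P sg != 0.
  move=> isg; apply/negP => /eqP P0.
  have := HP sg 0; rewrite P0 horner0 scale0r addr0 => /esym/eqP.
  have -> : V sg = (Vandermonde k (\row_i (sg i)%:R))^T.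
    by apply/matrixP => i j; rewrite !mxE.
  rewrite det_tr det_Vandermonde; apply/negP.
  apply/prodf_neq0 => i _; apply/prodf_neq0 => j ij; rewrite !mxE subr_eq0.
  by rewrite eqr_nat; apply: contraTneq ij => /val_inj/isg ->; rewrite ltnn.
pose Q := \prod_(sg : {ffun 'I_k -> 'I_s} | injectiveb sg) P sg.
have Q0 : Q != 0 by apply/prodf_neq0 => sg /injectiveP/PN0.
pose M := e^-1 * \sum_j \sum_i `|v j i| .
have M0 : 0 <= M.
  by rewrite mulr_ge0 ?invr_ge0 ?(ltW e0)// sumr_ge0// => ? _; rewrite sumr_ge0.
have [t Mt Qt] := poly_nonroot_above M Q0.
have t0 : 0 < t by rewrite (le_lt_trans M0).
exists (fun j i => t^-1 * v j i + b j i); split => [j i|sg isg].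
  rewrite addrK normrM gtr0_norm ?invr_gt0// mulrC ltr_pdivrMr//.
  rewrite mulrC -ltr_pdivrMr// mulrC; apply: le_lt_trans Mt.
  rewrite ler_wpM2l ?invr_ge0 ?(ltW e0)//.
  rewrite (bigD1 j)//= (bigD1 i)//= -addrA lerDl addr_ge0// ?sumr_ge0//.
  by move=> ? _; rewrite sumr_ge0.
have -> : (\matrix_(i, j) (t^-1 * v (sg i) j + b (sg i) j)) =
          t^-1 *: (V sg + t *: B sg).
  apply/matrixP => i j; rewrite !mxE; field; exact: lt0r_neq0.
rewrite detZ -HP mulf_neq0 ?expf_neq0 ?invr_neq0 ?(lt0r_neq0 t0)//.
move: Qt; rewrite horner_prod; apply: contraNneq => h.
by rewrite (bigD1 sg)/= ?h ?mul0r//; apply/injectiveP.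
Qed.

(** The moved points are [b + v / s], where the vectors [v] lie on the moment
    curve and [s] is large. Up to a power of [s], the determinant of any [#|I|]
    of them is a polynomial in [s] whose value at [0] is a Vandermonde
    determinant, so only finitely many values of [s] are excluded. *)
Lemma general_position (J I : finType) (b : J -> I -> R) (e : R) :
  0 < e ->
  exists a : J -> I -> R,
    (forall j i, `|a j i - b j i| < e) /\
    forall c : J -> R, (#|[pred j | c j != 0%R]| <= #|I|)%N ->
      (forall i, \sum_j c j * a j i = 0) -> forall j, c j = 0.
Proof.
move=> e0.
(* [#|I|] dummy points are added, so that a small set of indices extends to
   one with exactly [#|I|] elements. *)
pose J' := (J + I)%type.
pose b' (j : J') i := if j is inl j then b j i else 0.
have [a' [a'b adet]] :=
  @general_position_ord #|{: J'}| #|I|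
    (fun j i => b' (enum_val j) (enum_val i)) e e0.
pose a j i := a' (enum_rank (inl j : J')) (enum_rank i).
exists a; split => [j i|c cI csum j].
  have := a'b (enum_rank (inl j : J')) (enum_rank i).
  by rewrite !enum_rankK.
pose c' (j : J') := if j is inl j then c j else 0.
have [S sub cardS] : exists2 S : {set J'}, [set j | c' j != 0]%SET \subset S &
    #|S| = #|I|.
  have : (#|[set j | c' j != 0%R]%SET| <= #|I| <= #|[set: J']%SET|)%N.
    rewrite cardsT card_sum leq_addl andbT (leq_trans _ cI)//.
    have -> : [set j | c' j != 0]%SET = [set inl j | j in [pred j | c j != 0]]%SET.
      apply/setP => -[j0|i0]; rewrite !inE/=.
        by rewrite mem_imset ?inE//; exact: inl_inj.
      by rewrite eqxx; apply/esym/imsetP => -[].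
    by rewrite leq_imset_card.
  case/andP => h1 h2; set S0 := [set j | c' j != 0%R]%SET in h1 *.
  have := h1; rewrite leq_eqVlt => /orP[/eqP h|_]; first by exists S0.
  pose n := (#|I| - #|S0|)%N.
  have nle : (n <= #|(~: S0)%SET|)%N.
    by rewrite leq_subLR cardsC; rewrite cardsT in h2.
  have [T] : exists T : {set J'}, T \in
      [set T : {set J'} | T \subset (~: S0)%SET & #|T| == n]%SET.
    by apply/card_gt0P; rewrite cards_draws bin_gt0.
  rewrite inE => /andP[TS /eqP Tn].
  exists (S0 :|: T)%SET; first exact: finset.subsetUl.
  rewrite cardsU (_ : S0 :&: T = finset.set0)%SET ?cards0 ?subn0 ?Tn ?subnKC//.
  apply/setP => x; rewrite finset.in_setI finset.in_set0.
  by apply/negP => /andP[xS /(fintype.subsetP TS)]; rewrite finset.in_setC xS.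
pose ev (i : 'I_#|I|) : J' := @enum_val _ (mem S) (cast_ord (esym cardS) i).
have evS i : ev i \in S := enum_valP _.
have evI : injective ev by move=> x y /enum_val_inj/cast_ord_inj.
pose sg : {ffun 'I_#|I| -> 'I_#|{: J'}|} := [ffun i => enum_rank (ev i)].
have isg : injective sg by move=> x y; rewrite !ffunE => /enum_rank_inj/evI.
have {adet} := adet sg isg; rewrite -unitfE -unitmxE => U.
pose r := \row_i c' (ev i).
have : r *m (\matrix_(i, j) a' (sg i) j) = 0.
  apply/rowP => i; rewrite !mxE.
  transitivity (\sum_(x in S) c' x * a' (enum_rank x) i).
    rewrite (reindex ev); last first.
      exists (fun x => cast_ord cardS (enum_rank_in (evS i) x)) => x.
        move=> _; rewrite /ev.
        by rewrite enum_valK_in cast_ordKV.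
      by move=> xS; rewrite /ev cast_ordK enum_rankK_in.
    by apply: eq_big => [x|x _]; rewrite ?evS// !mxE ffunE.
  rewrite big_mkcond/= -[RHS](csum (enum_val i)).
  rewrite big_sumType/= [X in _ + X]big1 ?addr0; last first.
    by move=> y _; rewrite mul0r; case: ifP.
  apply: eq_bigr => y _; rewrite /a enum_valK.
  case: ifPn => // yS; apply/esym/eqP; rewrite mulf_eq0.
  suff -> : c y == 0 by [].
  by apply: contraNT yS => cy; apply: (fintype.subsetP sub); rewrite inE.
move/(congr1 (fun A => A *m invmx (\matrix_(i, j) a' (sg i) j))).
rewrite mulmxK// mul0mx => r0.
apply/eqP; apply: contraT => cj.
have jS : (inl j : J') \in S by apply: (fintype.subsetP sub); rewrite inE.
have := congr1 (fun A : 'rV[R]_#|I| =>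
  A 0 (cast_ord cardS (enum_rank_in jS (inl j : J')))) r0.
by rewrite !mxE /ev cast_ordK enum_rankK_in// => /= /eqP; rewrite (negbTE cj).
Qed.

End GeneralPosition.

(** * Partitions of unity of bounded multiplicity *)

Section PartitionsOfUnity.
Variables (R : realType) (X : topologicalType).

Definition pou (J : finType) (lam : J -> X -> R) : Prop :=
  [/\ forall j, continuous (lam j), forall j x, 0 <= lam j x &
      forall x, \sum_j lam j x = 1].

Definition has_pou (U : set (set X)) (k : nat) : Prop :=
  exists (J : finType) (lam : J -> X -> R),
    [/\ pou lam,
        forall j, exists2 O, U O & [set x | lam j x != 0] `<=` O &
        forall x, (#|[pred j | lam j x != 0%R]| <= k)%N].

Lemma pou_support (J : finType) (lam : J -> X -> R) x :
  pou lam -> exists j, lam j x != 0.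
Proof.
case=> _ _ lam1; apply: contrapT => h; have := lam1 x.
rewrite big1; first by move/eqP; rewrite eq_sym oner_eq0.
by move=> j _; apply/eqP; apply: contrapT => /negP hj; apply: h; exists j.
Qed.

Lemma continuous_sum_fun (J : finType) (P : pred J) (f : J -> X -> R) :
  (forall j, continuous (f j)) -> continuous (fun x => \sum_(j | P j) f j x).
Proof.
move=> fc; rewrite (_ : (fun x => _) = \sum_(j | P j) f j).
  move=> x; elim/big_ind: _ => [|g h|j _]; [exact: cst_continuous| |exact: fc].
  exact: continuousD.
by apply/funext => x; rewrite fct_sumE.
Qed.

(** The coefficient vectors are values of the functions at points of the
    supports, moved into general position; an average of such values stays close
    to the function because it varies little on each support. The index [b]
    serves to put the vectors of several maps into general position together. *)
Lemma pou_approx (J B I : finType) (lam : J -> X -> R) (v : B -> I -> X -> R)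
    (e : R) :
  pou lam -> 0 < e ->
  (forall b i j x x', lam j x != 0 -> lam j x' != 0 ->
     `|v b i x - v b i x'| <= e) ->
  exists a : B -> J -> I -> R,
    (forall b i x, `|(\sum_j lam j x * a b j i) - v b i x| <= 2 * e) /\
    forall c : B -> J -> R,
      (\sum_b #|[pred j | c b j != 0%R]| <= #|I|)%N ->
      (forall i, \sum_b \sum_j c b j * a b j i = 0) ->
      forall b j, c b j = 0.
Proof.
move=> plam e0 osc; have [lamc lam0 lam1] := plam.
pose base (p : B * J) i : R :=
  if pselect (exists x, lam p.2 x != 0) is left h
  then v p.1 i (sval (cid h)) else 0.
have [a [ab aindep]] := general_position base e0.
exists (fun b j i => a (b, j) i); split=> [b i x|c cI crel b j].
  have -> : \sum_j lam j x * a (b, j) i - v b i x =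
            \sum_j lam j x * (a (b, j) i - v b i x).
    under [RHS]eq_bigr do rewrite mulrBr.
    by rewrite big_split/= sumrN -mulr_suml lam1 mul1r.
  apply: le_trans (ler_norm_sum _ _ _) _.
  have -> : 2 * e = \sum_j lam j x * (2 * e) by rewrite -mulr_suml lam1 mul1r.
  apply: ler_sum => j _.
  rewrite normrM (ger0_norm (lam0 j x)); have [->|lamj] := eqVneq (lam j x) 0.
    by rewrite !mul0r.
  rewrite ler_wpM2l// (_ : _ - _ = (a (b, j) i - base (b, j) i)
    + (base (b, j) i - v b i x)); last by ring.
  rewrite (le_trans (ler_normD _ _))// mulr_natl mulr2n lerD ?(ltW (ab _ _))//.
  rewrite /base /=; case: pselect => [h|[]]; last by exists x.
  exact: (osc b i j _ _ (svalP (cid h)) lamj).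
apply: (aindep (fun p => c p.1 p.2) _ _ (b, j)) => /=.
  apply: leq_trans cI; rewrite -sum1_card.
  under [leqRHS]eq_bigr do rewrite -sum1_card.
  by rewrite pair_big_dep/=; apply: eq_leq; apply: eq_bigl => -[].
move=> i; rewrite -[RHS](crel i) pair_big/=; apply: eq_bigr => -[]//.
Qed.

Section Avoidance.
Variables (I : finType) (U : set (set X)) (k : nat) (e : R).
Hypotheses (Uk : has_pou U k) (e0 : 0 < e).

Definition small_variation (v : I -> X -> R) :=
  forall O, U O -> forall i x x', O x -> O x' -> `|v i x - v i x'| <= e.

Let combo_continuous (J : finType) (lam : J -> X -> R) (a : J -> I -> R) :
  pou lam -> forall i, continuous (fun x => \sum_j lam j x * a j i).
Proof.
case=> lamc _ _ i; apply: continuous_sum_fun => j x.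
by apply: continuousM; [exact: lamc|exact: cst_continuous].
Qed.

(** A zero would be a relation between at most [k] of the coefficient vectors
    whose coefficients have sum [1]. *)
Lemma approx_avoiding0 (v : I -> X -> R) : (k <= #|I|)%N ->
  small_variation v ->
  exists w : I -> X -> R,
    [/\ forall i, continuous (w i),
        forall i x, `|w i x - v i x| <= 2 * e &
        forall x, exists i, w i x != 0].
Proof.
move=> kI osc; have [J [lam [plam sub mult]]] := Uk.
have [|a [aw ind]] := @pou_approx _ unit I lam (fun=> v) e plam e0.
  move=> _ i j x x' jx jx'; have [A UA sA] := sub j.
  by apply: (osc A) => //; exact: sA.
exists (fun i x => \sum_j lam j x * a tt j i); split.
- exact: combo_continuous.
- by move=> i x; exact: aw.
move=> x; apply: contrapT => h.
have /(_ tt) : forall b j, (fun _ : unit => lam^~ x) b j = 0.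
  apply: ind => [|i]; rewrite (big_pred1 tt)/=; try by case.
    by rewrite (leq_trans (mult x)).
  by apply/eqP; apply: contrapT => /negP hi; apply: h; exists i.
by move=> z; have [j] := pou_support x plam; rewrite z eqxx.
Qed.

(** A common value would be a relation between at most [2 k] vectors, [k] for
    each of the two maps. *)
Lemma approx_disjoint_images (v v' : I -> X -> R) : (k + k <= #|I|)%N ->
  small_variation v -> small_variation v' ->
  exists w w' : I -> X -> R,
    [/\ forall i, continuous (w i) /\ continuous (w' i),
        forall i x, `|w i x - v i x| <= 2 * e /\ `|w' i x - v' i x| <= 2 * e &
        forall x x', exists i, w i x != w' i x'].
Proof.
move=> kI osc osc'; have [J [lam [plam sub mult]]] := Uk.
have [|a [aw ind]] :=
    @pou_approx _ bool I lam (fun b => if b then v else v') e plam e0.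
  move=> b i j x x' jx jx'; have [A UA sA] := sub j.
  by case: b; [apply: (osc A)|apply: (osc' A)] => //; exact: sA.
exists (fun i x => \sum_j lam j x * a true j i).
exists (fun i x => \sum_j lam j x * a false j i); split.
- by move=> i; split; exact: combo_continuous.
- by move=> i x; split; [exact: (aw true)|exact: (aw false)].
move=> x x'; apply: contrapT => h.
have /(_ true) : forall b j, (fun b j => if b then lam j x else - lam j x') b j = 0.
  apply: ind => [|i]; rewrite big_bool/=.
    rewrite (leq_trans _ kI)// leq_add ?mult//.
    rewrite (leq_trans _ (mult x'))//; apply: subset_leq_card.
    by apply/fintype.subsetP => j; rewrite !inE oppr_eq0.
  under [X in _ + X]eq_bigr do rewrite mulNr.
  rewrite sumrN; apply/eqP; rewrite subr_eq0.
  by apply: contrapT => /negP hi; apply: h; exists i.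
by move=> z; have [j] := pou_support x plam; rewrite z eqxx.
Qed.

(** If two points have the same image, general position forces their partition
    functions to coincide, hence the points share a member of [U]. *)
Lemma approx_injective_mod (v : I -> X -> R) : (k + k <= #|I|)%N ->
  small_variation v ->
  exists w : I -> X -> R,
    [/\ forall i, continuous (w i),
        forall i x, `|w i x - v i x| <= 2 * e &
        forall x x', (forall i, w i x = w i x') ->
          exists2 O, U O & O x /\ O x'].
Proof.
move=> kI osc; have [J [lam [plam sub mult]]] := Uk.
have [|a [aw ind]] := @pou_approx _ unit I lam (fun=> v) e plam e0.
  move=> _ i j x x' jx jx'; have [A UA sA] := sub j.
  by apply: (osc A) => //; exact: sA.
exists (fun i x => \sum_j lam j x * a tt j i); split.
- exact: combo_continuous.
- by move=> i x; exact: aw.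
move=> x x' wE.
have /(_ tt) lamE : forall b j, (fun (_ : unit) j => lam j x - lam j x') b j = 0.
  apply: ind => [|i]; rewrite (big_pred1 tt)/=; try by case.
    rewrite (leq_trans _ kI)// (leq_trans _ (leq_add (mult x) (mult x')))//.
    rewrite -cardUI; apply: leq_trans (leq_addr _ _); apply: subset_leq_card.
    apply/fintype.subsetP => j; rewrite !inE; apply: contraR.
    by rewrite negb_or !negbK => /andP[/eqP-> /eqP->]; rewrite subr0.
  by under eq_bigr do rewrite mulrBl; rewrite big_split/= sumrN wE subrr.
have [j jx] := pou_support x plam; have [A UA sA] := sub j.
exists A => //; split; apply: sA => //=.
by have /eqP := lamE j; rewrite subr_eq0 => /eqP <-.
Qed.

End Avoidance.

End PartitionsOfUnity.

Section Join.
Variables (R : realType) (X : topologicalType).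

Definition cover_join (U V : set (set X)) : set (set X) :=
  [set A `&` B | A in U & B in V].

Definition cumul (J : finType) (lam : J -> X -> R) (n : nat) (x : X) : R :=
  \sum_(j | (enum_rank j < n)%N) lam j x.

Lemma cumul_continuous (J : finType) (lam : J -> X -> R) n :
  pou lam -> continuous (cumul lam n).
Proof. by case=> lamc _ _; exact: continuous_sum_fun. Qed.

Lemma cumul0 (J : finType) (lam : J -> X -> R) x : cumul lam 0 x = 0.
Proof. by rewrite /cumul big_pred0. Qed.

Lemma cumul_card (J : finType) (lam : J -> X -> R) x :
  pou lam -> cumul lam #|J| x = 1.
Proof. by case=> _ _ /(_ x) <-; apply: eq_bigl => j; rewrite ltn_ord. Qed.

Lemma cumulS (J : finType) (lam : J -> X -> R) (j : J) x :
  cumul lam (enum_rank j).+1 x = cumul lam (enum_rank j) x + lam j x.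
Proof.
rewrite /cumul (bigD1 j)/=; last by rewrite ltnS.
rewrite addrC; congr (_ + _); apply: eq_bigl => i.
rewrite ltnS [RHS]ltn_neqAle andbC; congr (_ && _).
by rewrite (inj_eq val_inj) (inj_eq enum_rank_inj).
Qed.

Lemma cumul_le (J : finType) (lam : J -> X -> R) m n x :
  pou lam -> (m <= n)%N -> cumul lam m x <= cumul lam n x.
Proof.
case=> _ lam0 _ mn; rewrite /cumul [leRHS](bigID (fun j => (enum_rank j < m)%N))/=.
rewrite [X in _ <= X + _](eq_bigl (fun j => (enum_rank j < m)%N)).
  by rewrite lerDl sumr_ge0.
by move=> j; rewrite andbC; case: (ltnP _ m) => //= jm; rewrite (leq_trans jm).
Qed.

Lemma cumul_unique (J : finType) (lam : J -> X -> R) (j k : J) x y : pou lam ->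
  cumul lam (enum_rank j) x <= y < cumul lam (enum_rank j) x + lam j x ->
  cumul lam (enum_rank k) x <= y < cumul lam (enum_rank k) x + lam k x ->
  j = k.
Proof.
move=> plam /andP[a b] /andP[c d]; apply: contrapT => /eqP jk.
have : (enum_rank j != enum_rank k) by rewrite (inj_eq enum_rank_inj).
rewrite -(inj_eq val_inj) neq_ltn => /orP[] /(cumul_le x plam).
  by rewrite cumulS; lra.
by rewrite cumulS; lra.
Qed.

Lemma sum_telescope_rank (J : finType) (f : nat -> R) :
  \sum_(j : J) (f (enum_rank j).+1 - f (enum_rank j)) = f #|J| - f 0%N.
Proof.
rewrite -(telescope_sumr f (leq0n _)) big_mkord.
rewrite (reindex (fun j : J => enum_rank j))//.
by exists enum_val => j _; rewrite ?enum_rankK ?enum_valK.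
Qed.

Definition clamp (a b y : R) : R := Num.min b (Num.max a y).

Lemma clamp_homo (a b : R) : {homo clamp a b : y z / y <= z}.
Proof. by move=> y z yz; rewrite /clamp le_min2 // le_max2. Qed.

Lemma clamp_increment (l a m b : R) : 0 <= a -> 0 <= b ->
  clamp l (l + a) (m + b) - clamp l (l + a) m != 0 ->
  Num.max l m < Num.min (l + a) (m + b).
Proof.
move=> a0 b0; apply: contraNT; rewrite -leNgt ge_min !le_max /clamp => h.
apply/eqP; have {}h : [|| l + a <= l, l + a <= m, m + b <= l | m + b <= m].
  by rewrite -!orbA in h *.
case/or4P: h => h.
- by rewrite !min_l ?subrr// le_max h.
- by rewrite !min_l ?subrr// le_max ?h ?orbT//; apply/orP; right; lra.
- by rewrite (max_l h) max_l ?subrr//; lra.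
- by rewrite (_ : b = 0) ?addr0 ?subrr//; lra.
Qed.

(** Order the functions of two partitions of unity. At each point they cut
    [0, 1] into consecutive intervals of lengths [lam j x], resp. [mu j x].
    The lengths of the overlaps of the intervals of the two subdivisions form a
    partition of unity, and there are at most as many nontrivial overlaps as
    there are nontrivial intervals, since each overlap starts where one of them
    starts. This is why multiplicities add up, where products of the functions
    would multiply them. *)
Definition overlap (J K : finType) (lam : J -> X -> R) (mu : K -> X -> R)
    (p : J * K) (x : X) : R :=
  let c := clamp (cumul lam (enum_rank p.1) x)
                 (cumul lam (enum_rank p.1).+1 x) in
  c (cumul mu (enum_rank p.2).+1 x) - c (cumul mu (enum_rank p.2) x).

Section Overlap.
Variables (J K : finType) (lam : J -> X -> R) (mu : K -> X -> R).
Hypotheses (plam : pou lam) (pmu : pou mu).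

Let lam0 : forall j x, 0 <= lam j x. Proof. by case: plam. Qed.
Let mu0 : forall j x, 0 <= mu j x. Proof. by case: pmu. Qed.

Let L (j : J) x := cumul lam (enum_rank j) x.
Let M (k : K) x := cumul mu (enum_rank k) x.

Lemma overlap_neq0 j k x : overlap lam mu (j, k) x != 0 ->
  Num.max (L j x) (M k x) < Num.min (L j x + lam j x) (M k x + mu k x).
Proof.
rewrite /overlap /= !cumulS.
by apply: clamp_increment; [exact: lam0|exact: mu0].
Qed.

Lemma overlap_pou : pou (overlap lam mu).
Proof.
split=> [[j k]|[j k] x|x].
- have cl (f : X -> R) : continuous f -> continuous (fun x =>
      clamp (cumul lam (enum_rank j) x) (cumul lam (enum_rank j).+1 x) (f x)).
    move=> fc x; apply: continuous_min; first exact: cumul_continuous.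
    by apply: continuous_max; [exact: cumul_continuous|exact: fc].
  move=> x; have h n := cl _ (cumul_continuous (n := n) pmu) x.
  exact: (continuousB (h _) (h _)).
- by rewrite /overlap subr_ge0 clamp_homo// cumul_le.
rewrite -(pair_bigA _ (fun j k => overlap lam mu (j, k) x))/=.
under eq_bigr => j _.
  rewrite /overlap /= (sum_telescope_rank _ (fun n => clamp _ _ (cumul mu n x))).
  rewrite cumul0 cumul_card// /clamp cumulS.
  have h0 : 0 <= cumul lam (enum_rank j) x by rewrite -(cumul0 lam x) cumul_le.
  have h1 : cumul lam (enum_rank j) x + lam j x <= 1.
    by rewrite -cumulS -(cumul_card x plam) cumul_le.
  have a0 := lam0 j x.
  rewrite (_ : _ - _ = lam j x); last by do 4?case: leP => ?; lra.
  over.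
by case: plam.
Qed.

Lemma overlap_mult x : (#|[pred p | overlap lam mu p x != 0%R]| <=
  #|[pred j | lam j x != 0%R]| + #|[pred k | mu k x != 0%R]|)%N.
Proof.
pose phi (p : J * K) : J + K := if M p.2 x <= L p.1 x then inl p.1 else inr p.2.
(* An overlap starts at the left end of an interval of the first or of the
   second subdivision, and this interval determines it. *)
pose Q := [pred s : J + K |
  match s with inl j => lam j x != 0 | inr k => mu k x != 0 end].
apply: (@leq_trans #|Q|); last first.
  by rewrite -sum1_card big_sumType/= -!sum1_card.
rewrite -(@card_in_image _ _ phi).
  apply: subset_leq_card; apply/fintype.subsetP => s /mapP[[j k]]; rewrite mem_enum.
  rewrite inE => /overlap_neq0; rewrite lt_min !gt_max.
  rewrite /phi/= => /andP[/andP[h1 h2] /andP[h3 h4]] ->; case: ifP => _; rewrite inE.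
    by move: h1; rewrite ltrDl => /lt0r_neq0.
  by move: h4; rewrite ltrDl => /lt0r_neq0.
move=> [j k] [j' k']; rewrite !inE => /overlap_neq0 + /overlap_neq0.
rewrite !lt_min !gt_max /phi/=.
move=> /andP[/andP[h1 h2] /andP[h3 h4]] /andP[/andP[h1' h2'] /andP[h3' h4']].
case: leP => ML; case: leP => ML' // [E].
  subst j'; congr (_, _); apply: (cumul_unique pmu (x := x) (y := L j x)).
    by rewrite -/(M k x) ML h3.
  by rewrite -/(M k' x) ML' h3'.
subst k'; congr (_, _); apply: (cumul_unique plam (x := x) (y := M k x)).
  by rewrite -/(L j x) (ltW ML) h2.
by rewrite -/(L j' x) (ltW ML') h2'.
Qed.

End Overlap.

Lemma has_pou_join U V p q :
  has_pou R U p -> has_pou R V q -> has_pou R (cover_join U V) (p + q).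
Proof.
move=> [J [lam [plam lamU lamp]]] [K [mu [pmu muV muq]]].
exists (J * K)%type, (overlap lam mu); split; first exact: overlap_pou.
  move=> [j k]; have [A UA sA] := lamU j; have [B VB sB] := muV k.
  exists (A `&` B); first by exists A => //; exists B.
  move=> x /= /(overlap_neq0 plam pmu); rewrite lt_min !gt_max.
  move=> /andP[/andP[h1 h2] /andP[h3 h4]]; split.
    by apply: sA; move: h1; rewrite /= ltrDl => /lt0r_neq0.
  by apply: sB; move: h4; rewrite /= ltrDl => /lt0r_neq0.
move=> x; apply: leq_trans (overlap_mult plam pmu x) _.
exact: leq_add.
Qed.

Lemma has_pou_refine (U V : set (set X)) k l : (k <= l)%N ->
  (forall A, U A -> exists2 B, V B & A `<=` B) -> has_pou R U k -> has_pou R V l.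
Proof.
move=> kl UV [J [lam [plam lamU lamp]]]; exists J, lam; split=> //.
  move=> j; have [A /UV[B VB AB] sA] := lamU j; exists B => //.
  exact: subset_trans sA AB.
by move=> x; exact: leq_trans (lamp x) kl.
Qed.

Lemma has_pou_preimage (Y : topologicalType) (f : Y -> X) U k :
  continuous f -> has_pou R U k -> has_pou R [set f @^-1` A | A in U] k.
Proof.
move=> fc [J [lam [[lamc lam0 lam1] lamU lamp]]].
exists J, (fun j => lam j \o f); split.
- split=> [j|j y|y]; [|exact: lam0|exact: lam1].
  by move=> y; apply: continuous_comp; [exact: fc|exact: lamc].
- move=> j; have [A UA sA] := lamU j; exists (f @^-1` A); first by exists A.
  by move=> y /= /sA.
by move=> y; exact: lamp.
Qed.

End Join.

(** * Order of covers and partitions of unity *)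

Section DistanceFunctions.
Variables (R : realType) (X : metricType R).
Implicit Types (C : set X) (x y : X).

(** The distance to [C], truncated at [1] so that it is positive off [C] even
    when [C] is empty. *)
Definition dist_fun C x : R := inf ([set mdist x c | c in C] `|` [set 1]).

Let dist_has_inf C x : has_inf ([set mdist x c | c in C] `|` [set 1]).
Proof.
split; first by exists 1; right.
by exists 0 => _ [[c _ <-]|->]; rewrite ?mdist_ge0.
Qed.

Lemma dist_fun_ge0 C x : 0 <= dist_fun C x.
Proof.
apply: lb_le_inf; first by exists 1; right.
by move=> _ [[c _ <-]|->]; rewrite ?mdist_ge0.
Qed.

Lemma dist_fun_lip C x y : dist_fun C x <= dist_fun C y + mdist x y.
Proof.
rewrite -lerBlDr; apply: lb_le_inf; first by exists 1; right.
have [_ lb] := dist_has_inf C x.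
move=> _ [[c Cc <-]|->]; rewrite lerBlDr.
  rewrite addrC; apply: le_trans (metric_triangle _ y _).
  by apply: ge_inf => //; left; exists c.
by rewrite (@le_trans _ _ 1)// ?lerDl ?mdist_ge0//; apply: ge_inf => //; right.
Qed.

Lemma dist_fun_continuous C : continuous (dist_fun C).
Proof.
move=> x; apply/cvgrPdist_lt => e e0; near=> y.
apply: (@le_lt_trans _ _ (mdist x y)).
  have := dist_fun_lip C x y; have := dist_fun_lip C y x.
  by rewrite metric_sym ler_norml; lra.
have : ball x e y by near: y; exact: nbhsx_ballx.
by rewrite ballEmdist.
Unshelve. all: by end_near. Qed.

Lemma dist_fun0 C x : C x -> dist_fun C x = 0.
Proof.
move=> Cx; apply/eqP; rewrite eq_le dist_fun_ge0 andbT.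
have [_ lb] := dist_has_inf C x.
by apply: ge_inf => //; left; exists x => //; rewrite mdistxx.
Qed.

Lemma dist_fun_gt0 C x : closed C -> ~ C x -> 0 < dist_fun C x.
Proof.
move=> cC nCx; have : open (~` C) by exact: closed_openC.
rewrite openE => /(_ x nCx)/nbhs_ballP[e/= e0 sub].
apply: (@lt_le_trans _ _ (Num.min 1 e)); first by rewrite lt_min ltr01 e0.
apply: lb_le_inf; first by exists 1; right.
move=> _ [[c Cc <-]|->]; last by rewrite ge_min lexx.
rewrite ge_min; apply/orP; right; rewrite leNgt; apply/negP => h.
by apply: (sub c); rewrite ?ballEmdist.
Qed.

End DistanceFunctions.

Section CoverDimension.
Variables (R : realType) (X : metricType R) (x0 : X).
Implicit Types U V : set (set X).

Definition cover_mult V (x : X) : nat := \sum_(A <- fset_set V) (x \in A).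

Lemma cover_orderE V : finite_set V ->
  cover_order R V = -1 + sup [set (cover_mult V x)%:R | x in [set: X]].
Proof.
move=> finV; rewrite /cover_order; congr (_ + sup _).
apply/seteqP; split=> _ [x _ <-]; exists x => //; rewrite fsbig_finite//
  natr_sum; apply: eq_bigr => A _; by rewrite indicE.
Qed.

Lemma cover_mult_le V x : (cover_mult V x <= #|` fset_set V|)%N.
Proof.
rewrite /cover_mult -sum1_size; apply: leq_sum => A _; exact: leq_b1.
Qed.

Lemma cover_order_attained V : finite_set V ->
  exists c : nat, (forall x, cover_mult V x <= c)%N /\
    cover_order R V = -1 + c%:R.
Proof.
move=> finV; pose P c := `[< exists x, cover_mult V x = c >].
have exP : exists c, P c by exists (cover_mult V x0); apply/asboolP; exists x0.
have ubP c : P c -> (c <= #|` fset_set V|)%N.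
  by move/asboolP => [x <-]; exact: cover_mult_le.
have [c /asboolP[x xc] cmax] := ex_maxnP exP ubP.
have multc y : (cover_mult V y <= c)%N by apply: cmax; apply/asboolP; exists y.
exists c; split=> //; rewrite cover_orderE//; congr (_ + _); apply/eqP.
rewrite eq_le; apply/andP; split.
  apply: ge_sup; first by exists (cover_mult V x)%:R, x.
  by move=> _ [y _ <-]; rewrite ler_nat.
rewrite -xc; apply: ub_le_sup; last by exists x.
by exists c%:R => _ [y _ <-]; rewrite ler_nat.
Qed.

(** The distances to the complements of the members of a finite open cover
    never vanish together, and they can be normalised. *)
Lemma has_pou_of_cover U V k : finite_open_cover V -> refines V U ->
  (forall x, cover_mult V x <= k)%N -> has_pou R U k.
Proof.
move=> [finV opV covV] VU mult.
pose J : finType := fset_set V.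
have VP (j : J) : V (val j).
  by have := valP j; rewrite in_fset_set// inE.
pose rho (j : J) (x : X) : R := dist_fun (~` val j) x.
have rho0 j x : 0 <= rho j x by exact: dist_fun_ge0.
have rhoN0 j x : rho j x != 0 -> val j x.
  move=> h; apply: contrapT => nj; move/eqP: h; apply; exact: dist_fun0.
pose S x := \sum_j rho j x.
have S0 x : 0 < S x.
  have : [set: X] x by []; rewrite -covV => -[A VA Ax].
  have jA : A \in fset_set V by rewrite in_fset_set// inE.
  rewrite /S (bigD1 (FSetSub jA))//= ltr_pwDl ?sumr_ge0//.
  apply: dist_fun_gt0; first by apply: open_closedC; exact: opV.
  by rewrite /= => h; exact: h.
have Sc : continuous S by apply: continuous_sum_fun => j; exact: dist_fun_continuous.
exists J, (fun j x => rho j x / S x); split.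
- split=> [j x|j x|x].
  + apply: continuousM; first exact: dist_fun_continuous.
    apply: continuousV; last exact: Sc.
    exact: lt0r_neq0.
  + by rewrite divr_ge0// ltW.
  + by rewrite -mulr_suml -/(S x) divff// lt0r_neq0.
- move=> j; have [A UA jA] := VU _ (VP j); exists A => //.
  move=> x/= h; apply: jA; apply: rhoN0; apply: contra_neq h => ->.
  by rewrite mul0r.
move=> x; apply: leq_trans (mult x); rewrite /cover_mult.
rewrite big_seq_fsetE/= -sum1_card big_mkcond/=; apply: leq_sum => j _.
rewrite inE; case: ifPn => // h; rewrite lt0b; apply/mem_set/rhoN0.
by apply: contra_neq h => ->; rewrite mul0r.
Qed.

Lemma has_pou_of_cover_dim U (c : R) : finite_open_cover U ->
  cover_dim R U < c -> exists2 k, has_pou R U k & k%:R - 1 < c.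
Proof.
move=> Ufoc /inf_lt[|_ [V [Vfoc VU] <-]].
  by exists (cover_order R U), U => //; split=> // A UA; exists A.
have [finV _ _] := Vfoc; have [k [mult ->]] := cover_order_attained finV.
by rewrite addrC => kc; exists k => //; exact: has_pou_of_cover mult.
Qed.

(** The open supports cover the space and refine [U]. Several functions may have
    the same support, so the order of this cover can be less than the
    multiplicity of the partition. *)
Lemma cover_dim_le_pou U k : has_pou R U k -> cover_dim R U <= k%:R - 1.
Proof.
move=> [J [lam [plam sub mult]]]; have [lamc lam0 lam1] := plam.
pose O_ j := [set x | lam j x != 0].
pose V : set (set X) := [set O_ j | j in [set: J]].
have finV : finite_set V.
  by apply: finite_image; apply: finite_finset.
have Vfoc : finite_open_cover V.
  split=> //.
    move=> _ [j _ <-]; rewrite (_ : O_ j = lam j @^-1` [set r | r != 0])//.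
    by apply: open_comp => [x _|]; [exact: lamc|exact: open_neq].
  rewrite -subTset => x _; have [j jx] := pou_support x plam.
  by exists (O_ j) => //; exists j.
have VU : refines V U by move=> _ [j _ <-]; exact: sub.
have [c [multV ordV]] := cover_order_attained finV.
apply: (@le_trans _ _ (cover_order R V)).
  apply: ge_inf; last by exists V.
  exists (-1) => _ [W [[finW _ _] _] <-].
  by have [c' [_ ->]] := cover_order_attained finW; rewrite lerDl.
rewrite cover_orderE// addrC lerD2r; apply: ge_sup.
  by exists (cover_mult V x0)%:R, x0.
move=> _ [x _ <-]; rewrite ler_nat; apply: leq_trans (mult x).
rewrite /cover_mult big_seq_fsetE/=.
have VP (A : fset_set V) : {j | val A = O_ j}.
  apply: cid; have := valP A; rewrite in_fset_set// inE => -[j _ <-].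
  by exists j.
pose f A := sval (VP A); have fE A : val A = O_ (f A) := svalP (VP A).
have fI : injective f by move=> A B AB; apply: val_inj; rewrite !fE AB.
rewrite (eq_bigr (fun A => (f A \in [pred j | lam j x != 0]) : nat)); last first.
  by move=> A _; rewrite inE {1}fE /O_; congr nat_of_bool; rewrite mem_setE.
rewrite -big_mkcond/= sum1_card.
rewrite -(card_imset _ fI); apply: subset_leq_card.
by apply/fintype.subsetP => j /imsetP[A + ->].
Qed.

End CoverDimension.

(** * Compactness and Baire category *)

Section Compactness.
Variable R : realType.

Lemma open_bigcap_finite (X : topologicalType) (I : choiceType) (D : set I)
    (f : I -> set X) :
  finite_set D -> (forall i, D i -> open (f i)) ->
  open (\bigcap_(i in D) f i).
Proof.
move=> /finite_fsetP[E ->] fo; rewrite bigcap_fset big_seq.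
elim/big_ind: _ => [|A B|i iE]; [exact: openT|exact: openI|exact: fo].
Qed.

Lemma compact_uniformly_pos (Z : topologicalType) (K : set Z) (I : Type)
    (phi : I -> Z -> R) :
  compact K -> (forall i, continuous (phi i)) ->
  (forall z, K z -> exists i, 0 < phi i z) ->
  exists2 eta, 0 < eta & forall z, K z -> exists i, eta < phi i z.
Proof.
move=> /compact_near_coveringP cK phic pos.
have h : \forall e \near 0^'+, K `<=` (fun z => exists i, e < phi i z).
  apply: (cK R 0^'+ (fun e z => exists i, e < phi i z)) => z /pos[i iz].
  exists ([set y | phi i z / 2 < phi i y], [set e | e < phi i z / 2]) => /=.
    split; last by apply: nbhs_right_lt; rewrite divr_gt0.
    by apply: (cvgr_gt _ (phic i z)); rewrite ltr_pdivrMr// ltr_pMr ?ltr1n.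
  by move=> [y e]/= [h1 h2]; exists i; rewrite (lt_trans h2).
have [e [e0 he]] : exists e, 0 < e /\ K `<=` (fun z => exists i, e < phi i z).
  by apply: (@filter_ex _ (0^'+ : set_system R)); near=> e; split;
    near: e => //; exact: nbhs_right_gt.
by exists e.
Unshelve. all: by end_near. Qed.

Lemma compact_finite_open_cover (X : topologicalType) (P : set X -> Prop) :
  compact [set: X] ->
  (forall x, exists A, [/\ open A, A x & P A]) ->
  exists2 U, finite_open_cover U & forall A, U A -> P A.
Proof.
move=> /compact_near_coveringP cX loc.
pose good (D : {fset set X}) := forall A, A \in D -> open A /\ P A.
pose F := filter_from good (fun D => [set E : {fset set X} | (D `<=` E)%fset]).
have FF : Filter F.
  apply: filter_from_filter; first by exists fset0.
  move=> D E gD gE; exists (D `|` E)%fset.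
    by move=> A; rewrite in_fsetU => /orP[/gD|/gE].
  by move=> H /=; rewrite fsubUset => /andP[].
have [|D gD /(_ D (fsubset_refl D)) cov] :=
    cX _ F (fun D x => exists2 A, A \in D & A x) FF.
  move=> x _; have [A [oA Ax PA]] := loc x.
  exists (A, [set E : {fset set X} | ([fset A] `<=` E)%fset]) => /=.
    split; first by apply: open_nbhs_nbhs.
    by exists [fset A]%fset => // B; rewrite inE => /eqP ->.
  by move=> [y E]/= [Ay]; rewrite fsub1set => AE; exists A.
exists [set` D]; last by move=> A /gD[].
split; first exact: finite_fset.
  by move=> A /gD[].
by rewrite -subTset => x /cov[A AD Ax]; exists A.
Qed.

Lemma finite_open_cover_setT (X : topologicalType) :
  finite_open_cover [set [set: X]].
Proof.
split; [exact: finite_set1| |by rewrite bigcup_set1].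
by move=> _ ->; exact: openT.
Qed.

Lemma exists_small_variation_cover (X : topologicalType) (I : finType)
    (v : I -> X -> R) (e : R) (U : set (set X)) :
  compact [set: X] -> 0 < e -> (forall i, continuous (v i)) ->
  finite_open_cover U ->
  exists2 V, finite_open_cover V & small_variation V e v /\ refines V U.
Proof.
move=> cX e0 vc [_ oU covU].
have [|V Vfoc PV] := @compact_finite_open_cover X
  (fun A => (forall i x x', A x -> A x' -> `|v i x - v i x'| <= e) /\
            exists2 B, U B & A `<=` B) cX; last first.
  exists V => //; split; first by move=> A /PV[].
  by move=> A /PV[].
move=> x; have : [set: X] x by []; rewrite -covU => -[B UB Bx].
exists (B `&` \bigcap_(i in [set: I]) v i @^-1` ball (v i x) (e / 2)); split.
- apply: openI; first exact: oU.
  apply: open_bigcap_finite; first exact: finite_finset.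
  move=> i _; apply: open_comp; first by move=> *; exact: vc.
  exact: ball_open.
- by split=> // i _; apply: ballxx; rewrite divr_gt0.
split; last by exists B => //; exact: subIsetl.
move=> i y y' [_ /(_ i Logic.I)/= h] [_ /(_ i Logic.I)/= h'].
move: h h'; rewrite /ball/= => h h'.
rewrite (_ : _ - _ = (v i x - v i y') - (v i x - v i y)); last by ring.
by rewrite (le_trans (ler_normB _ _))// ltW// [e]splitr ltrD.
Qed.

End Compactness.

Section Baire.
Variables (R : realType) (X : topologicalType) (T : Type).
Implicit Types f g : T -> X -> R.

Definition fam_continuous f := forall t, continuous (f t).

Definition fam_close (e : R) f g := forall t x, `|f t x - g t x| <= e.

Definition open_condition (P : (T -> X -> R) -> Prop) :=
  forall f, fam_continuous f -> P f -> exists2 e, 0 < e &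
    forall g, fam_continuous g -> fam_close e f g -> P g.

Definition dense_condition (P : (T -> X -> R) -> Prop) :=
  forall f e, fam_continuous f -> 0 < e ->
    exists g, [/\ fam_continuous g, fam_close e f g & P g].

(** Baire's theorem for the uniform distance. The closed balls of centres [F n]
    and radii [r n] are nested and [r n] tends to [0]. As [F n - r n] increases
    and [F n + r n] decreases, the supremum of the former is a uniform limit that
    lies in all the balls. *)
Lemma baire_families (P : nat -> (T -> X -> R) -> Prop) :
  (forall n, open_condition (P n)) -> (forall n, dense_condition (P n)) ->
  dense_condition (fun f => forall n, P n f).
Proof.
move=> opP deP f0 e0 f0c e0_gt0.
pose S := {p : (T -> X -> R) * R | fam_continuous p.1 /\ 0 < p.2}.
have step (ns : nat * S) : {s' : S |
    [/\ fam_close ((sval ns.2).2 / 2) (sval ns.2).1 (sval s').1,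
        (sval s').2 <= (sval ns.2).2 / 2 &
        forall g, fam_continuous g -> fam_close (sval s').2 (sval s').1 g ->
          P ns.1 g]}.
  apply: cid; case: ns => n [[f r] /= [fc r0]].
  have r20 : 0 < r / 2 by rewrite divr_gt0.
  have [g [gc fg Pg]] := deP n f _ fc r20.
  have [d d0 dP] := opP n g gc Pg.
  have m0 : 0 < Num.min d (r / 2) by rewrite lt_min d0.
  exists (exist _ (g, Num.min d (r / 2)) (conj gc m0)) => /=; split=> //.
    by rewrite ge_min lexx orbT.
  move=> h hc gh; apply: dP => // t x; apply: le_trans (gh t x) _.
  by rewrite ge_min lexx.
pose s := fix s n : S := if n is n'.+1 then sval (step (n', s n')) else
  exist _ (f0, e0) (conj f0c e0_gt0).
pose F n := (sval (s n)).1; pose r n := (sval (s n)).2.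
have Fc n : fam_continuous (F n) by have [] := svalP (s n).
have r0 n : 0 < r n by have [] := svalP (s n).
have FS n : fam_close (r n / 2) (F n) (F n.+1).
  by have [] := svalP (step (n, s n)).
have rS n : r n.+1 <= r n / 2 by have [] := svalP (step (n, s n)).
have PS n g : fam_continuous g -> fam_close (r n.+1) (F n.+1) g -> P n g.
  by have [_ _] := svalP (step (n, s n)); apply.
have lo_homo t x : {homo (fun n => F n t x - r n) : m n / (m <= n)%N >-> m <= n}.
  apply: (@homo_leq _ _ (fun a b : R => a <= b)) => [//|? ? ? |n].
    exact: le_trans.
  by have := FS n t x; have := rS n; rewrite ler_norml; lra.
have hi_homo t x : {homo (fun n => F n t x + r n) : m n / (m <= n)%N >-> n <= m}.
  apply: (@homo_leq _ _ (fun a b : R => b <= a)) => [//|? ? ? /[swap] |n].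
    exact: le_trans.
  by have := FS n t x; have := rS n; rewrite ler_norml; lra.
pose E t x := range (fun n => F n t x - r n).
pose g t x := sup (E t x).
have lohi t x m n : F m t x - r m <= F n t x + r n.
  apply: (@le_trans _ _ (F (maxn m n) t x - r (maxn m n))).
    by apply: lo_homo; rewrite leq_maxl.
  apply: (@le_trans _ _ (F (maxn m n) t x + r (maxn m n))).
    by have := r0 (maxn m n); lra.
  by apply: hi_homo; rewrite leq_maxr.
have Fg n : fam_close (r n) (F n) g.
  move=> t x; rewrite ler_norml; apply/andP; split.
    rewrite lerBrDr addrC -lerBrDr opprK; apply: ge_sup.
      by exists (F 0%N t x - r 0%N), 0%N.
    by move=> _ [m _ <-]; exact: lohi.
  rewrite lerBlDr -lerBlDl; apply: ub_le_sup; last by exists n.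
  by exists (F 0%N t x + r 0%N) => _ [m _ <-]; exact: lohi.
have r_small (d : R) : 0 < d -> exists n, r n < d.
  move=> d0.
  have rn n : r n * n.+1%:R <= e0.
    elim: n => [|n IH]; first by rewrite mulr1.
    apply: le_trans IH; apply: (@le_trans _ _ (r n / 2 * n.+2%:R)).
      by rewrite ler_wpM2r.
    rewrite -mulrA ler_pM2l// mulrC ler_pdivrMr// -natrM ler_nat; lia.
  have [n hn] : exists n : nat, e0 / d < n%:R.
    by exists (Num.bound (e0 / d)); rewrite archi_boundP// divr_ge0// ltW.
  exists n; rewrite -(@ltr_pM2r _ n.+1%:R)//; apply: le_lt_trans (rn n) _.
  rewrite mulrC -ltr_pdivrMr//; apply: lt_le_trans hn _.
  by rewrite ler_nat.
have gc : fam_continuous g.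
  move=> t x; apply/cvgrPdist_lt => d d0.
  have d3 : 0 < d / 3 by rewrite divr_gt0.
  have [n rnd] := r_small _ d3.
  have /cvgrPdist_lt/(_ _ d3) := Fc n t x.
  apply: filterS => y; have := Fg n t x; have := Fg n t y.
  by rewrite !ler_norml !ltr_norml; lra.
exists g; split=> //; first exact: (Fg 0%N).
by move=> n; apply: PS.
Qed.

Lemma open_condition_and (I : finType) (P : I -> (T -> X -> R) -> Prop) :
  (forall i, open_condition (P i)) -> open_condition (fun f => forall i, P i f).
Proof.
move=> opP f fc Pf.
have /choice[d hd] : forall i, exists d, 0 < d /\
    forall g, fam_continuous g -> fam_close d f g -> P i g.
  by move=> i; have [d d0 h] := opP i f fc (Pf i); exists d.
exists (\big[Num.min/1]_i d i).
  by apply: lt_bigmin => // i _; case: (hd i).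
move=> g gc fg i; apply: (hd i).2 => // t x; apply: le_trans (fg t x) _.
exact: bigmin_le_cond.
Qed.

Lemma dense_condition_and (I : finType) (P : I -> (T -> X -> R) -> Prop) :
  (forall i, open_condition (P i)) -> (forall i, dense_condition (P i)) ->
  dense_condition (fun f => forall i, P i f).
Proof.
move=> opP deP f e fc e0.
pose Q n f := if insub n is Some k then P (@enum_val I predT k) f else True.
have [n|n|g [gc fg Pg]] := @baire_families Q _ _ f e fc e0.
- rewrite /Q; case: insub => [k|]; first exact: opP.
  by move=> *; exists 1.
- rewrite /Q; case: insub => [k|]; first exact: deP.
  by move=> h d hc d0; exists h; split=> // t x; rewrite subrr normr0 ltW.
exists g; split=> // i; have := Pg (enum_rank i).
by rewrite /Q valK enum_rankK.
Qed.

End Baire.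

Lemma norm_le_double (R : realType) (x e : R) : `|x| <= e -> `|x| <= 2 * e.
Proof. by have := normr_ge0 x; lra. Qed.

Section OpenConditions.
Variables (R : realType) (X Z : topologicalType) (T I : Type).

Lemma open_pos_condition (K : set Z) (Phi : I -> (T -> X -> R) -> Z -> R) :
  compact K ->
  (forall i f, fam_continuous f -> continuous (Phi i f)) ->
  (forall i e f g z, fam_close e f g -> `|Phi i f z - Phi i g z| <= 2 * e) ->
  open_condition (fun f => forall z, K z -> exists i, 0 < Phi i f z).
Proof.
move=> cK Phic lip f fc pos.
have [eta eta0 h] := compact_uniformly_pos cK (fun i => Phic i f fc) pos.
exists (eta / 2); first by rewrite divr_gt0.
move=> g gc fg z /h[i iz]; exists i; have := lip i _ _ _ z fg.
by rewrite ler_norml; lra.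
Qed.

End OpenConditions.

(** * Free actions on finite-dimensional spaces *)

Section MetricContinuity.
Variables (R : realType) (X : topologicalType) (Y : metricType R).

Lemma mdist_continuous (f g : X -> Y) : continuous f -> continuous g ->
  continuous (fun x => mdist (f x) (g x) : R).
Proof.
move=> fc gc x; apply/cvgrPdist_lt => e e0; near=> y.
have fy : mdist (f x) (f y) < e / 2.
  have : ball (f x) (e / 2) (f y).
    by near: y; apply: (fc x); apply: nbhsx_ballx; rewrite divr_gt0.
  by rewrite ballEmdist.
have gy : mdist (g x) (g y) < e / 2.
  have : ball (g x) (e / 2) (g y).
    by near: y; apply: (gc x); apply: nbhsx_ballx; rewrite divr_gt0.
  by rewrite ballEmdist.
have h1 := metric_triangle (f x) (f y) (g x).
have h2 := metric_triangle (f y) (g y) (g x).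
have h3 := metric_triangle (f y) (f x) (g y).
have h4 := metric_triangle (f x) (g x) (g y).
by move: h2 h3; rewrite ltr_norml (metric_sym (g y)) (metric_sym (f y) (f x)); lra.
Unshelve. all: by end_near. Qed.

End MetricContinuity.

Lemma metric_ball_open (R : realType) (Y : metricType R) (y : Y) (e : R) :
  open (ball y e).
Proof.
rewrite ballEmdist.
apply: (@open_comp _ _ (fun z => mdist y z : R) [set r | r < e]) => [z _|].
  by apply: mdist_continuous; [exact: cst_continuous|move=> x; exact: cvg_id].
exact: open_lt.
Qed.

Section Marker.
Variables (R : realType) (G : groupType) (Y : metricType R) (act : G -> Y -> Y).
Hypothesis sysY : is_system act.

Lemma act_inv g x : act g^-1%g (act g x) = x.
Proof. by have [_ a1 aM _] := sysY; rewrite -aM mulVg a1. Qed.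

Lemma act_invV g x : act g (act g^-1%g x) = x.
Proof. by have [_ a1 aM _] := sysY; rewrite -aM mulgV a1. Qed.

Section Greedy.
Variables (E : {fset G}) (J : eqType) (u : J -> Y -> R).
Hypotheses (E1 : 1%g \in E) (EV : forall g, g \in E -> g^-1%g \in E).

(** Greedy choice of a set whose translates by [E] are disjoint and cover the
    union of the sets [u j < 0]. The first component is built from the open sets
    [u j < 0], the second from the closed sets [u j <= 0]; each removes at every
    step what the other has reached, so that the first stays open and the
    second closed. They differ only near the zero sets of the functions. *)
Fixpoint greedy (js : seq J) : set Y * set Y :=
  if js is j :: js' then
    ((greedy js').1 `|` ([set y | u j y < 0] `&`
        \bigcap_(g in [set` E]) (act g @^-1` ~` (greedy js').2)),
     (greedy js').2 `|` ([set y | u j y <= 0] `&`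
        \bigcap_(g in [set` E]) (act g @^-1` ~` (greedy js').1)))
  else (set0, set0).

Lemma greedy_open_closed js : (forall j, continuous (u j)) ->
  open (greedy js).1 /\ closed (greedy js).2.
Proof.
have [_ _ _ ac] := sysY; move=> uc.
elim: js => [|j js [oW cV]] /=; first by split; [exact: open0|exact: closed0].
split.
  apply: openU => //; apply: openI.
    apply: (@open_comp _ _ (u j) [set r | r < 0]) => [y _|]; [exact: uc|].
    exact: open_lt.
  apply: open_bigcap_finite; first exact: finite_fset.
  move=> g _; apply: open_comp; first by move=> *; exact: ac.
  exact: closed_openC.
apply: closedU => //; apply: closedI.
  apply: (@closed_comp _ _ (u j) [set r | r <= 0]) => [y _|]; [exact: uc|].
  exact: closed_le.
apply: closed_bigI => g _; apply: closed_comp; first by move=> *; exact: ac.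
exact: open_closedC.
Qed.

Lemma greedy_sub js : (greedy js).1 `<=` (greedy js).2.
Proof.
elim: js => [//|j js IH] y /= [/IH|[uy h]]; first by left.
by right; split; [exact: ltW|move=> g gE /IH; exact: h].
Qed.

Lemma greedy_disjoint js :
  (forall j g y, g \in E -> u j y < 0 -> u j (act g y) < 0 -> g = 1%g) ->
  forall g y, g \in E -> (greedy js).1 y -> (greedy js).1 (act g y) -> g = 1%g.
Proof.
move=> sep; elim: js => [//|j js IH] g y gE /=.
move=> [Wy|[uy hy]] [Wgy|[ugy hgy]].
- exact: IH Wy Wgy.
- have /= := hgy _ (EV gE); rewrite act_inv => h.
  by case: h; exact: greedy_sub.
- by case: (hy _ gE); exact: greedy_sub.
- exact: sep uy ugy.
Qed.

Fixpoint fpower n : {fset G} :=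
  if n is n'.+1 then [fset h * g | h in fpower n', g in E]%fset%g
  else [fset 1%g]%fset.

Lemma fpowerS n h g : h \in fpower n -> g \in E -> (h * g)%g \in fpower n.+1.
Proof. by move=> hn gE; apply/imfset2P; exists h => //; exists g. Qed.

Lemma fpower_mono n h : h \in fpower n -> h \in fpower n.+1.
Proof. by move=> hn; rewrite -[h]mulg1 fpowerS. Qed.

Lemma fpower1 n : 1%g \in fpower n.
Proof. by elim: n => [|n IH]; [rewrite inE|exact: fpower_mono]. Qed.

Definition generic n y := forall j h, h \in fpower n -> u j (act h y) != 0.

Lemma generic_act n g y : g \in E -> generic n.+1 y -> generic n (act g y).
Proof.
have [_ _ aM _] := sysY; move=> gE gen j h hn; rewrite -aM.
by apply: gen; exact: fpowerS.
Qed.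

Lemma generic_pred n y : generic n.+1 y -> generic n y.
Proof.
by have [_ a1 _ _] := sysY; move=> /(generic_act E1); rewrite a1.
Qed.

(** Each step of the greedy choice looks one translate further, so a point that
    only one of the two sets contains has a translate by a product of at most
    [size js] elements of [E] at which some [u j] vanishes. *)
Lemma greedy_generic js y : generic (size js) y ->
  (greedy js).2 y -> (greedy js).1 y.
Proof.
have [_ a1 _ _] := sysY.
elim: js y => [//|j js IH] y gen /= [Vy|[uy hy]].
  by left; apply: IH => //; exact: generic_pred gen.
right; split.
  by rewrite lt_neqAle uy andbT -[y]a1; apply: gen; exact: fpower1.
by move=> g gE /= Vgy; apply: (hy g gE); apply: IH => //; exact: generic_act gen.
Qed.

Lemma greedy_cover js y : generic (size js) y ->
  (exists2 j, j \in js & u j y < 0) ->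
  exists2 g, g \in E & (greedy js).1 (act g y).
Proof.
have [_ a1 _ _] := sysY.
elim: js => [gen [] //|i js IH] gen [j jjs jy] /=.
have [[g gE Vgy]|nV] := pselect (exists2 g, g \in E & (greedy js).2 (act g y)).
  by exists g => //; left; apply: greedy_generic => //; exact: generic_act gen.
move: jjs; rewrite inE => /orP[/eqP ji|jjs].
  exists 1%g => //; right; rewrite a1 -ji; split=> // g gE /= Vgy.
  by apply: nV; exists g.
have [|g gE Wg] := IH (generic_pred gen); first by exists j.
by exists g => //; left.
Qed.

End Greedy.

Variable d : nat.
Hypothesis freeY : is_free act.
Hypothesis dimY : forall U : set (set Y), finite_open_cover U -> has_pou R U d.+1.

Let cY : compact [set: Y]. Proof. by case: sysY. Qed.
Let actc g : continuous (act g). Proof. by case: sysY => _ _ _; exact. Qed.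

(** The condition asks the map to [R^(d+1)] formed by the translated members
    [f (l, jj l)] to avoid the origin. Its components come from distinct members
    of the family, so perturbing the map amounts to perturbing the family. *)
Lemma dense_no_common_zero (J : finType) (gam : 'I_d.+1 -> G)
    (jj : 'I_d.+1 -> J) :
  dense_condition (fun f : 'I_d.+1 * J -> Y -> R =>
    forall y, [set: Y] y -> exists l, 0 < `|f (l, jj l) (act (gam l) y)|).
Proof.
move=> f e fc e0.
pose v l y := f (l, jj l) (act (gam l) y).
have vc l : continuous (v l).
  by move=> y; apply: continuous_comp; [exact: actc|exact: fc].
have e2 : 0 < e / 2 by rewrite divr_gt0.
have [V Vfoc [Vsmall _]] := exists_small_variation_cover cY e2 vc
  (@finite_open_cover_setT Y).
have [|w [wc wv w0]] := approx_avoiding0 (dimY Vfoc) e2 _ Vsmall.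
  by rewrite card_ord.
exists (fun lj y => if lj.2 == jj lj.1 then w lj.1 (act (gam lj.1)^-1%g y)
                    else f lj y); split.
- move=> [l j] /=; case: eqP => _; last exact: fc.
  by move=> y; apply: continuous_comp; [exact: actc|exact: wc].
- move=> [l j] y /=; case: eqP => [->|_]; last by rewrite subrr normr0 ltW.
  have := wv l (act (gam l)^-1%g y); rewrite /v act_invV distrC.
  by rewrite mulrC divfK.
- move=> y _; have [l wl] := w0 y; exists l.
  by rewrite /= eqxx act_inv normr_gt0.
Qed.

Let open_no_common_zero (J : finType) (gam : 'I_d.+1 -> G)
    (jj : 'I_d.+1 -> J) :
  open_condition (fun f : 'I_d.+1 * J -> Y -> R =>
    forall y, [set: Y] y -> exists l, 0 < `|f (l, jj l) (act (gam l) y)|).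
Proof.
apply: open_pos_condition => // [l f fc y|l e f g y fg].
  apply: (@continuous_comp _ _ _ (fun y => f (l, jj l) (act (gam l) y))).
    by apply: continuous_comp; [exact: actc|exact: fc].
  exact: norm_continuous.
apply: norm_le_double; apply: le_trans (ler_dist_dist _ _) _; exact: fg.
Qed.

(** Each set is a greedy choice from its own perturbation of one cover by small
    balls. A point missed by a greedy choice has a translate at which one of the
    corresponding functions vanishes, so in general position no point is missed
    by all [d + 1] choices. *)
Lemma marker_sets (E : {fset G}) : 1%g \in E ->
  (forall g, g \in E -> g^-1%g \in E) ->
  exists W : 'I_d.+1 -> set Y,
    [/\ forall l, open (W l),
        forall l g y, g \in E -> W l y -> W l (act g y) -> g = 1%g &
        forall y, exists l, exists2 g, g \in E & W l (act g y)].
Proof.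
move=> E1 EV; have [_ a1 aM _] := sysY.
have [r r0 rE] : exists2 r : R, 0 < r &
    forall g y, g \in E -> g != 1%g -> r < mdist y (act g y).
  have /choice[r hr] : forall g, exists r : R, 0 < r /\
      (g != 1%g -> forall y, r < mdist y (act g y)).
    move=> g; have [->|g1] := eqVneq g 1%g; first by exists 1.
    have [i|y _|r r0 hr] := @compact_uniformly_pos _ _ _ unit
      (fun _ y => mdist y (act g y)) cY.
    - by apply: mdist_continuous => //; move=> y; exact: cvg_id.
    - by exists tt; rewrite mdist_gt0; apply/eqP => /esym/freeY; apply; exact/eqP.
    - by exists r; split=> // _ y; have [] := hr y.
  exists (\big[Num.min/1]_(g : E) r (val g)).
    by apply: lt_bigmin => // g _; have [] := hr (val g).
  move=> g y gE g1; apply: le_lt_trans ((hr g).2 g1 y).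
  exact: (@bigmin_le_cond _ _ _ _ (FSetSub gE) predT (fun g : E => r (val g))).
have r30 : 0 < r / 3 by rewrite divr_gt0.
have [y|U [finU _ covU] Uball] := @compact_finite_open_cover Y
    (fun A => exists y, A = ball y (r / 3)) cY.
  exists (ball y (r / 3)); split; [exact: metric_ball_open|exact: ballxx|].
  by exists y.
pose J : finType := fset_set U.
have JU (j : J) : U (val j) by have := valP j; rewrite in_fset_set// inE.
pose c (j : J) : Y := sval (cid (Uball _ (JU j))).
have cE (j : J) : val j = ball (c j) (r / 3) := svalP (cid (Uball _ (JU j))).
pose f0 (lj : 'I_d.+1 * J) y : R := mdist (c lj.2) y - r / 3.
have f0c : fam_continuous f0.
  move=> lj y; apply: continuousB; last exact: cst_continuous.
  by apply: mdist_continuous; [exact: cst_continuous|move=> z; exact: cvg_id].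
(* Makes the translates of each greedy choice reach every generic point. *)
pose cond1 l (f : 'I_d.+1 * J -> Y -> R) :=
  forall y, [set: Y] y -> exists j, 0 < - f (l, j) y.
have open1 l : open_condition (cond1 l).
  apply: open_pos_condition => // [j f fc y|j e f g y /(_ (l, j) y)].
    by apply: continuousN; exact: fc.
  by rewrite -opprD normrN; exact: norm_le_double.
(* Makes the translates of each greedy choice disjoint. *)
pose cond2 (p : 'I_d.+1 * J * E) (f : 'I_d.+1 * J -> Y -> R) :=
  val p.2 = 1%g \/ forall y, [set: Y] y ->
    exists b : bool, 0 < if b then f p.1 y else f p.1 (act (val p.2) y).
have open2 p : open_condition (cond2 p).
  case: p => lj g; have [g1|g1] := eqVneq (val g) 1%g.
    by move=> f _ _; exists 1 => // h _ _; left.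
  move=> f fc [/eqP|hf]; first by rewrite (negbTE g1).
  have [b h hc|b e h h' y hh'|e e0 he] := @open_pos_condition R Y Y _ bool
    [set: Y] (fun b f y => if b then f lj y else f lj (act (val g) y)) cY _ _
    f fc hf.
  - case: b; first exact: hc.
    by move=> y; apply: continuous_comp; [exact: actc|exact: hc].
  - by case: b; apply: norm_le_double; exact: hh'.
  - by exists e => // h hc fh; right; exact: he.
have [|e1 e10 He1] := open_condition_and open1 f0c.
  move=> l y _; have : [set: Y] y by []; rewrite -covU => -[A UA Ay].
  have AJ : A \in fset_set U by rewrite in_fset_set// inE.
  exists (FSetSub AJ); rewrite opprB subr_gt0.
  have : val (FSetSub AJ : J) y by [].
  by rewrite cE ballEmdist.
have [|e2 e20 He2] := open_condition_and open2 f0c.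
  move=> [[l j] g]; have [|g1] := eqVneq (val g) 1%g; first by left.
  right=> y _; apply: contrapT => h; have := rE _ y (valP g) g1.
  have h1 : mdist (c j) y - r / 3 <= 0.
    by rewrite leNgt; apply/negP => h1; apply: h; exists true.
  have h2 : mdist (c j) (act (val g) y) - r / 3 <= 0.
    by rewrite leNgt; apply/negP => h2; apply: h; exists false.
  have := metric_triangle y (c j) (act (val g) y).
  by rewrite (metric_sym y (c j)); lra.
pose n := size (enum J).
pose K := ({ffun 'I_d.+1 -> fpower E n} * {ffun 'I_d.+1 -> J})%type.
(* The zero sets of the [d + 1] families are in general position, even after
   translation. *)
pose cond3 (p : K) (f : 'I_d.+1 * J -> Y -> R) := forall y, [set: Y] y ->
  exists l, 0 < `|f (l, p.2 l) (act (val (p.1 l)) y)|.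
have [|f [fc ff0 Hf]] := @dense_condition_and R Y ('I_d.+1 * J)%type K cond3
  (fun p => @open_no_common_zero J (fun l => val (p.1 l)) p.2)
  (fun p => @dense_no_common_zero J (fun l => val (p.1 l)) p.2)
  f0 (Num.min e1 e2) f0c.
  by rewrite lt_min e10.
have ff1 : fam_close e1 f0 f.
  by move=> t y; apply: le_trans (ff0 t y) _; rewrite ge_min lexx.
have ff2 : fam_close e2 f0 f.
  by move=> t y; apply: le_trans (ff0 t y) _; rewrite ge_min lexx orbT.
pose u l j := f (l, j).
exists (fun l => (greedy E (u l) (enum J)).1); split.
- by move=> l; apply: (greedy_open_closed _ _ _).1 => // j; exact: fc.
- move=> l g y gE; apply: greedy_disjoint => // j {}g {}y {}gE uy ugy.
  case: (He2 f fc ff2 (l, j, FSetSub gE)) => //= /(_ y Logic.I)[[|]].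
    by rewrite ltNge (ltW uy).
  by rewrite ltNge (ltW ugy).
move=> y; apply: contrapT => nW.
have /choice[p hp] : forall l, exists p : fpower E n * J,
    u l p.2 (act (val p.1) y) = 0.
  move=> l; apply: contrapT => h; apply: nW; exists l.
  apply: greedy_cover => //.
    move=> j g gn; apply/eqP => uj; apply: h.
    by exists (FSetSub gn, j).
  have [j] := He1 f fc ff1 l y Logic.I; rewrite oppr_gt0 => uj.
  by exists j; rewrite ?mem_enum.
have [l] := Hf ([ffun l => (p l).1], [ffun l => (p l).2]) y Logic.I.
by rewrite /= !ffunE -/(u l (p l).2) hp normr0 ltxx.
Qed.

End Marker.

(** * Separating orbits by continuous functions *)

Section Cut.
Variable R : realType.
Implicit Type r : R.

Definition cut01 r : R := Num.min 1 (Num.max 0 r).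

Lemma cut01_itv r : 0 <= cut01 r <= 1.
Proof. by rewrite /cut01 le_min ler01 le_max lexx /= ge_min lexx. Qed.

Lemma cut01_eq1 r : 1 <= r -> cut01 r = 1.
Proof. by move=> h; rewrite /cut01 max_r ?min_l//; lra. Qed.

Lemma cut01_gt0 r : cut01 r != 0 -> 0 < r.
Proof.
by apply: contra_neqT; rewrite -leNgt => h; rewrite /cut01 max_l// min_r.
Qed.

Lemma continuous_cut01 (X : topologicalType) (h : X -> R) :
  continuous h -> continuous (fun x => cut01 (h x)).
Proof.
move=> hc x; have c (r : R) : continuous_at x (fun _ : X => r).
  exact: cst_continuous.
exact: (continuous_min (c 1) (continuous_max (c 0) (hc x))).
Qed.

End Cut.

Section Graft.
Variables (R : realType) (G : groupType) (X : metricType R) (act : G -> X -> X).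
Hypothesis sysX : is_system act.

(** The values of [f] at the points [gam p x] are replaced by prescribed
    functions of the base point [x] where [chi p] is [1], and left alone where it
    is [0]; the disjointness of the supports keeps the replacements apart. *)
Lemma graft (P : finType) (gam : P -> G) (chi Phi : P -> X -> R) (f : X -> R)
    (e : R) :
  (forall p, continuous (chi p)) -> (forall p, continuous (Phi p)) ->
  continuous f -> 0 <= e -> (forall p x, 0 <= chi p x <= 1) ->
  (forall p q x, chi p (act (gam p)^-1%g x) != 0 ->
     chi q (act (gam q)^-1%g x) != 0 -> p = q) ->
  (forall p x, `|Phi p x - f (act (gam p) x)| <= e) ->
  exists f' : X -> R, [/\ continuous f', forall x, `|f x - f' x| <= e &
    forall p x, chi p x = 1 -> f' (act (gam p) x) = Phi p x].
Proof.
move=> chic Phic fc e0 chi01 disj close; have [_ a1 aM ac] := sysX.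
pose term p x := chi p (act (gam p)^-1%g x) * (Phi p (act (gam p)^-1%g x) - f x).
have termc p : continuous (term p).
  have cc (h : X -> R) : continuous h ->
      continuous (fun x => h (act (gam p)^-1%g x)).
    by move=> hc x; apply: continuous_comp; [exact: ac|exact: hc].
  move=> x.
  exact: (continuousM (cc _ (chic p) x) (continuousB (cc _ (Phic p) x) (fc x))).
have [F FE] : exists F : X -> R, forall x, F x = f x + \sum_p term p x.
  by exists (fun x => f x + \sum_p term p x).
(* At most one term of the sum is nonzero at a given point. *)
have FE1 p x : chi p (act (gam p)^-1%g x) != 0 -> F x = f x + term p x.
  move=> px; rewrite FE (bigD1 p)//= big1 ?addr0// => q qp; rewrite /term.
  have [->|qx] := eqVneq (chi q (act (gam q)^-1%g x)) 0; first by rewrite mul0r.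
  by move: qp; rewrite (disj _ _ _ qx px) eqxx.
exists F; split.
- rewrite (_ : F = fun x => f x + \sum_p term p x); last exact/funext.
  by move=> x; apply: continuousD; [exact: fc|exact: continuous_sum_fun].
- move=> x; have [[p px]|np] := pselect (exists p, chi p (act (gam p)^-1%g x) != 0).
    rewrite (FE1 p)// opprD addrA subrr add0r normrN normrM.
    have /andP[c0 c1] := chi01 p (act (gam p)^-1%g x).
    rewrite (ger0_norm c0) -[e]mul1r ler_pM//.
    by have := close p (act (gam p)^-1%g x); rewrite act_invV.
  rewrite FE big1 ?addr0 ?subrr ?normr0// => p _; rewrite /term.
  have [->|px] := eqVneq (chi p (act (gam p)^-1%g x)) 0; first by rewrite mul0r.
  by case: np; exists p.
move=> p x px; have E : act (gam p)^-1%g (act (gam p) x) = x by rewrite act_inv.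
by rewrite (FE1 p) /term E px ?oner_neq0// mul1r addrC subrK.
Qed.

End Graft.

Lemma inv_nat_le (R : realType) (D : R) :
  0 < D -> exists n : nat, n.+1%:R^-1 <= D.
Proof.
move=> D0; exists (Num.bound D^-1); rewrite invf_ple ?posrE//.
apply: ltW; apply: (lt_trans (archi_boundP _)); first by rewrite invr_ge0 ltW.
by rewrite ltr_nat.
Qed.

Section CompactPairs.
Variables (R : realType) (G : groupType) (X : metricType R) (act : G -> X -> X).
Variable T : Type.
Hypothesis sysX : is_system act.

Definition separates (f : T -> X -> R) (z : X * X) : Prop :=
  exists gt : G * T, 0 < `|f gt.2 (act gt.1 z.1) - f gt.2 (act gt.1 z.2)|.

Lemma compact_pairs : compact [set: X * X].
Proof.
by have [cX _ _ _] := sysX; rewrite -setXTT; exact: compact_setX.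
Qed.

Lemma closed_far_pairs (e : R) : closed [set z : X * X | e <= mdist z.1 z.2].
Proof.
apply: (@closed_comp _ _ (fun z : X * X => mdist z.1 z.2 : R) [set r | e <= r]).
  by move=> z _; apply: mdist_continuous => w; [exact: cvg_fst|exact: cvg_snd].
exact: closed_ge.
Qed.

Lemma open_separates (K : set (X * X)) : closed K ->
  open_condition (fun f => forall z, K z -> separates f z).
Proof.
move=> cK; have [_ _ _ ac] := sysX.
apply: open_pos_condition.
- exact: (subclosed_compact cK compact_pairs).
- move=> [g t] f fc z /=.
  apply: (@continuous_comp _ _ _
    (fun z : X * X => f t (act g z.1) - f t (act g z.2)) (fun r => `|r|)).
    apply: continuousB.
      apply: (@continuous_comp _ _ _ (fun z : X * X => act g z.1) (f t)).
        by apply: continuous_comp; [exact: cvg_fst|exact: ac].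
      exact: fc.
    apply: (@continuous_comp _ _ _ (fun z : X * X => act g z.2) (f t)).
      by apply: continuous_comp; [exact: cvg_snd|exact: ac].
    exact: fc.
  exact: norm_continuous.
move=> [g t] e f h z /= fh; apply: le_trans (ler_dist_dist _ _) _.
rewrite (_ : _ - _ = (f t (act g z.1) - h t (act g z.1)) -
                     (f t (act g z.2) - h t (act g z.2))); last by ring.
by rewrite (le_trans (ler_normB _ _))// mulr_natl mulr2n lerD.
Qed.

End CompactPairs.

Section Jaworski.
Variables (R : realType) (G : groupType) (Y : metricType R) (act : G -> Y -> Y).
Variable d : nat.
Hypotheses (sysY : is_system act) (freeY : is_free act).
Hypothesis dimY : forall U : set (set Y), finite_open_cover U -> has_pou R U d.+1.
Hypothesis infG : infinite_set [set: G].

Lemma free_transporter_finite (x y : Y) : finite_set [set g | act g x = y].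
Proof.
have [_ a1 aM _] := sysY.
have [[g gx]|ng] := pselect (exists g, act g x = y); last first.
  rewrite (_ : [set _ | _] = set0); first exact: finite_set0.
  by apply/seteqP; split=> // g gx; case: ng; exists g.
apply: (sub_finite_set (B := [set g])); last exact: finite_set1.
move=> h /= hx; apply: contrapT => hg.
apply: (freeY (x := x) (g := (g^-1 * h)%g)); last by rewrite aM hx -gx act_inv.
by move=> e; apply: hg; rewrite -[h](mulVKg g) e mulg1.
Qed.

Lemma independent_translates (c : bool -> Y) n : c true <> c false ->
  exists gam : 'I_n -> G, forall b b' i j,
    act (gam i) (c b) = act (gam j) (c b') -> (b, i) = (b', j).
Proof.
move=> cc; elim: n => [|n [gam IH]].
  by exists (fun _ => 1%g) => b b' [].
have : finite_set (\bigcup_(t in [set: 'I_n * bool * bool])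
    [set g | act g (c t.1.2) = act (gam t.1.1) (c t.2)]).
  apply: bigcup_finite; first exact: finite_finset.
  by move=> t _; exact: free_transporter_finite.
move=> fin; have [g ng] : exists g, ~ (\bigcup_(t in [set: 'I_n * bool * bool])
    [set g | act g (c t.1.2) = act (gam t.1.1) (c t.2)]) g.
  apply: contrapT => h; apply: infG; apply: sub_finite_set fin => g _.
  by apply: contrapT => hg; apply: h; exists g.
exists (fun i => if unlift ord_max i is Some j then gam j else g).
move=> b b' i j; case: unliftP => [i' ->|->]; case: unliftP => [j' ->|->].
- by move=> /IH[-> ->].
- by move=> h; case: ng; exists (i', b', b) => //=.
- by move=> h; case: ng; exists (j', b, b') => //=.
- move=> h; suff -> : b = b' by [].
  have := congr1 (act g^-1%g) h; rewrite !act_inv//.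
  by case: b b' {h} => -[] // h; case: cc.
Qed.

(** The values of [f] along the [2d + 2] translates of a neighbourhood of [z.1]
    and of a neighbourhood of [z.2] form two maps to [R^(2d+2)]. All these
    translates being disjoint, the maps can be perturbed independently, and their
    images made disjoint. *)
Lemma dense_separates_near (z : Y * Y) : z.1 <> z.2 ->
  exists2 e : R, 0 < e & dense_condition (fun f : unit -> Y -> R =>
    forall w, mdist z.1 w.1 <= e -> mdist z.2 w.2 <= e -> separates act f w).
Proof.
move=> zz; have [cY a1 aM ac] := sysY.
pose c (b : bool) := if b then z.1 else z.2.
pose k := (d.+1 + d.+1)%N.
have [gam gamP] : exists gam : 'I_k -> G, forall b b' i j,
    act (gam i) (c b) = act (gam j) (c b') -> (b, i) = (b', j).
  exact: independent_translates.
pose P : finType := (bool * 'I_k)%type.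
have /choice[r hr] : forall pq : P * P, exists r : R, 0 < r /\
    (pq.1 != pq.2 -> forall x y, mdist (c pq.1.1) x < r -> mdist (c pq.2.1) y < r ->
       act (gam pq.1.2) x <> act (gam pq.2.2) y).
  move=> [[b i] [b' j]] /=; have [_|ne] := eqVneq (b, i) (b', j); first by exists 1.
  pose D := mdist (act (gam i) (c b)) (act (gam j) (c b')).
  have D0 : 0 < D by rewrite mdist_gt0; apply: contra_neq ne => /gamP.
  have near (a : bool) l : exists2 r : R, 0 < r & forall x, mdist (c a) x < r ->
      mdist (act (gam l) (c a)) (act (gam l) x) < D / 2.
    have : nbhs (c a) (act (gam l) @^-1` ball (act (gam l) (c a)) (D / 2)).
      by apply: (ac (gam l)); apply: nbhsx_ballx; rewrite divr_gt0.
    move=> /nbhs_ballP[r/= r0 sub]; exists r => // x xr.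
    by have := sub x; rewrite !ballEmdist/=; apply.
  have [r1 r10 h1] := near b i; have [r2 r20 h2] := near b' j.
  exists (Num.min r1 r2); split=> [|_ x y]; first by rewrite lt_min r10.
  rewrite !lt_min => /andP[/h1 h1' _] /andP[_ /h2 h2'] E.
  have := metric_triangle (act (gam i) (c b)) (act (gam i) x) (act (gam j) (c b')).
  by rewrite -/D {2}E (metric_sym _ (act (gam j) (c b'))); lra.
pose r0 := \big[Num.min/1]_pq r pq.
have r00 : 0 < r0 by apply: lt_bigmin => // pq _; have [] := hr pq.
have r0P p q x y : mdist (c p.1) x < r0 -> mdist (c q.1) y < r0 ->
    act (gam p.2) x = act (gam q.2) y -> p = q.
  move=> px qy E; apply: contrapT => /eqP pq.
  have r0pq : r0 <= r (p, q) by exact: (@bigmin_le_cond _ _ _ _ (p, q) predT r).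
  by apply: (hr (p, q)).2 E => //=; apply: lt_le_trans r0pq.
exists (r0 / 2); first by rewrite divr_gt0.
move=> f e fc e0.
pose chi (b : bool) x : R := cut01 (2 - mdist (c b) x / (r0 / 2)).
have chic b : continuous (chi b).
  have dc : continuous (fun x => mdist (c b) x : R).
    by apply: mdist_continuous; [exact: cst_continuous|move=> y; exact: cvg_id].
  have cc (t : R) x : continuous_at x (fun _ : Y => t) by exact: cst_continuous.
  apply: continuous_cut01 => x.
  exact: (continuousB (cc 2 x) (continuousM (dc x) (cc (r0 / 2)^-1 x))).
have chi1 b x : mdist (c b) x <= r0 / 2 -> chi b x = 1.
  move=> h; apply: cut01_eq1; suff : mdist (c b) x / (r0 / 2) <= 1 by lra.
  by rewrite ler_pdivrMr ?mul1r ?divr_gt0.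
have chi0 b x : chi b x != 0 -> mdist (c b) x < r0.
  move/cut01_gt0; rewrite subr_gt0 ltr_pdivrMr ?divr_gt0//.
  by rewrite [2 * _]mulrC divfK.
pose v i x := f tt (act (gam i) x).
have vc i : continuous (v i).
  by move=> x; apply: continuous_comp; [exact: ac|exact: fc].
have e2 : 0 < e / 2 by rewrite divr_gt0.
have [V Vfoc [Vsmall _]] := exists_small_variation_cover cY e2 vc
  (@finite_open_cover_setT Y).
have [|w [w' [wc wv ww']]] :=
    approx_disjoint_images (dimY Vfoc) e2 _ Vsmall Vsmall.
  by rewrite card_ord.
pose Phi (p : P) x := if p.1 then w p.2 x else w' p.2 x.
have ee : 2 * (e / 2) = e by rewrite mulrC divfK.
have [||||f' [f'c ff' f'P]] := @graft R G Y act sysY P (fun p => gam p.2)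
  (fun p => chi p.1) Phi (f tt) e (fun p => chic p.1) _ (fc tt) (ltW e0) _ _ _.
- by move=> [[] i]; rewrite /Phi/=; have [] := wc i.
- by move=> p x; exact: cut01_itv.
- move=> p q x /chi0 px /chi0 qx; apply: (r0P _ _ _ _ px qx).
  by rewrite !act_invV.
- by move=> [[] i] x; rewrite /Phi/=; have [] := wv i x; rewrite ee.
exists (fun _ => f'); split; [by move=> _|by case|].
move=> y h1 h2; have [i wi] := ww' y.1 y.2; exists (gam i, tt).
rewrite normr_gt0 subr_eq0 /=.
rewrite (f'P (true, i)) ?(f'P (false, i)) //=; exact: chi1.
Qed.

(** By category: the pairs of points at distance at least [1 / (n + 1)] form a
    compact set, so finitely many of the local conditions of
    [dense_separates_near] take care of them, together with neighbourhoods of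
    diagonal points that contain no such pair. *)
Lemma exists_orbit_separating : exists2 u : Y -> R, continuous u &
  forall x y, (forall g, u (act g x) = u (act g y)) -> x = y.
Proof.
have [cY a1 aM ac] := sysY.
pose K n := [set z : Y * Y | n.+1%:R^-1 <= mdist z.1 z.2].
pose Pn n (f : unit -> Y -> R) := forall z, K n z -> separates act f z.
have opP n : open_condition (Pn n).
  by apply: open_separates => //; exact: closed_far_pairs.
have deP n : dense_condition (Pn n).
  pose good (C : set (Y * Y)) := closed C /\
    dense_condition (fun f : unit -> Y -> R =>
      forall z, (C `&` K n) z -> separates act f z).
  have n0 : 0 < n.+1%:R^-1 / 2 :> R by rewrite divr_gt0 ?invr_gt0.
  have [z|U [finU _ covU] Ugood] := @compact_finite_open_cover (Y * Y)%type
    (fun A => exists2 C, A `<=` C & good C) (compact_pairs sysY).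
    have [zz|zz] := pselect (z.1 = z.2).
      exists [set w | mdist w.1 w.2 < n.+1%:R^-1 / 2]; split.
      - apply: (@open_comp _ _ (fun z : Y * Y => mdist z.1 z.2 : R)
          [set r | r < n.+1%:R^-1 / 2]).
          move=> w _; apply: mdist_continuous => ?; [exact: cvg_fst|].
          exact: cvg_snd.
        exact: open_lt.
      - by rewrite /= zz mdistxx.
      exists [set w | mdist w.1 w.2 <= n.+1%:R^-1 / 2]; first by move=> w /ltW.
      split.
        apply: (@closed_comp _ _ (fun z : Y * Y => mdist z.1 z.2 : R)
          [set r | r <= n.+1%:R^-1 / 2]).
          move=> w _; apply: mdist_continuous => ?; [exact: cvg_fst|].
          exact: cvg_snd.
        exact: closed_le.
      move=> f e fc e0; exists f; split=> //.
        by move=> t x; rewrite subrr normr0 ltW.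
      move=> w [/= h1 h2]; have := le_trans h2 h1; rewrite ler_pdivlMr// mulr_natr.
      by rewrite -subr_le0 mulr2n addrK leNgt invr_gt0 ltr0Sn.
    have [e e0 dense] := dense_separates_near zz.
    exists (ball z.1 e `*` ball z.2 e); split.
    - apply: (@openI _ (fst @^-1` ball z.1 e) (snd @^-1` ball z.2 e)).
        by apply: open_comp => [? _|]; [exact: cvg_fst|exact: metric_ball_open].
      by apply: open_comp => [? _|]; [exact: cvg_snd|exact: metric_ball_open].
    - by split; exact: ballxx.
    exists [set w | mdist z.1 w.1 <= e /\ mdist z.2 w.2 <= e].
      by move=> w []; rewrite !ballEmdist/= => /ltW ? /ltW.
    split.
      have cl (p : Y * Y -> Y) y : continuous p ->
          closed [set w | mdist y (p w) <= e].
        move=> pc; apply: (@closed_comp _ _ (fun w => mdist y (p w) : R)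
          [set r | r <= e]); last exact: closed_le.
        by move=> w _; apply: mdist_continuous => //; exact: cst_continuous.
      by apply: closedI; apply: cl => w; [exact: cvg_fst|exact: cvg_snd].
    move=> f r fc r0; have [g [gc fg gP]] := dense f r fc r0.
    by exists g; split=> // w [[h1 h2] _]; exact: gP.
  pose J : finType := fset_set U.
  have JU (j : J) : U (val j) by have := valP j; rewrite in_fset_set// inE.
  have /choice[C hC] : forall j : J, exists C, val j `<=` C /\ good C.
    by move=> j; have [C] := Ugood _ (JU j); exists C.
  move=> f e fc e0; have [j|j|g [gc fg gP]] := @dense_condition_and R Y unit J
    (fun j f => forall z, (C j `&` K n) z -> separates act f z) _ _ f e fc e0.
  - apply: open_separates => //; apply: closedI; last exact: closed_far_pairs.
    by have [_ []] := hC j.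
  - by have [_ []] := hC j.
  exists g; split=> // z Kz; have : [set: Y * Y] z by [].
  rewrite -covU => -[A UA Az].
  have AJ : A \in fset_set U by rewrite in_fset_set// inE.
  apply: (gP (FSetSub AJ)); split=> //.
  by apply: (hC (FSetSub AJ)).1.
have [|u [uc _ uP]] := baire_families opP deP (f := fun _ _ => 0) _ ltr01.
  by move=> _; exact: cst_continuous.
exists (u tt); first exact: uc.
move=> x y xy; apply: contrapT => /eqP; rewrite -mdist_gt0 => D0.
have [n nD] := inv_nat_le D0.
have [[g []] /=] := uP n (x, y) nD.
by rewrite xy subrr normr0 ltxx.
Qed.

End Jaworski.

Definition quotients (G : groupType) (F : {fset G}) : {fset G} :=
  [fset x^-1 * y | x in F, y in F]%fset%g.

Lemma quotientsP (G : groupType) (F : {fset G}) g :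
  reflect (exists x y, [/\ x \in F, y \in F & g = (x^-1 * y)%g])
          (g \in quotients F).
Proof.
apply: (iffP idP) => [/imfset2P[x xF [y yF ->]]|[x [y [xF yF ->]]]].
  by exists x, y.
by apply/imfset2P; exists x => //; exists y.
Qed.

Section FibreSeparation.
Variables (R : realType) (G : groupType) (X Y : metricType R).
Variables (actX : G -> X -> X) (actY : G -> Y -> Y) (pi : X -> Y) (d p : nat).
Hypotheses (sysX : is_system actX) (sysY : is_system actY).
Hypotheses (pic : continuous pi) (piE : forall g x, pi (actX g x) = actY g (pi x)).
Hypothesis freeY : is_free actY.
Hypothesis dimY : forall U : set (set Y), finite_open_cover U -> has_pou R U d.+1.
Hypothesis narrow : forall U : set (set X), finite_open_cover U ->
  exists F : {fset G}, 1%g \in F /\ exists k,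
    has_pou R (dynamical_cover actX U (quotients F)) k /\
    (k + k <= p * #|` F|)%N.

Let T := ('I_d.+1 * 'I_p)%type.

Let far_pairs n : set (X * X) :=
  [set z | pi z.1 = pi z.2] `&` [set z | n.+1%:R^-1 <= mdist z.1 z.2].

Let closed_far n : closed (far_pairs n).
Proof.
apply: closedI; last exact: closed_far_pairs.
rewrite (_ : [set _ | _] = [set z : X * X | mdist (pi z.1) (pi z.2) <= 0]).
  apply: (@closed_comp _ _ (fun z : X * X => mdist (pi z.1) (pi z.2) : R)
    [set r | r <= 0]); last exact: closed_le.
  move=> z _; apply: mdist_continuous => w; apply: continuous_comp;
    solve [exact: cvg_fst|exact: cvg_snd|exact: pic].
apply/seteqP; split => z /= => [->|]; first by rewrite mdistxx.
move=> h; apply: (@mdist_positivity R); apply/eqP.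
by rewrite eq_le h mdist_ge0.
Qed.

(** The towers over marker sets of the factor carry a code: along the [F]-orbit
    piece over a marker point [z], the [p] functions of one colour are replaced
    by [p * #|F|] functions of [z] that determine the position of the points
    [g z], for [g] in [F^-1 F], up to a small error. Two points of a fibre have
    the same towers, and every point is reached from a marker point by an element
    of [F^-1 F], which is why the finer code is needed there. *)
Lemma dense_separates_fibres n :
  dense_condition (fun f : T -> X -> R =>
    forall z, far_pairs n z -> separates actX f z).
Proof.
move=> f e fc e0; have [cX a1 aM ac] := sysX; have [_ b1 bM bc] := sysY.
have n0 : 0 < n.+1%:R^-1 / 2 :> R by rewrite divr_gt0 ?invr_gt0.
have [x|U0 U0foc U0small] := @compact_finite_open_cover X
    (fun A => exists x, A `<=` ball x (n.+1%:R^-1 / 2)) cX.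
  exists (ball x (n.+1%:R^-1 / 2)); split; last by exists x.
    exact: metric_ball_open.
  exact: ballxx.
have e2 : 0 < e / 2 by rewrite divr_gt0.
have [U Ufoc [Usmall UU0]] := exists_small_variation_cover cX e2 fc U0foc.
have Udiam A x x' : U A -> A x -> A x' -> mdist x x' < n.+1%:R^-1.
  move=> /UU0[B /U0small[y yB] AB] /AB/yB + /AB/yB; rewrite !ballEmdist/=.
  move=> h h'; apply: le_lt_trans (metric_triangle _ y _) _.
  by rewrite (metric_sym x) [ltRHS]splitr ltrD.
have [F [F1 [k [Ek kF]]]] := narrow Ufoc.
pose E := quotients F.
have FE g : g \in F -> g \in E.
  by move=> gF; apply/quotientsP; exists 1%g, g; rewrite invg1 mul1g.
have EV g : g \in E -> g^-1%g \in E.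
  move=> /quotientsP[x [y [xF yF ->]]]; apply/quotientsP; exists y, x.
  by rewrite invgM invgK.
have [W [Wopen Wdisj Wcov]] := marker_sets sysY freeY dimY (FE _ F1) EV.
pose rho l y : R := dist_fun (~` W l) y.
have rhoc l : continuous (rho l) by exact: dist_fun_continuous.
have rhoW l y : 0 < rho l y -> W l y.
  move=> h; apply: contrapT => nW; move: h.
  by rewrite /rho dist_fun0// ltxx.
have [|lg||eta eta0 etaP] := @compact_uniformly_pos R Y [set: Y] ('I_d.+1 * E)%type
    (fun lg y => rho lg.1 (actY (val lg.2) y)) _ _ _.
- by case: sysY.
- move=> y; apply: (@continuous_comp _ _ _ (actY (val lg.2)) (rho lg.1)).
    exact: bc.
  exact: rhoc.
- move=> y _; have [l [g gE Wg]] := Wcov y; exists (l, FSetSub gE) => /=.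
  by apply: dist_fun_gt0; [exact: open_closedC|apply].
pose chi l x := cut01 (rho l (pi x) / eta).
have chic l : continuous (chi l).
  apply: continuous_cut01 => x.
  have rc : continuous_at x (fun x => rho l (pi x)).
    by apply: (@continuous_comp _ _ _ pi (rho l)); [exact: pic|exact: rhoc].
  have cc : continuous_at x (fun _ : X => eta^-1) by exact: cst_continuous.
  exact: (continuousM rc cc).
have chiW l x : chi l x != 0 -> W l (pi x).
  by move/cut01_gt0; rewrite pmulr_lgt0 ?invr_gt0//; exact: rhoW.
pose I := ('I_p * F)%type.
pose v l (i : I) x := f (l, i.1) (actX (val i.2) x).
have vsmall l : small_variation (dynamical_cover actX U E) (e / 2) (v l).
  move=> _ [A AU <-] [t g] x x' /=.
  have gE : [set` E] (val g) by apply: FE; exact: valP.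
  by move=> /(_ _ gE) xA /(_ _ gE) x'A; apply: (Usmall _ (AU _ gE)).
have /choice[w hw] : forall l, exists w : I -> X -> R,
    [/\ forall i, continuous (w i), forall i x, `|w i x - v l i x| <= 2 * (e / 2) &
        forall x x', (forall i, w i x = w i x') ->
          exists2 A, dynamical_cover actX U E A & A x /\ A x'].
  move=> l; apply: approx_injective_mod Ek e2 _ _ (vsmall l).
  by rewrite card_prod card_ord -cardfE.
have ee : 2 * (e / 2) = e by rewrite mulrC divfK.
have /choice[f' hf'] : forall lt : T, exists f' : X -> R,
    [/\ continuous f', forall x, `|f lt x - f' x| <= e &
      forall (g : F) x, chi lt.1 x = 1 ->
        f' (actX (val g) x) = w lt.1 (lt.2, g) x].
  move=> [l t]; apply: (@graft R G X actX sysX F val (fun _ => chi l)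
    (fun g => w l (t, g)) (f (l, t)) e) => //.
  - by move=> g; have [] := hw l.
  - exact: ltW.
  - by move=> g x; exact: cut01_itv.
  - move=> g h x /chiW + /chiW; rewrite !piE => Wg Wh.
    apply: val_inj; apply/esym/eqP.
    rewrite -(inj_eq (mulgI (val h)^-1%g)) mulVg eq_sym.
    apply/eqP; apply: (Wdisj l _ _ _ Wg).
      by apply/quotientsP; exists (val h), (val g); rewrite !fsvalP.
    by rewrite bM act_invV.
  - by move=> g x; have [_ h _] := hw l; rewrite -[leRHS]ee; exact: (h (t, g)).
exists f'; split.
- by move=> lt; have [] := hf' lt.
- by move=> lt; have [] := hf' lt.
move=> [x x'] [/= xx' far]; apply: contrapT => nsep.
have same lt g : f' lt (actX g x) = f' lt (actX g x').
  apply/eqP; rewrite -subr_eq0 -normr_le0 leNgt; apply/negP => h.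
  by apply: nsep; exists (g, lt).
have [[l h] /= lh] := etaP (pi x) Logic.I.
have chi1 y : pi y = pi x -> chi l (actX (val h) y) = 1.
  move=> yx; apply: cut01_eq1; rewrite piE yx ler_pdivlMr// mul1r; exact: ltW.
have [_ _ winj] := hw l.
have [|_ [A AU <-] [Ax Ax']] := winj (actX (val h) x) (actX (val h) x').
  move=> [t g]; have [_ _ ft] := hf' (l, t).
  by rewrite -!ft ?chi1// -!aM.
have hE : [set` E] (val h)^-1%g by apply: EV; exact: valP.
have := Udiam _ _ _ (AU _ hE) (Ax _ hE) (Ax' _ hE).
by rewrite !act_inv// ltNge far.
Qed.

Lemma exists_fibre_separating : exists2 f : T -> X -> R, fam_continuous f &
  forall x x', pi x = pi x' ->
    (forall t g, f t (actX g x) = f t (actX g x')) -> x = x'.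
Proof.
have opP n : open_condition (fun f : T -> X -> R =>
    forall z, far_pairs n z -> separates actX f z).
  by apply: open_separates => //; exact: closed_far.
have [|f [fc _ fP]] := baire_families opP dense_separates_fibres
    (f := fun _ _ => 0) _ ltr01.
  by move=> _; exact: cst_continuous.
exists f => // x x' pxx' xx'; apply: contrapT => /eqP; rewrite -mdist_gt0 => D0.
have [n nD] := inv_nat_le D0.
have [[g t] /=] := fP n (x, x') (conj pxx' nD).
by rewrite xx' subrr normr0 ltxx.
Qed.

End FibreSeparation.

(** * Convergence along Folner sequences *)

Section Tiling.
Variable G : groupType.
Implicit Types (K F T C : {fset G}) (g k t : G).
Local Open Scope fset_scope.

Definition rtrans F (c : G) : {fset G} := [fset (x * c)%g | x in F].

Definition tiles F C : {fset G} := [fset (x * c)%g | x in F, c in C].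

Definition inner_bd K T : {fset G} :=
  [fset t in T | has (fun k => (k * t)%g \notin T) (enum_fset K)].

Definition outer_bd K F : {fset G} :=
  \bigcup_(k <- enum_fset K) (left_translate k^-1%g F `\` F).

Lemma rtransP F c t :
  reflect (exists2 x, x \in F & t = (x * c)%g) (t \in rtrans F c).
Proof. exact: imfsetP. Qed.

Lemma tilesP F C t :
  reflect (exists x c, [/\ x \in F, c \in C & t = (x * c)%g]) (t \in tiles F C).
Proof.
apply: (iffP idP) => [/imfset2P[x xF [c cC ->]]|[x [c [xF cC ->]]]].
  by exists x, c.
by apply/imfset2P; exists x => //; exists c.
Qed.

Lemma card_rtrans F c : #|` rtrans F c| = #|` F|.
Proof. by rewrite card_imfset//=; exact: mulIg. Qed.

Lemma card_subset_pairs (T1 T2 T3 : choiceType) (A : {fset T1}) (B : {fset T2})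
    (S : {fset T3}) (f : T1 -> T2 -> T3) :
  (forall x, x \in S -> exists a b, [/\ a \in A, b \in B & x = f a b]) ->
  (#|` S| <= #|` A| * #|` B|)%N.
Proof.
move=> h; rewrite -(size_allpairs f); apply: uniq_leq_size => // x /h.
by move=> [a [b [aA bB ->]]]; apply: allpairs_f.
Qed.

Lemma card_quotients F (L : nat) : approximate_group F L ->
  (#|` quotients F| <= L * #|` F|)%N.
Proof.
case=> L0 _ [g cov].
have -> : L = size (enum 'I_L) by rewrite size_enum_ord.
rewrite -(size_allpairs (fun i z => (g i * z)%g)); apply: uniq_leq_size => // q.
move=> /quotientsP[x [y [xF yF ->]]].
have [i _ [z zF <-]] :
    (\bigcup_(i in [set: 'I_L]) [set (g i * z)%g | z in [set` F]])%classic
    (x^-1 * y)%g by apply: cov; exists x => //; exists y.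
by apply: allpairs_f; rewrite // mem_enum.
Qed.

(** The family of translates [F c] is maximal among the disjoint families in
    [T]. A translate [F t] in [T] that cannot be added has [t] in [F^-1 F c] for
    some [c] of the family; so, up to its boundary, [T] has at most [L] times as
    many points as the family covers. *)
Lemma disjoint_tiles F T (L : nat) : 1%g \in F -> approximate_group F L ->
  exists C, [/\ tiles F C `<=` T, #|` tiles F C| = (#|` F| * #|` C|)%N &
    (#|` T `\` inner_bd F T| <= L * (#|` F| * #|` C|))%N].
Proof.
move=> F1 FL.
have [C [CT disj maxC]] : exists C, [/\ C `<=` T `\` inner_bd F T,
    forall c c' x x', c \in C -> c' \in C -> x \in F -> x' \in F ->
      (x * c = x' * c')%g -> c = c' &
    forall t, t \in T `\` inner_bd F T ->
      exists c x x', [/\ c \in C, x \in F, x' \in F & (x * t = x' * c)%g]].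
  have [C [CT disj maxC]] : exists C : {fset G},
      [/\ {subset C <= enum_fset (T `\` inner_bd F T)},
      forall c c' x x', c \in C -> c' \in C -> x \in F -> x' \in F ->
        (x * c = x' * c')%g -> c = c' &
      forall t, t \in enum_fset (T `\` inner_bd F T) ->
        exists c x x', [/\ c \in C, x \in F, x' \in F & (x * t = x' * c)%g]].
    elim: (enum_fset _) => [|t s [C [Cs disj maxC]]].
      by exists fset0; split=> // c.
    have [[c [x [x' h]]]|h] := pselect (exists c x x',
        [/\ c \in C, x \in F, x' \in F & (x * t = x' * c)%g]).
      exists C; split=> [c' /Cs|//|t']; first by rewrite inE orbC => ->.
      by rewrite inE => /orP[/eqP ->|/maxC//]; exists c, x, x'.
    exists (t |` C); split.
    - by move=> c; rewrite !inE => /orP[->//|/Cs ->]; rewrite orbT.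
    - move=> c c' x x'; rewrite !inE => /orP[/eqP ->|cC] /orP[/eqP ->|c'C]//.
      + by move=> xF x'F E; case: h; exists c', x, x'.
      + by move=> xF x'F E; case: h; exists c, x', x.
      + exact: disj.
    - move=> t'; rewrite inE => /orP[/eqP ->|/maxC[c [x [x' [cC xF x'F E]]]]].
        by exists t, 1%g, 1%g; rewrite !inE eqxx.
      by exists c, x, x'; split=> //; rewrite !inE cC orbT.
  by exists C; split=> //; apply/fsubsetP => c /CT.
exists C; split.
- apply/fsubsetP => _ /tilesP[x [c [xF /(fsubsetP CT) + ->]]].
  rewrite !inE negb_and => /andP[+ cT]; rewrite cT /= => /hasPn h.
  by have := h _ xF; rewrite negbK.
- apply/eqP; rewrite eqn_leq; apply/andP; split.
    by apply: (card_subset_pairs (f := fun x c => (x * c)%g)) => t /tilesP.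
  rewrite -(size_allpairs (fun x c => (x * c)%g)); apply: uniq_leq_size.
    apply: allpairs_uniq => // -[x c] [x' c'].
    move=> /allpairsP[[? ?] [/= xF cC [-> ->]]].
    move=> /allpairsP[[? ?] [/= x'F c'C [-> ->]]] E.
    have cc := disj _ _ _ _ cC c'C xF x'F E.
    by move: E; rewrite cc => /mulIg ->.
  by move=> t /allpairsP[[x c] [/= xF cC ->]]; apply/tilesP; exists x, c.
rewrite mulnA; apply: leq_trans (leq_mul (card_quotients FL) (leqnn _)).
apply: (card_subset_pairs (f := fun q c => (q * c)%g)) => t /maxC.
move=> [c [x [x' [cC xF x'F E]]]]; exists (x^-1 * x')%g, c; split=> //.
  by apply/quotientsP; exists x, x'.
by rewrite -mulgA -E mulKg.
Qed.

Lemma inner_bd_remainder K F T C : tiles F C `<=` T ->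
  (#|` inner_bd K (T `\` tiles F C)| <=
     #|` inner_bd K T| + #|` outer_bd K F| * #|` C|)%N.
Proof.
move=> CT.
apply: (@leq_trans (#|` inner_bd K T `|` tiles (outer_bd K F) C|)); last first.
  apply: leq_trans (_ : (#|` inner_bd K T| + #|` tiles (outer_bd K F) C|) <= _)%N.
    by rewrite cardfsU leq_subr.
  rewrite leq_add2l; apply: (card_subset_pairs (f := fun q c => (q * c)%g)).
  by move=> t /tilesP.
apply: fsubset_leq_card; apply/fsubsetP => t.
rewrite !inE => /andP[/andP[tV tT]] /hasP[k kK]; rewrite !inE negb_and negbK.
rewrite tT /= => /orP[ktV|ktT]; last by apply/orP; left; apply/hasP; exists k.
apply/orP; right; have /tilesP[x [c [xF cC E]]] := ktV.
apply/tilesP; exists (k^-1 * x)%g, c; split=> //; last by rewrite -mulgA -E mulKg.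
apply/bigfcupP; exists k; rewrite ?andbT//; rewrite inE; apply/andP; split.
  apply: contraNN tV => kx; apply/tilesP; exists (k^-1 * x)%g, c; split=> //.
  by rewrite -mulgA -E mulKg.
by apply/imfsetP; exists x.
Qed.

Lemma card_outer_bd K F : (#|` outer_bd K F| <=
  \sum_(k <- enum_fset K) #|` symdiff (left_translate k^-1%g F) F|)%N.
Proof.
rewrite /outer_bd; elim: (enum_fset K) => [|k s IH].
  by rewrite !big_nil cardfs0.
rewrite !big_cons; apply: leq_trans (_ : (_ + _) <= _)%N.
  by rewrite cardfsU; exact: leq_subr.
rewrite leq_add//; apply: fsubset_leq_card; exact: fsubsetUl.
Qed.

Lemma card_inner_bd K T : (#|` inner_bd K T| <=
  \sum_(k <- enum_fset K) #|` symdiff (left_translate k T) T|)%N.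
Proof.
rewrite /inner_bd; elim: (enum_fset K) => [|k s IH].
  rewrite big_nil leqn0 cardfs_eq0; apply/eqP/fsetP => t.
  by rewrite !inE andbF.
rewrite big_cons; set A := [fset t in T | has _ s] in IH.
pose B := [fset t in T | (k * t)%g \notin T].
apply: leq_trans (_ : #|` B `|` A| <= _)%N.
  apply: fsubset_leq_card; apply/fsubsetP => t; rewrite !inE /=.
  by case/andP => -> /orP[->//|->]; rewrite orbT.
apply: leq_trans (_ : (#|` B| + #|` A|) <= _)%N.
  by rewrite cardfsU; exact: leq_subr.
rewrite leq_add//.
have -> : #|` B| = #|` [fset (k * t)%g | t in B]|.
  by rewrite [RHS]card_imfset //= => a b /mulgI.
apply: fsubset_leq_card; apply/fsubsetP => _ /imfsetP[t /= + ->].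
rewrite !inE => /andP[tT kt]; rewrite kt /=; apply/orP; left.
by apply/imfsetP; exists t.
Qed.

End Tiling.

Section OrnsteinWeiss.
Variables (R : realType) (G : groupType) (F : nat -> {fset G}) (L : nat).
Hypothesis folF : folner R F.
Hypothesis appF : forall n, approximate_group (F n) L.

Let F1 n : 1%g \in F n. Proof. by have [_ h _ _] := folF. Qed.

Let Fgt0 n : 0 < #|` F n|%:R :> R.
Proof. by rewrite ltr0n cardfs_gt0; apply/fset0Pn; exists 1%g. Qed.

Let L0 : (0 < L)%N. Proof. by have [] := appF 0%N. Qed.

Lemma folner_sum_translates (s : seq G) (a : G -> G) (dl : R) : 0 < dl ->
  \forall n \near \oo,
    (\sum_(k <- s) #|` symdiff (left_translate (a k) (F n)) (F n)|)%:R
      <= dl * #|` F n|%:R.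
Proof.
elim: s dl => [|k s IH] dl dl0.
  by near=> n; rewrite big_nil mulr_ge0// ltW.
have dl2 : 0 < dl / 2 by rewrite divr_gt0.
have [_ _ _ /(_ (a k)) /cvgrPdist_le /(_ _ dl2) hk] := folF.
have {}IH := IH _ dl2; near=> n; rewrite big_cons natrD [dl]splitr mulrDl.
apply: lerD; last by near: n.
have : `|0 - #|` symdiff (left_translate (a k) (F n)) (F n)|%:R / #|` F n|%:R|
    <= dl / 2 by near: n.
by rewrite sub0r normrN ger0_norm ?divr_ge0// ler_pdivrMr.
Unshelve. all: by end_near. Qed.

Lemma folner_boundary (K : {fset G}) (dl : R) : 0 < dl ->
  \forall n \near \oo, #|` inner_bd K (F n)|%:R <= dl * #|` F n|%:R /\
                       #|` outer_bd K (F n)|%:R <= dl * #|` F n|%:R.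
Proof.
move=> dl0; near=> n; split.
  apply: (@le_trans _ _ (\sum_(k <- enum_fset K)
      #|` symdiff (left_translate k (F n)) (F n)|)%:R).
    by rewrite ler_nat; exact: card_inner_bd.
  by near: n; exact: (@folner_sum_translates _ id).
apply: (@le_trans _ _ (\sum_(k <- enum_fset K)
    #|` symdiff (left_translate k^-1%g (F n)) (F n)|)%:R).
  by rewrite ler_nat; exact: card_outer_bd.
by near: n; exact: (@folner_sum_translates _ (fun k => k^-1%g)).
Unshelve. all: by end_near. Qed.

Variable h : {fset G} -> nat.
Hypothesis h0 : h fset0 = 0%N.
Hypothesis hU : forall A B, (h (A `|` B)%fset <= h A + h B)%N.
Hypothesis hT : forall A c, h (rtrans A c) = h A.

Lemma subadditive_tiles A C : (h (tiles A C) <= #|` C| * h A)%N.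
Proof.
elim/fset1U_rect: C => [|c C cC IH].
  rewrite cardfs0 mul0n (_ : tiles A fset0 = fset0) ?h0//.
  by apply/fsetP => t; apply/tilesP; rewrite inE => -[x [c []]].
rewrite (_ : tiles A (c |` C)%fset = (rtrans A c `|` tiles A C)%fset).
  apply: leq_trans (hU _ _) _; rewrite hT cardfsU1 cC mulnDl mul1n.
  by rewrite leq_add2l.
apply/fsetP => t; rewrite inE; apply/tilesP/orP.
  move=> [x [b [xA]]]; rewrite !inE => /orP[/eqP -> ->|bC ->].
    by left; apply/rtransP; exists x.
  by right; apply/tilesP; exists x, b.
move=> [/rtransP[x xA ->]|/tilesP[x [b [xA bC ->]]]].
  by exists x, c; rewrite !inE eqxx.
by exists x, b; rewrite !inE bC orbT.
Qed.

Lemma subadditive_card A : (h A <= #|` A| * h [fset 1%g]%fset)%N.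
Proof.
rewrite (_ : A = tiles [fset 1%g]%fset A); last first.
  apply/fsetP => t; apply/idP/tilesP => [tA|[x [c []]]].
    by exists 1%g, t; rewrite !inE mul1g.
  by rewrite inE => /eqP -> cA ->; rewrite mul1g.
apply: leq_trans (subadditive_tiles _ _) _; rewrite leq_mul//.
apply: fsubset_leq_card; apply/fsubsetP => c cA.
by apply/tilesP; exists 1%g, c; rewrite !inE mul1g.
Qed.

Let bounds_rate (s : R) := exists K (dl : R), 0 < dl /\ forall T : {fset G},
  #|` inner_bd K T|%:R <= dl * #|` T|%:R -> (h T)%:R <= s * #|` T|%:R.

Lemma card_inner_bd_mono (K K' T : {fset G}) : (K `<=` K')%fset ->
  (#|` inner_bd K T| <= #|` inner_bd K' T|)%N.
Proof.
move=> KK; apply: fsubset_leq_card; apply/fsubsetP => t; rewrite !inE.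
move=> /andP[-> /hasP[k kK kt]] /=; apply/hasP; exists k => //.
exact: (fsubsetP KK).
Qed.

(** If [s] bounds the rate of all sufficiently invariant sets and some very
    invariant [F n] has the smaller rate [q], then disjoint translates of this
    [F n] cover the fraction [1 / L] of every more invariant set, and the
    remainder is still invariant enough for the rate [s]. *)
Lemma bounds_rate_improve (s q : R) : q < s -> bounds_rate s ->
  (forall N, exists n, (N <= n)%N /\ (h (F n))%:R <= q * #|` F n|%:R) ->
  bounds_rate (s - (s - q) / (2 * L%:R)).
Proof.
move=> qs [K [dl [dl0 sP]]] freq.
have LR : 0 < L%:R :> R by rewrite ltr0n.
pose M : R := (h [fset 1%g]%fset)%:R + 1.
have M0 : 0 < M by rewrite ltr_wpDl.
pose c := (s - q) / (4 * L%:R).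
have c0 : 0 < c by rewrite divr_gt0 ?mulr_gt0 ?subr_gt0.
have sqc : s - q = 4 * L%:R * c.
  by rewrite /c mulrC divfK// mulf_neq0// lt0r_neq0.
pose eta := c / M.
have eta0 : 0 < eta by rewrite divr_gt0.
pose d1 := eta * dl / 2.
have d10 : 0 < d1 by rewrite divr_gt0// mulr_gt0.
have [N _ NP] := folner_boundary K d10.
have [n [/NP[_ outF] hF]] := freq N.
have q0 : 0 <= q.
  by rewrite -(pmulr_lge0 _ (Fgt0 n)); apply: le_trans hF.
have s0 : 0 <= s by rewrite (le_trans q0)// ltW.
exists (F n `|` K)%fset, (Num.min (1 / 4) d1); split.
  by rewrite lt_min d10 andbT divr_gt0.
move=> T TP; pose t : R := #|` T|%:R.
have t0 : 0 <= t by [].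
have TF : #|` inner_bd (F n) T|%:R <= 1 / 4 * t.
  apply: (@le_trans _ _ #|` inner_bd (F n `|` K)%fset T|%:R).
    by rewrite ler_nat card_inner_bd_mono// fsubsetUl.
  by apply: le_trans TP _; rewrite ler_wpM2r// ge_min lexx.
have TK : #|` inner_bd K T|%:R <= d1 * t.
  apply: (@le_trans _ _ #|` inner_bd (F n `|` K)%fset T|%:R).
    by rewrite ler_nat card_inner_bd_mono// fsubsetUr.
  by apply: le_trans TP _; rewrite ler_wpM2r// ge_min lexx orbT.
have [C [CT cardV covT]] := disjoint_tiles T (F1 n) (appF n).
pose V := tiles (F n) C; pose v : R := #|` V|%:R.
pose W := (T `\` V)%fset; pose r : R := #|` W|%:R.
have tvr : t = v + r.
  rewrite /t /v /r -natrD; congr (_%:R).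
  by rewrite -(cardfsID V T) (fsetIidPr CT).
have r0 : 0 <= r by [].
have v0 : 0 <= v by [].
have vE : v = #|` F n|%:R * #|` C|%:R by rewrite /v cardV natrM.
have vt : 3 * t <= 4 * L%:R * v.
  have : #|` T `\` inner_bd (F n) T|%fset%:R <= L%:R * v.
    by rewrite vE -!natrM ler_nat.
  have -> : #|` T `\` inner_bd (F n) T|%fset%:R = t - #|` inner_bd (F n) T|%:R :> R.
    rewrite cardfsD (fsetIidPr _); last first.
      by apply/fsubsetP => x; rewrite !inE => /andP[].
    rewrite natrB// fsubset_leq_card//.
    by apply/fsubsetP => x; rewrite !inE => /andP[].
  by move: TF; lra.
have hTVW : (h T)%:R <= (h V)%:R + (h W)%:R :> R.
  rewrite -natrD ler_nat; apply: leq_trans (hU _ _).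
  by rewrite fsetUDl fsetDv fsetD0 (fsetUidPr _ _ CT).
have hV : (h V)%:R <= q * v.
  apply: (@le_trans _ _ (#|` C|%:R * (h (F n))%:R)).
    by rewrite -natrM ler_nat; exact: subadditive_tiles.
  rewrite vE mulrCA mulrA [X in _ <= X]mulrC.
  by rewrite ler_wpM2l// mulrC.
have gain : c * (3 * t) <= (s - q) * v.
  rewrite sqc; apply: le_trans (_ : c * (4 * L%:R * v) <= _).
    by rewrite ler_wpM2l// ltW.
  by rewrite le_eqVlt; apply/orP; left; apply/eqP; ring.
have goalE : (s - (s - q) / (2 * L%:R)) * t = s * t - 2 * c * t.
  by rewrite sqc; field; exact: lt0r_neq0.
rewrite goalE; apply: le_trans hTVW _.
have [rbig|rsmall] := leP (eta * t) r.
  have hW : (h W)%:R <= s * r.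
    apply: sP; apply: (@le_trans _ _ (#|` inner_bd K T|%:R +
        #|` outer_bd K (F n)|%:R * #|` C|%:R)).
      by rewrite -natrM -natrD ler_nat; exact: inner_bd_remainder.
    apply: (@le_trans _ _ (d1 * t + d1 * v)).
      by rewrite lerD// vE mulrA ler_wpM2r.
    apply: (@le_trans _ _ (dl * (eta * t))); last by rewrite ler_pM2l.
    have -> : dl * (eta * t) = d1 * t + d1 * t by rewrite /d1; field.
    by rewrite lerD2l ler_pM2l// tvr lerDl.
  move: gain hV hW; rewrite tvr; have := mulr_ge0 (ltW c0) v0.
  by have := mulr_ge0 (ltW c0) r0; lra.
have hW : (h W)%:R <= c * t.
  apply: (@le_trans _ _ (r * M)).
    apply: (@le_trans _ _ (r * (h [fset 1%g]%fset)%:R)).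
      by rewrite -natrM ler_nat; exact: subadditive_card.
    by rewrite ler_wpM2l// lerDl.
  rewrite -ler_pdivlMr//; apply: ltW; apply: lt_le_trans rsmall _.
  by rewrite /eta mulrAC.
have := mulr_ge0 s0 r0.
by move: gain hV hW; rewrite tvr; lra.
Qed.

(** By the improvement step, the infimum of the upper bounds for the rates of
    invariant sets cannot exceed the lower limit along the sequence; it is not
    less than the upper limit, as the sets of the sequence become invariant. *)
Lemma subadditive_rate_cvg : cvgn (fun n => (h (F n))%:R / #|` F n|%:R : R).
Proof.
pose a n : R := (h (F n))%:R / #|` F n|%:R.
have LR : 0 < L%:R :> R by rewrite ltr0n.
have M_rate : bounds_rate (h [fset 1%g]%fset)%:R.
  exists fset0, 1; split=> // T _; rewrite -natrM ler_nat mulnC.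
  exact: subadditive_card.
have rate_ge0 s : bounds_rate s -> 0 <= s.
  move=> [K [dl [dl0 sP]]]; have [N _ NP] := folner_boundary K dl0.
  have [inF _] := NP N (leqnn _).
  by rewrite -(pmulr_lge0 _ (Fgt0 N)); apply: le_trans (sP _ inF).
pose l := inf bounds_rate.
have has_l : has_inf bounds_rate.
  by split; [exists (h [fset 1%g]%fset)%:R|exists 0 => s /rate_ge0].
apply/cvg_ex; exists l; apply/cvgrPdist_le => e e0.
have upper : \forall n \near \oo, a n <= l + e.
  have [s sP sl] := inf_adherent e0 has_l.
  have [K [dl [dl0 sT]]] := sP; near=> n.
  have [inF _] : #|` inner_bd K (F n)|%:R <= dl * #|` F n|%:R /\
                 #|` outer_bd K (F n)|%:R <= dl * #|` F n|%:R.
    by near: n; exact: folner_boundary.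
  apply: le_trans (ltW sl); rewrite /a ler_pdivrMr//; exact: sT.
have lower : \forall n \near \oo, l - e <= a n.
  apply: contrapT => nlow; pose q := l - e.
  have freq N : exists n, (N <= n)%N /\ (h (F n))%:R <= q * #|` F n|%:R.
    apply: contrapT => nfreq; apply: nlow; exists N => // n /= Nn.
    rewrite leNgt; apply/negP => an; apply: nfreq; exists n; split=> //.
    by rewrite -ler_pdivrMr// ltW.
  pose c := e / (2 * L%:R).
  have c0 : 0 < c by rewrite divr_gt0// mulr_gt0.
  have [s sP sl] := inf_adherent c0 has_l.
  have ls : l <= s by apply: ge_inf => //; have [] := has_l.
  have qs : q < s by rewrite /q; lra.
  have := ge_inf has_l.2 (bounds_rate_improve qs sP freq).
  rewrite -/l => h1.
  have : c <= (s - q) / (2 * L%:R).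
    by rewrite /c ler_pM2r ?invr_gt0 ?mulr_gt0// /q; lra.
  by move: sl h1; lra.
near=> n; have h1 : a n <= l + e by near: n.
have h2 : l - e <= a n by near: n.
by rewrite -/(a n) ler_norml; lra.
Unshelve. all: by end_near. Qed.

End OrnsteinWeiss.

(** * Embedding into the cubical shift *)

Section TopologicalEmbedding.

Lemma hausdorff_of_separating (R : realType) (Z : topologicalType) :
  (forall p q : Z, p <> q ->
     exists2 phi : Z -> R, continuous phi & phi p != phi q) ->
  hausdorff_space Z.
Proof.
move=> sep p q pq; apply: contrapT => /sep[phi phic /eqP]; apply.
apply: Rhausdorff => A B nA nB.
have [z [Az Bz]] := pq _ _ (phic p _ nA) (phic q _ nB).
by exists (phi z).
Qed.

Lemma compact_injective_embedding (X Z : topologicalType) (f : X -> Z) :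
  compact [set: X] -> hausdorff_space Z -> injective f -> continuous f ->
  topological_embedding f.
Proof.
move=> cX hZ fI fc; split=> // U oU.
have cU : compact (f @` ~` U).
  apply: continuous_compact; first exact: continuous_subspaceT.
  exact: (subclosed_compact (open_closedC oU) cX).
exists (~` (f @` ~` U)); first exact: closed_openC (compact_closed hZ cU).
apply/seteqP; split=> [_ [x Ux <-]|z [nU [x _ fx]]].
  by split; [move=> [y nUy /fI yx]; apply: nUy; rewrite yx|exists x].
exists x => //; apply: contrapT => nUx; apply: nU; exists x => //.
Qed.

Lemma continuous_into_ptws (X : topologicalType) (I : Type) (K : topologicalType)
    (f : X -> {ptws I -> K}) :
  (forall i, continuous (fun x => f x i)) -> continuous f.
Proof.
move=> fc x; apply/cvg_sup => i U [V [[W oW <-] Wfx] WU].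
apply: (filterS WU); apply: (fc i x); exact: open_nbhs_nbhs.
Qed.

End TopologicalEmbedding.

Section CubicalCoordinates.
Variables (R : realType) (G : groupType) (Q : nat).

Definition cube_coord (h : G) (q : 'I_Q) (x : cubical_space R G Q) : R :=
  set_val (x h q).

Lemma cube_coord_continuous h q : continuous (cube_coord h q).
Proof.
have c1 : continuous (fun x : cubical_space R G Q => x h).
  exact: (@proj_continuous G (fun _ => cube R Q) h).
have c2 : continuous (fun x : cube R Q => x q).
  exact: (@proj_continuous 'I_Q (fun _ => unit_interval R) q).
have c3 : continuous (fun x : unit_interval R => set_val x).
  exact: initial_continuous.
move=> x; apply: (@continuous_comp _ _ _ (fun x : cubical_space R G Q => x h)
  (fun x : cube R Q => set_val (x q))); first exact: c1.
apply: (@continuous_comp _ _ _ (fun x : cube R Q => x q)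
  (fun x : unit_interval R => set_val x)); first exact: c2.
exact: c3.
Qed.

Lemma cube_coord_inj (x y : cubical_space R G Q) :
  (forall h q, cube_coord h q x = cube_coord h q y) -> x = y.
Proof.
move=> xy; apply/funext => h; apply/funext => q; apply: val_inj; exact: xy.
Qed.

Lemma cubical_space_hausdorff : hausdorff_space (cubical_space R G Q).
Proof.
apply: (@hausdorff_of_separating R) => x y xy.
have [h [q hq]] : exists h q, cube_coord h q x <> cube_coord h q y.
  apply: contrapT => n; apply: xy; apply: cube_coord_inj => h q.
  by apply: contrapT => hq; apply: n; exists h, q.
exists (cube_coord h q); [exact: cube_coord_continuous|exact/eqP].
Qed.

Definition logistic (r : R) : R := (1 + expR r)^-1.

Lemma logistic_itv r : `[0%R, 1%R : R]%classic (logistic r).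
Proof.
have h : 0 < 1 + expR r by rewrite addr_gt0 ?expR_gt0.
rewrite /logistic /= in_itv /= invr_ge0 (ltW h) /= invf_le1//.
by rewrite lerDl expR_ge0.
Qed.

Lemma logistic_inj : injective logistic.
Proof. by move=> r s /invr_inj/addrI/expR_inj. Qed.

Lemma logistic_continuous : continuous logistic.
Proof.
move=> r; apply: (@continuousV _ _ (fun r => 1 + expR r)).
  by rewrite lt0r_neq0// addr_gt0 ?expR_gt0.
by apply: continuousD; [exact: cst_continuous|exact: continuous_expR].
Qed.

Definition to_unit (r : R) : unit_interval R :=
  exist _ (logistic r) (mem_set (logistic_itv r)).

Lemma to_unit_continuous : continuous to_unit.
Proof.
move=> r U [V [[W oW <-] Wr] WU]; apply: (filterS WU).
by apply: logistic_continuous; exact: open_nbhs_nbhs.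
Qed.

(** The functions are rescaled to values in [0, 1], and missing coordinates are
    filled with constants; the resulting equivariant map is an embedding because
    it is injective and continuous on a compact space. *)
Lemma embeds_of_separating (X : metricType R) (act : G -> X -> X) (T : finType)
    (f : T -> X -> R) :
  is_system act -> fam_continuous f -> (#|T| <= Q)%N ->
  (forall x y, (forall t g, f t (act g x) = f t (act g y)) -> x = y) ->
  embeds_in_cubical_shift R act Q.
Proof.
move=> sysX fc TQ sep; have [cX a1 aM ac] := sysX.
pose fQ (q : 'I_Q) x : R :=
  if insub (val q) is Some k then f (enum_val (k : 'I_#|T|)) x else 0.
have fQc q : continuous (fQ q).
  rewrite /fQ; case: insub => [k|] x; first exact: fc.
  exact: cst_continuous.
pose e x : cubical_space R G Q := fun h q => to_unit (fQ q (act h x)).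
exists e; split; last by move=> g x; apply/funext => h; apply/funext => q;
  rewrite /e /cubical_shift aM.
apply: compact_injective_embedding => //; first exact: cubical_space_hausdorff.
  move=> x y exy; apply: sep => t g.
  have := congr1 (fun z : cubical_space R G Q =>
    cube_coord g (widen_ord TQ (enum_rank t)) z) exy.
  rewrite /cube_coord /= => /logistic_inj; rewrite /fQ /=.
  by rewrite valK enum_rankK.
apply: continuous_into_ptws => h; apply: continuous_into_ptws => q x.
apply: (@continuous_comp _ _ _ (fun x => fQ q (act h x)) to_unit).
  by apply: continuous_comp; [exact: ac|exact: fQc].
exact: to_unit_continuous.
Qed.

End CubicalCoordinates.

(** * Mean dimension *)

Section DynamicalCovers.
Variables (R : realType) (G : groupType) (X : metricType R) (act : G -> X -> X).
Variable U : set (set X).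
Hypotheses (sysX : is_system act) (Ufoc : finite_open_cover U).

Local Notation dcov A := (dynamical_cover act U A).

Lemma dynamical_cover_foc (A : {fset G}) : finite_open_cover (dcov A).
Proof.
have [_ _ _ ac] := sysX; have [finU oU covU] := Ufoc; split.
- pose b (phi : {ffun A -> fset_set U}) : set X :=
    \bigcap_(g in [set: A]) (act (val g) @^-1` val (phi g)).
  apply: (@sub_finite_set _ _ (b @` setT)); last first.
    by apply: finite_image; exact: finite_finset.
  move=> _ [f fU <-].
  have fP (g : A) : f (val g) \in fset_set U.
    by rewrite in_fset_set// inE; apply: fU; exact: valP.
  exists [ffun g => FSetSub (fP g)] => //; apply/seteqP; split=> x h.
    by move=> g gA; have := h (FSetSub gA) Logic.I; rewrite /= ffunE.
  by move=> g _; rewrite /= ffunE; apply: h; exact: valP.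
- move=> _ [f fU <-]; apply: open_bigcap_finite; first exact: finite_fset.
  move=> g gA; apply: open_comp; first by move=> *; exact: ac.
  by apply: oU; exact: fU.
rewrite -subTset => x _.
have /choice[f fP] : forall g, exists B, U B /\ B (act g x).
  move=> g; have : [set: X] (act g x) by [].
  by rewrite -covU => -[B UB Bx]; exists B.
exists (\bigcap_(g in [set` A]) (act g @^-1` f g)).
  by exists f => // g _; have [] := fP g.
by move=> g _; have [] := fP g.
Qed.

Lemma has_pou_dcov_sub (A B : {fset G}) k : (A `<=` B)%fset ->
  has_pou R (dcov B) k -> has_pou R (dcov A) k.
Proof.
move=> /fsubsetP AB; apply: has_pou_refine => // _ [f fU <-].
exists (\bigcap_(g in [set` A]) (act g @^-1` f g)).
  by exists f => // g /AB/fU.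
by move=> x h g /AB; exact: h.
Qed.

Lemma has_pou_dcov_union (A B : {fset G}) p q :
  has_pou R (dcov A) p -> has_pou R (dcov B) q ->
  has_pou R (dcov (A `|` B)%fset) (p + q).
Proof.
move=> hA hB; apply: has_pou_refine (leqnn _) _ (has_pou_join hA hB).
move=> _ [_ [f fU <-] [_ [f' f'U <-] <-]].
pose f'' g := if g \in A then f g else f' g.
exists (\bigcap_(g in [set` (A `|` B)%fset]) (act g @^-1` f'' g)).
  exists f'' => // g; rewrite /f'' inE; case: ifP => [gA _|_ /=]; first exact: fU.
  exact: f'U.
move=> x [hA' hB'] g /=; rewrite /f'' inE; case: ifP => [gA _|_ /=].
  exact: hA'.
exact: hB'.
Qed.

(** The cover along [A c] is the pull-back by [c] of the cover along [A]. *)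
Lemma has_pou_dcov_rtrans (A : {fset G}) c k :
  has_pou R (dcov A) k -> has_pou R (dcov (rtrans A c)) k.
Proof.
have [_ _ aM ac] := sysX.
move=> /(has_pou_preimage (ac c)); apply: has_pou_refine => //.
move=> _ [_ [f fU <-] <-].
exists (\bigcap_(g in [set` rtrans A c]) (act g @^-1` f (g * c^-1)%g)).
  exists (fun g => f (g * c^-1)%g) => // g /rtransP[a aA ->].
  by rewrite mulgK; exact: fU.
move=> x h g /rtransP[a aA ->] /=; rewrite mulgK aM; exact: h.
Qed.

(** Here [h A] is [1 + D(U_A)] for nonempty [A]. The shift by [1] turns it into
    the least multiplicity of a partition of unity; it is subadditive and has the
    same rate as [D(U_A)] along sets of growing cardinality. *)
Lemma exists_cover_rate (x0 : X) : exists h : {fset G} -> nat,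
  [/\ h fset0 = 0%N,
      forall A B, (h (A `|` B)%fset <= h A + h B)%N,
      forall A c, h (rtrans A c) = h A,
      forall A, (0 < #|` A|)%N -> has_pou R (dcov A) (h A) &
      forall A, (0 < #|` A|)%N -> cover_dim R (dcov A) = (h A)%:R - 1].
Proof.
have exk A : exists k, `[< has_pou R (dcov A) k >].
  have foc := dynamical_cover_foc A.
  have [|k hk _] := @has_pou_of_cover_dim R X x0 (dcov A)
    (cover_dim R (dcov A) + 1) foc; first by rewrite ltrDl.
  by exists k; apply/asboolP.
pose N A := ex_minn (exk A).
have NP A : has_pou R (dcov A) (N A).
  by rewrite /N; case: ex_minnP => k /asboolP.
have Nmin A k : has_pou R (dcov A) k -> (N A <= k)%N.
  by rewrite /N; case: ex_minnP => n _ nmin hk; apply: nmin; apply/asboolP.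
pose h A := if A == fset0 then 0%N else N A.
have hE A : (0 < #|` A|)%N -> h A = N A.
  by rewrite cardfs_gt0 /h => /negbTE ->.
have rtrans0 A c : (rtrans A c == fset0) = (A == fset0).
  by rewrite -!cardfs_eq0 card_rtrans.
exists h; split=> [|A B|A c|A A0|A A0].
- by rewrite /h eqxx.
- have [->|A0] := eqVneq A fset0; first by rewrite fset0U leq_addl.
  have [->|B0] := eqVneq B fset0; first by rewrite fsetU0 leq_addr.
  rewrite !hE ?cardfs_gt0//; last by rewrite fsetU_eq0 negb_and A0.
  by apply: Nmin; exact: has_pou_dcov_union.
- rewrite /h rtrans0; case: eqP => // _; apply/eqP; rewrite eqn_leq.
  apply/andP; split; apply: Nmin; first exact: has_pou_dcov_rtrans.
  have {1}-> : A = rtrans (rtrans A c) c^-1%g.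
    apply/fsetP => g; apply/idP/rtransP => [gA|[_ /rtransP[a aA ->] ->]].
      exists (g * c)%g; last by rewrite mulgK.
      by apply/rtransP; exists g.
    by rewrite mulgK.
  exact: has_pou_dcov_rtrans.
- by rewrite hE.
rewrite hE//; apply/eqP; rewrite eq_le; apply/andP; split.
  exact: cover_dim_le_pou.
rewrite leNgt; apply/negP => /(has_pou_of_cover_dim x0 (dynamical_cover_foc A)).
by move=> [k /Nmin]; rewrite -(ler_nat R) => h1; rewrite ltrD2r ltNge h1.
Qed.

End DynamicalCovers.

Lemma seq_fsubset_mono (T : choiceType) (F : nat -> {fset T}) :
  (forall n, (F n `<=` F n.+1)%fset) ->
  forall m n, (m <= n)%N -> (F m `<=` F n)%fset.
Proof.
move=> Finc m n; apply: (@homo_leq _ F (fun A B => A `<=` B)%fset) => [//|? ? ?|//].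
exact: fsubset_trans.
Qed.

Section GroupFacts.
Variables (R : realType) (G : groupType) (F : nat -> {fset G}).

Lemma approximate_groupW (A : {fset G}) L L' : (L <= L')%N ->
  approximate_group A L -> approximate_group A L'.
Proof.
move=> LL [L0 A1 [g cov]]; split=> //; first exact: leq_trans LL.
exists (fun i => if insub (val i) : option 'I_L is Some j then g j else 1%g).
move=> _ /cov[i _ [z zA <-]]; exists (widen_ord LL i) => //=.
by exists z => //; rewrite valK.
Qed.

Lemma WAFC_approximate_group L n : WAFC R F L -> approximate_group (F n) L.
Proof. by move=> [_ /(_ n)[k [[kF _] kL]]]; exact: approximate_groupW kF. Qed.

(** Inversion turns a cover of [A^-1 A] by left translates of a symmetric set
    [A] into a cover by right translates, and it is right translation that
    preserves the multiplicities of dynamical covers. *)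
Lemma quotients_sub_tiles (A : {fset G}) L : approximate_group A L ->
  A = [fset x^-1 | x in A]%fset%g ->
  exists C : {fset G}, (#|` C| <= L)%N /\ (quotients A `<=` tiles A C)%fset.
Proof.
move=> [_ _ [g cov]] symA.
exists [fset (g i)^-1%g | i in 'I_L]%fset; split.
  by rewrite (leq_trans (leq_imfset_card _ _ _))//= -cardE card_ord.
apply/fsubsetP => _ /quotientsP[x [y [xA yA ->]]].
have [i _ [z zA E]] : (\bigcup_(i in [set: 'I_L]) [set (g i * z)%g | z in [set` A]])
    (y^-1 * x)%g by apply: cov; exists y => //; exists x.
apply/tilesP; exists z^-1%g, (g i)^-1%g; split.
- by rewrite symA; apply/imfsetP; exists z.
- by apply/imfsetP; exists i.
- by rewrite -invgM E invgM invgK.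
Qed.

Lemma folner_card_cvg : folner R F -> infinite_set [set: G] ->
  (fun n => (#|` F n|%:R : R)^-1) @ \oo --> (0 : R).
Proof.
move=> [Finc _ Fcov _] infG.
have Fmono := seq_fsubset_mono Finc.
have big M : exists N, (M <= #|` F N|)%N.
  have [A _ cA] := infinite_set_fset M infG.
  have : exists N, (A `<=` F N)%fset.
    elim/fset1U_rect: A {cA} => [|a A _ [N AN]].
      by exists 0%N; exact: fsub0set.
    have [n _ an] : (\bigcup_n [set` F n])%classic a by rewrite Fcov.
    exists (maxn n N); apply/fsubsetP => x; rewrite !inE => /orP[/eqP ->|xA].
      by apply: (fsubsetP (Fmono _ _ (leq_maxl _ _))).
    by apply: (fsubsetP (Fmono _ _ (leq_maxr _ _))); exact: (fsubsetP AN).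
  by move=> [N AN]; exists N; rewrite (leq_trans cA)// fsubset_leq_card.
apply/cvgrPdist_le => e e0; have [N NP] := big (Num.bound e^-1).
exists N => // n /= Nn; rewrite sub0r normrN ger0_norm ?invr_ge0//.
rewrite -[leRHS]invrK lef_pV2 ?posrE ?invr_gt0//; last first.
  rewrite ltr0n (leq_trans _ (fsubset_leq_card (Fmono _ _ Nn)))//.
  by rewrite (leq_trans _ NP)// -(ltr0n R) (lt_le_trans _ (ltW (archi_boundP _)))
    ?invr_gt0 ?invr_ge0 ?ltW.
apply: (le_trans (ltW (archi_boundP _))); first by rewrite invr_ge0 ltW.
by rewrite ler_nat (leq_trans NP)// fsubset_leq_card// Fmono.
Qed.

End GroupFacts.

Section EmbeddingTheorem.
Variables (R : realType) (G : groupType) (F : nat -> {fset G}) (L : nat).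
Hypothesis infG : infinite_set [set: G].
Hypothesis symF : symmetric_seq F.
Hypothesis wafc : WAFC R F L.

(** Along some [F N] the multiplicity is at most [m #|F N| / 2]. The quotients of
    [F N] lie in [L] right translates of [F N], and multiplicities add up. *)
Lemma narrow_of_mdim (X : metricType R) (act : G -> X -> X) (x0 : X) (m : nat) :
  is_system act -> (mdim R act F < (m%:R / 2)%R%:E)%E ->
  forall U : set (set X), finite_open_cover U ->
  exists A : {fset G}, 1%g \in A /\ exists k,
    has_pou R (dynamical_cover act U (quotients A)) k /\
    (k + k <= (L * m) * #|` A|)%N.
Proof.
move=> sysX small U Ufoc; have [folF _] := wafc.
have appF n := WAFC_approximate_group n wafc.
have F1 n : 1%g \in F n by have [_ h _ _] := folF.
have F0 n : (0 < #|` F n|)%N by rewrite cardfs_gt0; apply/fset0Pn; exists 1%g.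
have [h [h0 hU hT hpou hdim]] := exists_cover_rate sysX Ufoc x0.
have /cvg_ex[l al] := subadditive_rate_cvg folF appF h0 hU hT.
have dl : cover_dim R (dynamical_cover act U (F n)) / #|` F n|%:R
    @[n --> \oo] --> (l : R).
  under eq_fun do rewrite hdim// mulrBl mul1r.
  rewrite -[l]subr0; apply: cvgB => //; exact: folner_card_cvg.
have lm : l < m%:R / 2.
  rewrite -lte_fin; apply: le_lt_trans small; apply: ereal_sup_ubound.
  by exists U => //; congr (_%:E); apply: cvg_lim.
have [N _ NP] := cvgr_lt _ al _ lm.
have hN : (h (F N) + h (F N) <= m * #|` F N|)%N.
  have /= := NP N (leqnn _); rewrite ltr_pdivrMr ?ltr0n// => hlt.
  rewrite -(ler_nat R) natrD natrM; lra.
exists (F N); split=> //; exists (L * h (F N))%N; split; last first.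
  by rewrite -mulnDr -mulnA leq_mul2l hN orbT.
have [C [CL sub]] := quotients_sub_tiles (appF N) (symF N).
have L0 : (0 < L)%N by have [] := appF N.
apply: has_pou_dcov_sub sub _; have [->|C0] := eqVneq C fset0.
  have -> : tiles (F N) fset0 = fset0.
    by apply/fsetP => t; rewrite inE; apply/tilesP => -[x [c []]].
  apply: (has_pou_refine _ _ (has_pou_dcov_sub (fsub0set (F N)) (hpou _ (F0 N)))).
    by rewrite leq_pmull.
  by move=> A HA; exists A.
have T0 : (0 < #|` tiles (F N) C|)%N.
  have [c cC] := fset0Pn _ C0.
  rewrite cardfs_gt0; apply/fset0Pn; exists (1 * c)%g.
  by apply/tilesP; exists 1%g, c.
apply: (has_pou_refine _ _ (hpou _ T0)); last by move=> A HA; exists A.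
apply: leq_trans (subadditive_tiles h0 hU hT _ _) _.
by rewrite leq_mul2r CL orbT.
Qed.

Lemma edim_bound_of_WAFC : edim_bound R F L.
Proof.
move=> X actX Y actY m d sysX sysY [pi [pic pisurj piE]] m0 freeY dimY small Q.
suff emb : embeds_in_cubical_shift R actX Q.
  split=> //; apply: ereal_inf_lbound; exists Q => //; split=> //.
  by rewrite /Q addn1.
have [[x0 _]|X0] := pselect ([set: X] !=set0); last first.
  have noX (x : X) : False by apply: X0; exists x.
  apply: (@embeds_of_separating R G Q X actX void (fun v => match v with end)) => //.
  by rewrite card_void.
have dimY' (U : set (set Y)) : finite_open_cover U -> has_pou R U d.+1.
  move=> Ufoc; have Ud : cover_dim R U < d.+1%:R.
    apply: (@le_lt_trans _ _ d%:R); last by rewrite ltr_nat.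
    rewrite -lee_fin; apply: le_trans dimY; apply: ereal_sup_ubound.
    by exists U.
  have [k kU kd] := has_pou_of_cover_dim (pi x0) Ufoc Ud.
  apply: (has_pou_refine _ _ kU); last by move=> A HA; exists A.
  by rewrite -ltnS -(ltr_nat R) -[k%:R](subrK 1) -natr1 ltrD2r.
have [u uc uP] := exists_orbit_separating sysY freeY dimY' infG.
have [f fc fP] := exists_fibre_separating sysX sysY pic piE freeY dimY'
  (narrow_of_mdim x0 sysX small).
pose T : finType := option ('I_d.+1 * 'I_(L * m))%type.
pose phi (t : T) : X -> R := if t is Some i then f i else u \o pi.
apply: (@embeds_of_separating R G Q X actX T phi) => //.
- move=> [i|] x; first exact: fc.
  by apply: continuous_comp; [exact: pic|exact: uc].
- rewrite card_option card_prod !card_ord /Q; nia.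
move=> x y sep; apply: fP; last by move=> t g; exact: (sep (Some t)).
by apply: uP => g; rewrite -!piE; exact: (sep None).
Qed.

End EmbeddingTheorem.

(** * Groups with symmetric Folner sequences of bounded doubling *)

Section SymmetricWAFC.
Variable R : realType.

Definition sym_wafc (G : groupType) :=
  exists (F : nat -> {fset G}) (L : nat), symmetric_seq F /\ WAFC R F L.

Lemma cvg0_le (a b : nat -> R) :
  (\forall n \near \oo, 0 <= a n <= b n) ->
  b @ \oo --> (0 : R) -> a @ \oo --> (0 : R).
Proof.
move=> ab /cvgrPdist_le b0; apply/cvgrPdist_le => e e0.
apply: filterS2 ab (b0 e e0) => n /andP[a0 ab].
by rewrite !sub0r !normrN !ger0_norm// ?(le_trans a0 ab)//; exact: le_trans.
Qed.

Lemma approximate_group_const (G : groupType) (A : {fset G}) L :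
  approximate_group A L -> exists k, approximate_const A k /\ (k <= L)%N.
Proof.
move=> AL; have ex : exists k, `[< approximate_group A k >].
  by exists L; apply/asboolP.
case: (ex_minnP ex) => k /asboolP Ak kmin.
exists k; split; last by apply: kmin; apply/asboolP.
by split=> // k' Ak'; apply: kmin; apply/asboolP.
Qed.

Lemma approximate_group_of_cover (G : groupType) (A C : {fset G}) L :
  1%g \in A -> (#|` C| <= L)%N ->
  (forall x y, x \in A -> y \in A ->
     exists c z, [/\ c \in C, z \in A & (x^-1 * y = c * z)%g]) ->
  approximate_group A L.
Proof.
move=> A1 CL cov; split=> //.
  have [c [z [cC _ _]]] := cov _ _ A1 A1.
  by rewrite (leq_trans _ CL)// cardfs_gt0; apply/fset0Pn; exists c.
exists (fun i => nth 1%g (enum_fset C) i) => _ [x xA [y yA <-]].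
have [c [z [cC zA ->]]] := cov _ _ xA yA.
have iC : (index c (enum_fset C) < #|` C|)%N by rewrite index_mem.
exists (Ordinal (leq_trans iC CL)) => //=; exists z => //.
by rewrite nth_index.
Qed.

Lemma symmetric_seqP (G : groupType) (F : nat -> {fset G}) :
  (forall n x, x \in F n -> x^-1%g \in F n) -> symmetric_seq F.
Proof.
move=> h n; apply/fsetP => x; apply/idP/imfsetP => [xF|[y yF ->]]; last exact: h.
by exists x^-1%g; rewrite ?invgK//; exact: h.
Qed.

Lemma card_symdiff_translate (G : groupType) (A : {fset G}) g :
  #|` symdiff (left_translate g A) A| = (2 * #|` left_translate g A `\` A|%fset)%N.
Proof.
set B := left_translate g A.
have cAB : #|` B| = #|` A| by rewrite card_imfset//=; exact: mulgI.
have cD : #|` A `\` B|%fset = #|` B `\` A|%fset.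
  by apply/eqP; rewrite -(eqn_add2l #|` A `&` B|%fset) cardfsID fsetIC -cAB cardfsID.
rewrite /symdiff cardfsU (_ : (_ `&` _)%fset = fset0).
  by rewrite cardfs0 subn0 cD mul2n addnn.
by apply/fsetP => x; rewrite !inE; case: (x \in A); rewrite ?andbF.
Qed.

(** ** Products *)

Section Product.
Variables (G H : groupType).

Lemma card_fsetM (A : {fset G}) (B : {fset H}) :
  #|` (A `*` B)%fset| = (#|` A| * #|` B|)%N.
Proof.
apply/eqP; rewrite eqn_leq; apply/andP; split.
  apply: (card_subset_pairs (f := fun a b => (a, b))) => -[a b].
  by rewrite in_fsetM => /andP[aA bB]; exists a, b.
rewrite -(size_allpairs (fun a b => (a, b))); apply: uniq_leq_size.
  by apply: allpairs_uniq => // -[a b] [a' b'].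
by move=> _ /allpairsP[[a b] [/= aA bB ->]]; rewrite in_fsetM aA.
Qed.

Lemma sym_wafc_prod : sym_wafc G -> sym_wafc H -> sym_wafc (G * H)%type.
Proof.
move=> [F [L [symF wF]]] [F' [L' [symF' wF']]].
have appF n := WAFC_approximate_group n wF.
have appF' n := WAFC_approximate_group n wF'.
have [[Finc F1 Fcov Fl] _] := wF; have [[Finc' F1' Fcov' Fl'] _] := wF'.
have Fmono := seq_fsubset_mono Finc.
have Fmono' := seq_fsubset_mono Finc'.
exists (fun n => F n `*` F' n)%fset, (L * L')%N; split.
  apply: symmetric_seqP => n [x y]; rewrite !in_fsetM /= => /andP[xF yF'].
  rewrite (symF n) (symF' n); apply/andP; split; apply/imfsetP.
    by exists x.
  by exists y.
split; last first.
  move=> n; apply: approximate_group_const.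
  have [L0 _ [g gcov]] := appF n; have [L0' _ [g' gcov']] := appF' n.
  pose C : {fset (G * H)%type} :=
    [fset (g ij.1, g' ij.2) | ij in {: 'I_L * 'I_L'}]%fset.
  apply: (@approximate_group_of_cover (G * H)%type _ C).
  - by rewrite in_fsetM F1 F1'.
  - by rewrite (leq_trans (leq_imfset_card _ _ _))//= -cardE card_prod !card_ord.
  - move=> [x x'] [y y']; rewrite !in_fsetM /= => /andP[xF xF'] /andP[yF yF'].
    have [i _ [z zF E]] :
        (\bigcup_(i in [set: 'I_L]) [set (g i * z)%g | z in [set` F n]])
        (x^-1 * y)%g by apply: gcov; exists x => //; exists y.
    have [j _ [z' zF' E']] :
        (\bigcup_(i in [set: 'I_L'])
          [set (g' i * z)%g | z in [set` F' n]])
        (x'^-1 * y')%g by apply: gcov'; exists x' => //; exists y'.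
    exists (g i, g' j), (z, z'); split.
    + by apply/imfsetP; exists (i, j).
    + by rewrite in_fsetM zF zF'.
    + by rewrite -[LHS]/((x^-1 * y)%g, (x'^-1 * y')%g) -E -E'.
split.
- move=> n; apply/fsubsetP => -[x y]; rewrite !in_fsetM => /andP[xF yF].
  by rewrite (fsubsetP (Finc n))// (fsubsetP (Finc' n)).
- by move=> n; rewrite in_fsetM F1 F1'.
- rewrite -subTset => -[x y] _.
  have [n _ xn] : (\bigcup_n [set` F n]) x by rewrite Fcov.
  have [n' _ yn] : (\bigcup_n [set` F' n]) y by rewrite Fcov'.
  exists (maxn n n') => //=; rewrite in_fsetM /=.
  rewrite (fsubsetP (Fmono _ _ (leq_maxl _ _)))//.
  by rewrite (fsubsetP (Fmono' _ _ (leq_maxr _ _))).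
move=> [g g'].
have pos n : 0 < #|` F n|%:R :> R.
  by rewrite ltr0n cardfs_gt0; apply/fset0Pn; exists 1%g.
have pos' n : 0 < #|` F' n|%:R :> R.
  by rewrite ltr0n cardfs_gt0; apply/fset0Pn; exists 1%g.
have lim0 : (fun n =>
    #|` symdiff (left_translate g (F n)) (F n)|%:R / #|` F n|%:R +
    #|` symdiff (left_translate g' (F' n)) (F' n)|%:R / #|` F' n|%:R)
    @ \oo --> (0 : R).
  by rewrite -[0 : R]addr0; exact: cvgD (Fl g) (Fl' g').
apply: cvg0_le lim0; near=> n.
rewrite divr_ge0//=; rewrite !card_symdiff_translate card_fsetM.
set A := left_translate _ (F n); set A' := left_translate _ (F' n).
set B := left_translate _ _.
have : (#|` B `\` (F n `*` F' n)|%fset <= #|` A `\` F n|%fset * #|` F' n| +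
    #|` F n| * #|` A' `\` F' n|%fset)%N.
  have cA : #|` A| = #|` F n| by rewrite card_imfset//=; exact: mulgI.
  have cA' : #|` A'| = #|` F' n| by rewrite card_imfset//=; exact: mulgI.
  rewrite -cA -cA' -!card_fsetM.
  apply: (@leq_trans (#|` (A `\` F n) `*` A' `|` A `*` (A' `\` F' n)|)%fset).
    apply: fsubset_leq_card; apply/fsubsetP => z; rewrite inE => /andP[zF].
    case/imfsetP => -[x x'] /=; rewrite in_fsetM /= => /andP[xF xF'] zE.
    have zA : z.1 \in A by rewrite zE; apply/imfsetP; exists x.
    have zA' : z.2 \in A' by rewrite zE; apply/imfsetP; exists x'.
    move: zF; rewrite in_fsetM negb_and inE !in_fsetM !inE zA zA' /= !andbT.
    by [].
  by rewrite cardfsU leq_subr.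
move=> h; rewrite -(ler_nat R) natrD !natrM in h; rewrite !(natrM _ 2 _).
have key (a b x y z : R) : 0 < x -> 0 < y -> z <= a * y + x * b ->
    2 * z / (x * y) <= 2 * a / x + 2 * b / y.
  move=> x0 y0 zab; apply: (@le_trans _ _ (2 * (a * y + x * b) / (x * y))).
    by rewrite ler_pM2r ?ler_pM2l// invr_gt0 mulr_gt0.
  rewrite le_eqVlt; apply/orP; left; apply/eqP.
  by field; rewrite !lt0r_neq0.
by rewrite [(#|` F n| * _)%:R]natrM; exact: key.
Unshelve. all: by end_near. Qed.

End Product.

(** ** Sequences of bounded doubling *)

Definition doubling_seq (G : groupType) (A : nat -> {fset G}) (L : nat) :=
  [/\ forall k, 1%g \in A k,
      forall k x, x \in A k -> x^-1%g \in A k,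
      forall j k x y, x \in A j -> y \in A k -> (x * y)%g \in A (j + k)%N &
      forall k, exists C : {fset G}, (#|` C| <= L)%N /\
        forall x, x \in A (k + k)%N ->
          exists c z, [/\ c \in C, z \in A k & x = (c * z)%g]].

Section Doubling.
Variables (G : groupType) (A : nat -> {fset G}) (L : nat).
Hypothesis dblA : doubling_seq A L.

Lemma doubling_mono m n : (m <= n)%N -> (A m `<=` A n)%fset.
Proof.
have [A1 _ AM _] := dblA; move=> /subnKC <-; apply/fsubsetP => x xA.
by rewrite -[x]mulg1; exact: AM.
Qed.

Lemma doubling_card k : (#|` A (k + k)| <= L * #|` A k|)%N.
Proof.
have [_ _ _ dbl] := dblA; have [C [CL cov]] := dbl k.
apply: (@leq_trans (#|` C| * #|` A k|)); last by rewrite leq_mul2r CL orbT.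
exact: (card_subset_pairs (f := fun c z => (c * z)%g)).
Qed.

(** Bounded doubling forbids that the cardinality grows by the factor [1 + e]
    at every one of many consecutive steps of length [c]. *)
Lemma doubling_slow_growth (c K : nat) (e : R) : 0 < e ->
  exists2 k, (K <= k)%N & #|` A (k + c)%N|%:R <= (1 + e) * #|` A k|%:R.
Proof.
move=> e0; apply: contrapT => fast.
have grow k : (K <= k)%N -> (1 + e) * #|` A k|%:R <= #|` A (k + c)%N|%:R.
  move=> Kk; rewrite leNgt; apply/negP => h; apply: fast; exists k => //.
  exact: ltW.
have [A1 _ _ _] := dblA.
have pos k : 0 < #|` A k|%:R :> R.
  by rewrite ltr0n cardfs_gt0; apply/fset0Pn; exists 1%g.
have iter k j : (K <= k)%N ->
    (1 + j%:R * e) * #|` A k|%:R <= #|` A (k + j * c)%N|%:R.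
  move=> Kk; elim: j => [|j IH]; first by rewrite mul0r addr0 mul1r mul0n addn0.
  have -> : (k + j.+1 * c = k + j * c + c)%N by rewrite mulSn; lia.
  apply: le_trans (grow _ _); last by rewrite (leq_trans Kk)// leq_addr.
  apply: (@le_trans _ _ ((1 + e) * ((1 + j%:R * e) * #|` A k|%:R))); last first.
    by rewrite ler_pM2l// addr_gt0.
  rewrite mulrA ler_pM2r// -natr1.
  have := mulr_ge0 (mulr_ge0 (ler0n R j) (ltW e0)) (ltW e0); nra.
pose J := Num.bound (L%:R / e); pose k := (K + J * c)%N.
have := iter k J (leq_addr _ _).
have : #|` A (k + J * c)%N|%:R <= L%:R * #|` A k|%:R :> R.
  rewrite -natrM ler_nat; apply: leq_trans (doubling_card k).
  by apply: fsubset_leq_card; apply: doubling_mono; rewrite leq_add2l leq_addl.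
move=> h1 /le_trans/(_ h1); rewrite ler_pM2r// => h2.
have : L%:R / e < J%:R by rewrite archi_boundP// divr_ge0// ltW.
by rewrite ltr_pdivrMr// => h3; move: h2; lra.
Qed.

(** The subsequence [A (s n)] is chosen so that [n] further steps enlarge
    [A (s n)] by a factor at most [1 + 1 / (n + 1)]; left translation by a fixed
    element moves [A (s n)] by a bounded number of steps. *)
Lemma sym_wafc_of_doubling : \bigcup_k [set` A k] = [set: G] -> sym_wafc G.
Proof.
move=> covA; have [A1 AV AM dbl] := dblA.
have step (jk : nat * nat) : {k : nat | (jk.2 < k)%N &
    #|` A (k + jk.1)%N|%:R <= (1 + (jk.1.+1%:R)^-1) * #|` A k|%:R :> R}.
  apply: cid2; apply: doubling_slow_growth; by rewrite invr_gt0.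
pose s := fix s j := if j is j'.+1 then s2val (step (j, s j')) else 0%N.
have s_lt j : (s j < s j.+1)%N by exact: (s2valP (step (j.+1, s j))).
have s_slow j : #|` A (s j.+1 + j.+1)%N|%:R <=
    (1 + (j.+2%:R)^-1) * #|` A (s j.+1)|%:R :> R.
  exact: (s2valP' (step (j.+1, s j))).
have s_ge j : (j <= s j)%N.
  by elim: j => // j IH; exact: leq_ltn_trans IH (s_lt j).
have pos k : 0 < #|` A k|%:R :> R.
  by rewrite ltr0n cardfs_gt0; apply/fset0Pn; exists 1%g.
exists (A \o s), L; split; first by apply: symmetric_seqP => n x; exact: AV.
split; last first.
  move=> n; apply: approximate_group_const; have [C [CL cov]] := dbl (s n).
  apply: (approximate_group_of_cover (A1 _) CL) => x y xA yA.
  by apply: cov; apply: AM => //; exact: AV.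
split.
- by move=> n; apply: doubling_mono; exact: ltnW.
- by move=> n; exact: A1.
- rewrite -subTset => x _; have [k _ xk] : (\bigcup_k [set` A k]) x by rewrite covA.
  by exists k => //=; apply: (fsubsetP (doubling_mono (s_ge k))).
move=> g; have [c _ gc] : (\bigcup_k [set` A k]) g by rewrite covA.
have lim0 : (fun n => 2 * n.+1%:R^-1 : R) @ \oo --> (0 : R).
  by rewrite -[0](mulr0 2); apply: cvgMr; exact: cvg_harmonic.
apply: cvg0_le lim0; near=> n.
rewrite divr_ge0//= card_symdiff_translate ler_pdivrMr//.
have [j nj] : exists j, n = j.+1.
  by exists n.-1; rewrite prednK//; near: n; exists 1%N.
have cn : (c <= n)%N by near: n; exists c.
rewrite natrM -mulrA ler_pM2l//.
have sub : (left_translate g (A (s n)) `<=` A (s n + n)%N)%fset.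
  apply/fsubsetP => _ /imfsetP[x /= xA ->].
  have := AM _ _ _ _ gc xA; rewrite addnC.
  by apply: (fsubsetP (doubling_mono _)); rewrite leq_add2l.
apply: (@le_trans _ _ (#|` A (s n + n)%N `\` A (s n)|%fset%:R)).
  by rewrite ler_nat fsubset_leq_card// fsetSD.
rewrite cardfsD (fsetIidPr (doubling_mono (leq_addr _ _))).
rewrite natrB ?fsubset_leq_card ?doubling_mono ?leq_addr//.
rewrite lerBlDl -[X in X + _]mul1r -mulrDl.
apply: le_trans (_ : _ <= (1 + n.+1%:R^-1) * #|` A (s n)|%:R); last by [].
by rewrite nj; exact: s_slow.
Unshelve. all: by end_near. Qed.

End Doubling.

End SymmetricWAFC.

(** ** Locally finite groups *)

Section LocallyFinite.
Variables (R : realType) (G : groupType).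

Lemma generated_subgroup (S : {fset G}) : is_subgroup (generated S).
Proof.
split; first by move=> A [[A1 _] _].
move=> x y xS yS A /[dup] AS [[_ AV] _].
by apply: AV; [exact: xS|exact: yS].
Qed.

Lemma subgroupV (H : set G) x : is_subgroup H -> H x -> H x^-1%g.
Proof. by move=> [H1 HV] Hx; rewrite -[x^-1%g]mul1g; exact: HV. Qed.

Lemma subgroupM (H : set G) x y : is_subgroup H -> H x -> H y -> H (x * y)%g.
Proof.
move=> sH Hx Hy; rewrite -[y]invgK; have [_ HV] := sH.
by apply: HV => //; exact: subgroupV.
Qed.

(** A countable locally finite group is exhausted by finite subgroups; these
    satisfy [H^-1 H = H] and are invariant under their own elements. *)
Lemma sym_wafc_locally_finite :
  countable [set: G] -> locally_finite G -> sym_wafc R G.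
Proof.
move=> /countable_injP[f finj] locfin.
have finS n : finite_set (f @^-1` `I_n).
  by apply: finite_preimage => // x y _ _; apply: finj; rewrite inE.
pose S n := fset_set (f @^-1` `I_n).
have SP n x : (x \in S n) = (f x < n)%N.
  by rewrite in_fset_set//; apply/idP/idP; rewrite inE.
pose F n := fset_set (generated (S n)).
have FP n x : (x \in F n) = (x \in generated (S n)).
  by rewrite in_fset_set//; exact: locfin.
have F1 n : 1%g \in F n by rewrite FP inE; have [] := generated_subgroup (S n).
have FV n x : x \in F n -> x^-1%g \in F n.
  by rewrite !FP !inE; apply: subgroupV; exact: generated_subgroup.
have FM n x y : x \in F n -> y \in F n -> (x * y)%g \in F n.
  by rewrite !FP !inE; apply: subgroupM; exact: generated_subgroup.
have SF n x : (f x < n)%N -> x \in F n.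
  move=> fx; rewrite FP inE; apply: sub_gen_smallest; rewrite /= SP.
  exact: fx.
exists F, 1%N; split; first exact: symmetric_seqP.
split; last first.
  move=> n; apply: approximate_group_const.
  apply: (@approximate_group_of_cover _ _ [fset 1%g]%fset) => //.
    by rewrite cardfs1.
  move=> x y xF yF; exists 1%g, (x^-1 * y)%g; rewrite inE mul1g; split=> //.
  by apply: FM => //; exact: FV.
split=> //.
- move=> n; apply/fsubsetP => x; rewrite !FP !inE; apply: smallest_sub.
    exact: generated_subgroup.
  move=> y /=; rewrite SP => fy; have := SF n.+1 y (leq_trans fy (leqnSn n)).
  by rewrite FP inE.
- rewrite -subTset => x _; exists (f x).+1 => //=; exact: SF.
move=> g; apply: cvg0_le (cvg_cst (0 : R)); near=> n.
have gF : g \in F n by apply: SF; near: n; exists (f g).+1.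
rewrite divr_ge0//= card_symdiff_translate.
rewrite (_ : (left_translate g (F n) `\` F n)%fset = fset0).
  by rewrite cardfs0 muln0 mul0r.
apply/eqP; rewrite fsetD_eq0; apply/fsubsetP => _ /imfsetP[x /= xF ->].
exact: FM.
Unshelve. all: by end_near. Qed.

End LocallyFinite.

(** ** Finitely generated abelian groups *)

Section Abelian.
Variables (R : realType) (G : groupType).
Hypothesis abG : abelian_group G.

Let mulCA (x y z : G) : (x * (y * z) = y * (x * z))%g.
Proof. by rewrite !mulgA (abG x y). Qed.

Let mulACA (x y z t : G) : ((x * y) * (z * t) = (x * z) * (y * t))%g.
Proof. by rewrite -!mulgA (mulCA y). Qed.

Lemma doubling_seq_mul (A B : nat -> {fset G}) L M :
  doubling_seq A L -> doubling_seq B M ->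
  doubling_seq (fun k => tiles (A k) (B k)) (L * M).
Proof.
move=> [A1 AV AM dblA] [B1 BV BM dblB]; split=> [k|k x|j k x y|k].
- by apply/tilesP; exists 1%g, 1%g; rewrite mulg1.
- move=> /tilesP[a [b [aA bB ->]]]; apply/tilesP.
  exists a^-1%g, b^-1%g; rewrite invgM abG; split=> //; [exact: AV|exact: BV].
- move=> /tilesP[a [b [aA bB ->]]] /tilesP[a' [b' [aA' bB' ->]]].
  apply/tilesP; exists (a * a')%g, (b * b')%g; rewrite mulACA; split=> //.
    exact: AM.
  exact: BM.
have [C [CL covC]] := dblA k; have [D [DM covD]] := dblB k.
exists (tiles C D); split.
  apply: (@leq_trans (#|` C| * #|` D|)); last exact: leq_mul.
  by apply: (card_subset_pairs (f := fun c d => (c * d)%g)) => x /tilesP.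
move=> x /tilesP[a [b [/covC[c [z [cC zA ->]]] /covD[d [w [dD wB ->]]] ->]]].
exists (c * d)%g, (z * w)%g; split; last exact: mulACA.
  by apply/tilesP; exists c, d.
by apply/tilesP; exists z, w.
Qed.

Definition cyclic_box (s : G) (k : nat) : {fset G} :=
  [fset s ^+ val p.1 * (s ^+ val p.2)^-1 | p in {: 'I_k.+1 * 'I_k.+1}]%fset%g.

Lemma cyclic_boxP s k x : reflect
  (exists i j, [/\ (i <= k)%N, (j <= k)%N & x = (s ^+ i * (s ^+ j)^-1)%g])
  (x \in cyclic_box s k).
Proof.
apply: (iffP idP) => [/imfsetP[[i j] _ ->]|[i [j [ik jk ->]]]].
  by exists (val i), (val j); split=> //; rewrite -ltnS; exact: ltn_ord.
by apply/imfsetP; exists (Ordinal (ik : (i < k.+1)%N), Ordinal (jk : (j < k.+1)%N)).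
Qed.

Lemma doubling_seq_cyclic s : doubling_seq (cyclic_box s) 4.
Proof.
split=> [k|k x|j k x y|k].
- by apply/cyclic_boxP; exists 0%N, 0%N; rewrite !expg0 mulgV.
- move=> /cyclic_boxP[i [j [ik jk ->]]]; apply/cyclic_boxP; exists j, i.
  by rewrite invgM invgK.
- move=> /cyclic_boxP[i [i' [ik ik' ->]]] /cyclic_boxP[l [l' [lk lk' ->]]].
  apply/cyclic_boxP; exists (i + l)%N, (i' + l')%N; rewrite !leq_add//; split=> //.
  by rewrite !expgnDr invgM mulACA (abG (s ^+ l')^-1%g).
pose c (e : bool * bool) : G := (s ^+ (e.1 * k) * (s ^+ (e.2 * k))^-1)%g.
exists [fset c e | e in {: bool * bool}]%fset; split.
  by rewrite (leq_trans (leq_imfset_card _ _ _))//= -cardE card_prod card_bool.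
have split i : (i <= k + k)%N ->
    exists (e : bool) i', (i' <= k)%N /\ i = (e * k + i')%N.
  move=> ik; have [h|h] := leqP i k; first by exists false, i.
  by exists true, (i - k)%N; split; lia.
move=> x /cyclic_boxP[i [j [/split[e [i' [ik ->]]] /split[d [j' [jk ->]]] ->]]].
exists (c (e, d)), (s ^+ i' * (s ^+ j')^-1)%g; split.
- by apply/imfsetP; exists (e, d).
- by apply/cyclic_boxP; exists i', j'.
- by rewrite /c !expgnDr invgM (abG (s ^+ j')^-1%g) mulACA.
Qed.

(** The boxes spanned by a finite generating set have bounded doubling. *)
Lemma sym_wafc_abelian : finitely_generated G -> sym_wafc R G.
Proof.
move=> [S genS].
have [A [L [dblA SA]]] : exists A L, doubling_seq A L /\
    forall s, s \in enum_fset S -> s \in A 1%N.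
  elim: (enum_fset S) => [|s ss [A [L [dblA sA]]]].
    exists (fun _ => [fset 1%g]%fset), 1%N; split=> //.
    split=> [k|k x|j k x y|k]; rewrite ?inE//.
    - by move=> /eqP ->; rewrite invg1.
    - by move=> /eqP -> /eqP ->; rewrite mul1g.
    exists [fset 1%g]%fset; rewrite cardfs1; split=> // x.
    by rewrite inE => /eqP ->; exists 1%g, 1%g; rewrite !inE mul1g.
  have [A1 _ _ _] := dblA; have [B1 _ _ _] := doubling_seq_cyclic s.
  exists (fun k => tiles (cyclic_box s k) (A k)), (4 * L)%N.
  split; first exact: doubling_seq_mul (doubling_seq_cyclic s) dblA.
  move=> t; rewrite inE => /orP[/eqP ->|/sA tA]; apply/tilesP.
    exists s, 1%g; rewrite mulg1; split=> //; apply/cyclic_boxP.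
    by exists 1%N, 0%N; rewrite expg1 expg0 invg1 mulg1.
  by exists 1%g, t; rewrite mul1g.
have [A1 AV AM _] := dblA.
apply: (sym_wafc_of_doubling _ dblA); rewrite -subTset -genS.
apply: smallest_sub; last by move=> s sS; exists 1%N => //; exact: SA.
split; first by exists 0%N => //=.
move=> x y [j _ xj] [k _ yk]; exists (j + k)%N => //=.
by apply: AM => //; exact: AV.
Qed.

End Abelian.

(** ** Heisenberg groups *)

Section Heisenberg.
Variables (R : realType) (n : nat).
Hypothesis n0 : (0 < n)%N.
Implicit Types x y z : heisenberg n.

(** Twice the central coordinate of [x] in exponential coordinates; inversion
    changes its sign. *)
Definition heis_center x : int := heis_c x *+ 2 - dotz (heis_a x) (heis_b x).

Let heis_aM x y : heis_a (x * y)%g = heis_a x + heis_a y. Proof. by []. Qed.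

Let heis_bM x y : heis_b (x * y)%g = heis_b x + heis_b y. Proof. by []. Qed.

Let heis_aV x : heis_a x^-1%g = - heis_a x. Proof. by []. Qed.

Let heis_bV x : heis_b x^-1%g = - heis_b x. Proof. by []. Qed.

Lemma heis_centerM x y : heis_center (x * y)%g = heis_center x + heis_center y
  + dotz (heis_a x) (heis_b y) - dotz (heis_a y) (heis_b x).
Proof.
rewrite /heis_center -[(x * y)%g]/(heis_mul x y) /= !dotzDl !dotzDr; ring.
Qed.

Lemma heis_centerV x : heis_center x^-1%g = - heis_center x.
Proof.
rewrite /heis_center -[(x^-1)%g]/(heis_inv x) /= dotzNl dotzNr; ring.
Qed.

Lemma normr_dotz (a b : 'rV[int]_n) (k l : nat) :
  (forall i, `|a 0 i| <= k%:Z) -> (forall i, `|b 0 i| <= l%:Z) ->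
  `|dotz a b| <= (n * (k * l))%N%:Z.
Proof.
move=> ak bl; apply: le_trans (ler_norm_sum _ _ _) _.
apply: (@le_trans _ _ (\sum_(i < n) (k * l)%N%:Z)).
  by apply: ler_sum => i _; rewrite normrM PoszM ler_pM.
by rewrite sumr_const card_ord -mulr_natl PoszM natz.
Qed.

(** Boxes in exponential coordinates, scaled by the dilations of the group. *)
Definition heis_box (k : nat) : set (heisenberg n) :=
  [set x | [/\ forall i, `|heis_a x 0 i| <= k%:Z,
               forall i, `|heis_b x 0 i| <= k%:Z &
               `|heis_center x| <= (n * (k * k))%N%:Z]].

Lemma heis_box_finite k : finite_set (heis_box k).
Proof.
pose M := (n * (k * k))%N.
pose T := ({ffun 'I_n -> 'I_(2 * k).+1} * {ffun 'I_n -> 'I_(2 * k).+1} *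
           'I_(2 * M).+1)%type.
pose b (t : T) : heisenberg n := Heisenberg
  (\row_i ((t.1.1 i)%:Z - k%:Z)) (\row_i ((t.1.2 i)%:Z - k%:Z)) (t.2%:Z - M%:Z).
apply: (@sub_finite_set _ _ (b @` setT)); last first.
  by apply: finite_image; exact: finite_finset.
move=> [va vb c] [/= ak bk ck].
have coord (z : int) (l : nat) :
    `|z| <= l%:Z -> exists i : 'I_(2 * l).+1, z = i%:Z - l%:Z.
  move=> zl; have h : (absz (z + l%:Z)%R < (2 * l).+1)%N by lia.
  by exists (Ordinal h) => /=; lia.
have /choice[u hu] := fun i => coord _ _ (ak i).
have /choice[v hv] := fun i => coord _ _ (bk i).
have [w hw] : exists w : 'I_(2 * M).+1, c = w%:Z - M%:Z.
  apply: coord; have := normr_dotz ak bk; rewrite -/M.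
  by move: ck; rewrite /heis_center /= -/M; lia.
exists ([ffun i => u i], [ffun i => v i], w) => //.
by rewrite /b /= -hw; congr Heisenberg; apply/rowP => i; rewrite mxE ffunE -?hu -?hv.
Qed.

Lemma heis_box_mul j k x y : heis_box j x -> heis_box k y ->
  heis_box (j + k) (x * y)%g.
Proof.
move=> [ax bx cx] [ay by_ cy]; split.
- move=> i; rewrite heis_aM mxE PoszD; apply: le_trans (ler_normD _ _) _.
  by apply: lerD; [exact: ax|exact: ay].
- move=> i; rewrite heis_bM mxE PoszD; apply: le_trans (ler_normD _ _) _.
  by apply: lerD; [exact: bx|exact: by_].
rewrite heis_centerM; have := normr_dotz ax by_; have := normr_dotz ay bx.
have -> : (n * ((j + k) * (j + k)) =
  n * (j * j) + n * (k * k) + n * (j * k) + n * (k * j))%N by ring.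
by move: cx cy; lia.
Qed.

Lemma heis_box_inv k x : heis_box k x -> heis_box k x^-1%g.
Proof.
move=> [ax bx cx]; split; last by rewrite heis_centerV normrN.
  by move=> i; rewrite heis_aV mxE normrN.
by move=> i; rewrite heis_bV mxE normrN.
Qed.

Lemma centering (u : int) (s : nat) : `|u| <= (9 * s)%N%:Z ->
  exists w : 'I_11, `|u - (2 * (w%:Z - 5) * s%:Z)| <= s%:Z.
Proof.
have [->|s0] := posnP s => us; first by exists ord0; rewrite mulr0 subr0.
have d0 : (2 * s)%N%:Z > 0 by lia.
pose q := ((u + s%:Z) %/ (2 * s)%N%:Z)%Z.
pose r := ((u + s%:Z) %% (2 * s)%N%:Z)%Z.
have E : u + s%:Z = q * (2 * s)%N%:Z + r by exact: divz_eq.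
have r0 : 0 <= r by apply: modz_ge0; rewrite gt_eqF.
have r1 : r < (2 * s)%N%:Z by exact: ltz_pmod.
have q1 : -5 <= q by nia.
have q2 : q <= 5 by nia.
have h : (absz (q + 5)%R < 11)%N by lia.
by exists (Ordinal h) => /=; rewrite gez0_abs; nia.
Qed.

(** The translating element is chosen in two steps. Signs bring the first two
    coordinates into the smaller box; the central value is then at most
    [9 n k^2], and [centering] corrects it by one of [11] multiples of
    [2 n k^2]. None of these choices depends on [k]. *)
Lemma heis_box_cover k : exists C : {fset heisenberg n},
  (#|` C| <= #|{: {ffun 'I_n -> bool} * {ffun 'I_n -> bool} * 'I_11}|)%N /\
  forall x, heis_box (k + k) x -> exists c z,
    [/\ c \in C, heis_box k z & x = (c * z)%g].
Proof.
pose sg (b : bool) : int := if b then k%:Z else - k%:Z.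
pose s := (n * (k * k))%N.
pose g (t : {ffun 'I_n -> bool} * {ffun 'I_n -> bool} * 'I_11) : heisenberg n :=
  Heisenberg (\row_i sg (t.1.1 i)) (\row_i sg (t.1.2 i)) ((t.2%:Z - 5) * s%:Z).
exists [fset g t | t in {: {ffun 'I_n -> bool} * {ffun 'I_n -> bool} * 'I_11}]%fset.
split; first by rewrite (leq_trans (leq_imfset_card _ _ _))//= -cardE.
move=> x [ax bx cx].
pose u := [ffun i => 0 <= heis_a x 0 i]; pose v := [ffun i => 0 <= heis_b x 0 i].
pose a := \row_i sg (u i); pose b := \row_i sg (v i).
have recenter (z : int) : `|z| <= (k + k)%N%:Z -> `|- sg (0 <= z) + z| <= k%:Z.
  by rewrite /sg; case: ifP; lia.
have sgk e : `|sg e| <= k%:Z by case: e; rewrite /sg; lia.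
have ak i : `|a 0 i| <= k%:Z by rewrite mxE.
have bk i : `|b 0 i| <= k%:Z by rewrite mxE.
have h1 := normr_dotz ak bk; have h2 := normr_dotz ak bx.
have h3 := normr_dotz ax bk.
have e2 : (n * ((k + k) * (k + k)) = 4 * s)%N by rewrite /s; ring.
have e3 : (n * (k * (k + k)) = 2 * s)%N by rewrite /s; ring.
have e4 : (n * ((k + k) * k) = 2 * s)%N by rewrite /s; ring.
rewrite e2 in cx; rewrite -/s in h1; rewrite e3 in h2; rewrite e4 in h3.
have [|w hw] := @centering
  (heis_center x + dotz a b - dotz a (heis_b x) + dotz (heis_a x) b) s.
  by lia.
pose c := g (u, v, w); exists c, (c^-1 * x)%g; split.
- by apply/imfsetP; exists (u, v, w).
- split.
  + by move=> i; rewrite heis_aM heis_aV !mxE /= ffunE; apply: recenter; exact: ax.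
  + by move=> i; rewrite heis_bM heis_bV !mxE /= ffunE; apply: recenter; exact: bx.
  + rewrite heis_centerM heis_centerV heis_aV heis_bV.
    rewrite dotzNl dotzNr /heis_center -/(heis_center x) /= -/a -/b -/s.
    by move: hw; lia.
- by rewrite mulVKg.
Qed.

Lemma sym_wafc_heisenberg : sym_wafc R (heisenberg n).
Proof.
pose A k := fset_set (heis_box k).
have AP k x : (x \in A k) = (x \in heis_box k).
  by rewrite in_fset_set//; exact: heis_box_finite.
have dblA : doubling_seq A
    #|{: {ffun 'I_n -> bool} * {ffun 'I_n -> bool} * 'I_11}|.
  split=> [k|k x|j k x y|k].
  - rewrite AP inE; split.
    + by move=> i; rewrite mxE normr0.
    + by move=> i; rewrite mxE normr0.
    + by rewrite /heis_center /= dotz0l.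
  - by rewrite !AP !inE; exact: heis_box_inv.
  - by rewrite !AP !inE; exact: heis_box_mul.
  - have [C [CL cov]] := heis_box_cover k; exists C; split=> // x.
    rewrite AP inE => /cov[c [z [cC zA ->]]]; exists c, z; split=> //.
    by rewrite AP inE.
apply: (sym_wafc_of_doubling _ dblA); rewrite -subTset => x _.
pose k := (\sum_(i < n) absz (heis_a x 0%R i) +
  \sum_(i < n) absz (heis_b x 0%R i) + absz (heis_center x) + 1)%N.
exists k => //=; rewrite AP inE; split.
- move=> i; have : (absz (heis_a x 0%R i) <= k)%N.
    by rewrite /k (bigD1 i)//=; lia.
  by lia.
- move=> i; have : (absz (heis_b x 0%R i) <= k)%N.
    by rewrite /k (bigD1 i (P := xpredT) (F := fun i => absz (heis_b x 0%R i)))//=; lia.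
  by lia.
have : (absz (heis_center x) <= k)%N by rewrite /k; lia.
have : (0 < k)%N by rewrite /k addn1.
by move: n0 => n0' k0; nia.
Qed.

End Heisenberg.

Section HeisenbergProduct.
Variables (n : nat) (G1 : groupType).
Local Notation G := (heisenberg n * G1)%type.

Let central (k : nat) : G := (Heisenberg 0 0 k%:Z, 1%g).

Let infinite_central (P : set G) : (forall k, P (central k)) -> infinite_set P.
Proof.
move=> Pc finP; apply: infinite_nat.
rewrite (_ : [set: nat] = central @^-1` P); last first.
  by apply/seteqP; split=> // k _; exact: Pc.
by apply: finite_preimage => // i j _ _ [].
Qed.

Lemma heisenberg_prod_infinite : infinite_set [set: G].
Proof. exact: infinite_central. Qed.

Lemma heisenberg_prod_centralizer (S : {fset G}) :
  infinite_set (centralizer S).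
Proof.
apply: infinite_central => k -[[a b c] h] _; congr (_, _).
  rewrite -[LHS]/(heis_mul (Heisenberg 0 0 k%:Z) (Heisenberg a b c)).
  rewrite -[RHS]/(heis_mul (Heisenberg a b c) (Heisenberg 0 0 k%:Z)).
  by rewrite /heis_mul /= !add0r !addr0 dotz0l dotz0r !addr0 addrC.
by rewrite /= mulg1 mul1g.
Qed.

Lemma heisenberg_prod_countable :
  countable [set: G1] -> countable [set: G].
Proof.
move=> cG1; rewrite -setXTT; apply: countableX => //.
apply/countable_injP; exists (fun x => choice.pickle (heis_to_triple x)) => x y _ _.
by move/(pcan_inj choice.pickleK)/(can_inj (@heis_to_tripleK n)).
Qed.

End HeisenbergProduct.

Theorem theoremE (R : realType) :
  (forall (G : groupType) (F : nat -> {fset G}) (LG : nat),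
      group_hypotheses R F LG -> edim_bound R F LG)
  /\
  (forall (n : nat) (G1 : groupType),
      (0 < n)%N ->
      countable [set: G1]%classic ->
      [\/ finite_set [set: G1]%classic,
          finitely_generated G1 /\ abelian_group G1,
          locally_finite G1
        | exists (F1 : nat -> {fset G1}) (L1 : nat),
            symmetric_seq F1 /\ WAFC R F1 L1] ->
      exists (F : nat -> {fset (heisenberg n * G1)%type}) (LG : nat),
        group_hypotheses R F LG /\ edim_bound R F LG).
Proof.
split=> [G F LG [_ infG _ symF wafc]|n G1 n0 cG1 cases].
  exact: edim_bound_of_WAFC.
have wG1 : sym_wafc R G1.
  case: cases => [finG1|[fgG1 abG1]|lfG1|//].
  - apply: sym_wafc_locally_finite => // S.
    exact: sub_finite_set (@subsetT _ _) finG1.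
  - exact: sym_wafc_abelian.
  - exact: sym_wafc_locally_finite.
have [F [LG [symF wafc]]] := sym_wafc_prod (sym_wafc_heisenberg R n0) wG1.
have infG := @heisenberg_prod_infinite n G1.
exists F, LG; split; last exact: edim_bound_of_WAFC.
split=> //; first exact: heisenberg_prod_countable.
exact: heisenberg_prod_centralizer.
Qed.
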